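(* Let $n\ge 1$ be an integer and let $q\in(1,\infty)$. Then the sequence $\{S_{\mathbf k}\}_{\mathbf k\in\mathbb N^n}$, enumerated by the square ordering of $\mathbb N^n$, is a Schauder basis of the real Lebesgue space $L_q((0,1)^n)$.
   Context: Let $S(t)=2t$ for $0\le t\le \frac12$ and $S(t)=2(1-t)$ for $\frac12<t\le 1$, and extend $S$ to $\mathbb R$ by $S(t)=(-1)^{\lfloor t\rfloor}S(t-\lfloor t\rfloor)$ (so $S$ is odd and $2$-periodic). Let $\mathbb N=\{1,2,\dots\}$. For $\mathbf k=(k_1,\dots,k_n)\in\mathbb N^n$ put $S_{\mathbf k}(x)=S(k_1x_1)\cdots S(k_nx_n)$, $x\in(0,1)^n$. The square ordering $\sigma_2:\mathbb N\to\mathbb N^2$ of $\mathbb N^2$ lists the pairs as follows: for $N=1,2,3,\dots$ successively, list the pairs with maximum entry equal to $N$ in the order $(1,N),(2,N),\dots,(N,N),(N,N-1),\dots,(N,1)$; thus $(1,1),(1,2),(2,2),(2,1),(1,3),(2,3),(3,3),(3,2),(3,1),\dots$. The square ordering of $\mathbb N^n$ is obtained by iteration: $\sigma_1=\mathrm{id}$ and, for $n\ge 2$, $\sigma_n(k)=(\sigma_{n-1}(a),b)\in\mathbb N^{n-1}\times\mathbb N$, where $(a,b)=\sigma_2(k)$. A sequence $(\varphi_j)_{j=1}^\infty$ in a Banach space $X$ is a Schauder basis of $X$ if for every $x\in X$ there is a unique sequence of scalars $(\alpha_j)_{j=1}^\infty$ such that $x=\sum_{j=1}^\infty\alpha_j\varphi_j$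 (norm convergence of the partial sums in the given order). *)

(* Defs.v *)
From HB Require Import structures.
From mathcomp Require Import all_boot all_order all_algebra lra.
From mathcomp Require Import all_classical all_reals all_analysis.
From mathcomp Require Import measurable_realfun ess_sup_inf.

Set Implicit Arguments.
Unset Strict Implicit.
Unset Printing Implicit Defensive.
Import Order.TTheory GRing.Theory Num.Theory.
Import numFieldNormedType.Exports.

Local Open Scope classical_set_scope.
Local Open Scope ring_scope.

(* The library's [LspaceType mu p1] (a.e. classes of measurable functions with
   finite L^p norm) has no algebraic structure; we equip it with its usual one,
   a normed module whose norm is ['N[mu]_p]. [Lclass f] is the class of an
   L^p function [f], [Lrepr u] a representative of the class [u]. *)
Section Lspace_normed.
Context d (T : measurableType d) (R : realType).
Variables (mu : {measure set T -> \bar R}) (p : \bar R) (p1 : (1 <= p)%E).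
Local Open Scope quotient_scope.
Local Notation Q := ({mfun_ mu, T >-> measurableTypeR R}).
Implicit Types (f g : LfunType mu p1) (u v w : LspaceType mu p1).

Lemma Lspace_Lfun u : (u : T -> R) \in Lfun mu p.
Proof.
apply/andP; split; rewrite inE/=.
- exact: (@measurable_funPT _ _ _ _ (repr (u : Q))).
- exact: Lebesgue_finite.
Qed.

Definition Lrepr u : LfunType mu p1 := Lfun_Sub p1 (Lspace_Lfun u).

Definition Lclass_mfun f : {mfun T >-> measurableTypeR R} :=
  HB.pack_for {mfun T >-> measurableTypeR R} (f : T -> R)
    (@isMeasurableFun.Build _ _ T (measurableTypeR R) f
      (@measurable_funPT _ _ _ _ f)).

Lemma Lclass_ae f : ((\pi_Q (Lclass_mfun f) : Q) : T -> R) = f %[ae mu].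
Proof.
have : \pi_Q (repr (\pi_Q (Lclass_mfun f))) = \pi_Q (Lclass_mfun f).
  by rewrite reprK.
by move=> /eqP; rewrite eqmodE => /asboolP.
Qed.

Lemma eq_ae_Lnorm (f g : T -> R) :
  measurable_fun setT f -> measurable_fun setT g ->
  f = g %[ae mu] -> ('N[mu]_p[EFin \o f] = 'N[mu]_p[EFin \o g])%E.
Proof.
move=> mf mg fg; rewrite unlock /Lnorm.
have mpow (h : T -> R) r : measurable_fun setT h ->
    measurable_fun setT (fun x => (`|(EFin \o h) x| `^ r)%E).
  move=> mh; apply/measurable_EFinP.
  apply: (@measurableT_comp _ _ _ _ _ _ (@powR R ^~ r)) => //.
  exact: measurableT_comp.
move: p1; case: p => [r|_|r1].
- move=> _; apply: (f_equal (fun z => poweR z r^-1)).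
  apply: ae_eq_integral => //; [exact: mpow|exact: mpow|].
  by apply: filterS fg => x /= /[apply] ->.
- case: ifPn => // _; apply: eq_ess_sup.
  by apply: filterS fg => x /= /(_ I) ->.
- by rewrite leeNy_eq in r1.
Qed.

Lemma Lclass_finite f : finite_norm mu p ((\pi_Q (Lclass_mfun f)) : Q).
Proof.
rewrite /finite_norm (@eq_ae_Lnorm _ f) //.
- exact: Lfunction_finite.
- exact: (@measurable_funPT _ _ _ _ (repr (\pi_Q (Lclass_mfun f)))).
- exact: Lclass_ae.
Qed.

Definition Lclass f : LspaceType mu p1 :=
  HB.pack_for (LspaceType mu p1) (\pi_Q (Lclass_mfun f))
    (@isFinLebesgue.Build _ _ _ mu p p1 (\pi_Q (Lclass_mfun f))
      (Lclass_finite f)).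

Lemma Lclass_repr_ae f : (Lrepr (Lclass f) : T -> R) = f %[ae mu].
Proof. exact: Lclass_ae. Qed.

Lemma Lspace_eq u v : (u : Q) = v -> u = v.
Proof.
case: u v => u [[uf]] [v [[vf]]] /= uv; subst v.
by rewrite (Prop_irrelevance uf vf).
Qed.

Lemma LspaceP u v : (u : T -> R) = v %[ae mu] -> u = v.
Proof.
move=> uv; apply: Lspace_eq.
by rewrite -[LHS]reprK -[RHS]reprK; apply/eqP; rewrite eqmodE; apply/asboolP.
Qed.

Lemma LclassP f g : (f : T -> R) = g %[ae mu] <-> Lclass f = Lclass g.
Proof.
split=> [fg|fg].
  apply: LspaceP; apply: ae_eq_trans (Lclass_repr_ae f) _.
  by apply: ae_eq_trans fg _; apply: ae_eq_sym; exact: Lclass_repr_ae.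
apply: ae_eq_trans (Lclass_repr_ae g); rewrite -fg.
by apply: ae_eq_sym; exact: Lclass_repr_ae.
Qed.

Lemma LreprK : cancel Lrepr Lclass.
Proof. by move=> u; apply: LspaceP; exact: Lclass_repr_ae. Qed.

HB.instance Definition _ := gen_eqMixin (LspaceType mu p1).
HB.instance Definition _ := gen_choiceMixin (LspaceType mu p1).

Definition Lspace_zero : LspaceType mu p1 := Lclass 0.
Definition Lspace_opp u := Lclass (- Lrepr u).
Definition Lspace_add u v := Lclass (Lrepr u + Lrepr v).
Definition Lspace_scale (a : R) u := Lclass (a *: Lrepr u).
Definition Lspace_norm u : R := fine ('N[mu]_p[EFin \o (u : T -> R)])%E.

Lemma Lclass_oppE f : Lspace_opp (Lclass f) = Lclass (- f).
Proof.
apply/LclassP; have := Lclass_repr_ae f.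
by apply: filterS => x /= /[apply] fx; congr (- _).
Qed.

Lemma Lclass_addE f g : Lspace_add (Lclass f) (Lclass g) = Lclass (f + g).
Proof.
apply/LclassP; have := Lclass_repr_ae f; have := Lclass_repr_ae g.
by apply: filterS2 => x /= gx fx D; congr (_ + _); [exact: fx|exact: gx].
Qed.

Lemma Lclass_scaleE a f : Lspace_scale a (Lclass f) = Lclass (a *: f).
Proof.
apply/LclassP; have := Lclass_repr_ae f.
by apply: filterS => x /= /[apply] fx; congr (_ *: _).
Qed.

Lemma Lclass_normE f : Lspace_norm (Lclass f) = fine ('N[mu]_p[EFin \o f])%E.
Proof.
congr fine; apply: eq_ae_Lnorm => //; last exact: Lclass_ae.
exact: (@measurable_funPT _ _ _ _ (Lrepr (Lclass f))).
Qed.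

Lemma Lspace_ind (P : LspaceType mu p1 -> Prop) :
  (forall f, P (Lclass f)) -> forall u, P u.
Proof. by move=> Pf u; rewrite -(LreprK u). Qed.

Let addA : associative Lspace_add.
Proof.
elim/Lspace_ind=> f; elim/Lspace_ind=> g; elim/Lspace_ind=> h.
by rewrite !Lclass_addE addrA.
Qed.
Let addC : commutative Lspace_add.
Proof.
by elim/Lspace_ind=> f; elim/Lspace_ind=> g; rewrite !Lclass_addE addrC.
Qed.
Let add0 : left_id Lspace_zero Lspace_add.
Proof. by elim/Lspace_ind=> f; rewrite Lclass_addE add0r. Qed.
Let addN : left_inverse Lspace_zero Lspace_opp Lspace_add.
Proof. by elim/Lspace_ind=> f; rewrite Lclass_oppE Lclass_addE addNr. Qed.

HB.instance Definition _ :=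
  GRing.isZmodule.Build (LspaceType mu p1) addA addC add0 addN.

Let addE u v : u + v = Lspace_add u v.
Proof. by []. Qed.

Let scaleA a b u : Lspace_scale a (Lspace_scale b u) = Lspace_scale (a * b) u.
Proof. by elim/Lspace_ind: u => f; rewrite !Lclass_scaleE scalerA. Qed.
Let scale1 : left_id 1 Lspace_scale.
Proof. by elim/Lspace_ind=> f; rewrite Lclass_scaleE scale1r. Qed.
Let scaleDr : right_distributive Lspace_scale +%R.
Proof.
move=> a; elim/Lspace_ind=> f; elim/Lspace_ind=> g.
by rewrite !addE Lclass_addE !Lclass_scaleE Lclass_addE scalerDr.
Qed.
Let scaleDl u : {morph Lspace_scale^~ u : a b / a + b}.
Proof.
elim/Lspace_ind: u => f a b.
by rewrite addE !Lclass_scaleE Lclass_addE scalerDl.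
Qed.

HB.instance Definition _ := GRing.Zmodule_isLmodule.Build R (LspaceType mu p1)
  scaleA scale1 scaleDr scaleDl.

Let normD u v : Lspace_norm (u + v) <= Lspace_norm u + Lspace_norm v.
Proof.
elim/Lspace_ind: u => f; elim/Lspace_ind: v => g.
rewrite addE Lclass_addE.
by rewrite !Lclass_normE; exact: ler_LnormD.
Qed.

Let normZ a u : Lspace_norm (a *: u) = `|a| * Lspace_norm u.
Proof.
elim/Lspace_ind: u => f.
rewrite (_ : _ *: _ = Lclass (a *: f)); last exact: Lclass_scaleE.
rewrite !Lclass_normE; apply: EFin_inj.
by rewrite EFinM !finite_norm_fine LnormZ.
Qed.

Let norm0 u : Lspace_norm u = 0 -> u = 0.
Proof.
elim/Lspace_ind: u => f; rewrite Lclass_normE => f0.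
by apply/LclassP; exact: fine_Lnormr_eq0.
Qed.

HB.instance Definition _ := @Lmodule_isNormed.Build R (LspaceType mu p1)
  Lspace_norm normD normZ norm0.

Lemma LspaceD f g : Lclass f + Lclass g = Lclass (f + g).
Proof. exact: Lclass_addE. Qed.
Lemma LspaceZ a f : a *: Lclass f = Lclass (a *: f).
Proof. exact: Lclass_scaleE. Qed.
Lemma Lspace_normE f : `|Lclass f| = fine ('N[mu]_p[EFin \o f])%E.
Proof. exact: Lclass_normE. Qed.
End Lspace_normed.

Definition schauder_basis (K : numFieldType) (X : normedModType K)
    (phi : nat -> X) : Prop :=
  forall x : X, exists! a : nat -> K,
    [series a j *: phi j]_j @ \oo --> x.

(* n-dimensional Lebesgue measure, on the product (Borel) sigma-algebra of
   [n.-tuple R], built by iterating the binary product of measures and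
   transporting it along [cons]; see [lebesgue_tuple_box]. *)
Section lebesgue_tuple.
Variable R : realType.
Local Notation RR := (measurableTypeR R).

Definition consp n (z : RR * n.-tuple RR) : n.+1.-tuple RR :=
  cons_tuple z.1 z.2.

Definition unconsp n (t : n.+1.-tuple RR) : RR * n.-tuple RR :=
  (thead t, behead_tuple t).

Lemma conspK n : cancel (@consp n) (@unconsp n).
Proof. by case=> a t; congr (_, _); apply: val_inj. Qed.

Lemma unconspK n : cancel (@unconsp n) (@consp n).
Proof. by move=> t; rewrite [RHS]tuple_eta; apply: val_inj. Qed.

Lemma measurable_consp n : measurable_fun setT (@consp n).
Proof. by apply: measurable_cons. Qed.

Lemma measurable_unconsp n : measurable_fun setT (@unconsp n).
Proof.
apply/measurable_fun_pairP; split.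
- exact: measurable_tnth.
- exact: measurable_behead.
Qed.

Section step.
Variables (n : nat) (m : {sigma_finite_measure set (n.-tuple RR) -> \bar R}).

Definition lebesgue_cons : set (n.+1.-tuple RR) -> \bar R :=
  pushforward (lebesgue_measure \x m)%E (@consp n).

Let l0 : lebesgue_cons set0 = 0%E.
Proof. by rewrite /lebesgue_cons /pushforward preimage_set0 measure0. Qed.

Let l_ge0 A : (0 <= lebesgue_cons A)%E.
Proof. by rewrite /lebesgue_cons /pushforward measure_ge0. Qed.

Let mcons A : measurable A -> measurable (@consp n @^-1` A).
Proof.
by move=> mA; rewrite -[X in measurable X]setTI; exact: measurable_consp.
Qed.

Let l_semi_sigma_additive : semi_sigma_additive lebesgue_cons.
Proof.
move=> F mF tF mUF; rewrite /lebesgue_cons /pushforward preimage_bigcup.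
apply: measure_semi_sigma_additive.
- by move=> k; exact: mcons.
- apply/trivIsetP => /= i j _ _ ij; rewrite -preimage_setI.
  by move/trivIsetP : tF => /(_ _ _ _ _ ij) ->//; rewrite preimage_set0.
- by rewrite -preimage_bigcup; exact: mcons.
Qed.

HB.instance Definition _ := isMeasure.Build _ _ _ lebesgue_cons
  l0 l_ge0 l_semi_sigma_additive.

Let sf : sigma_finite setT lebesgue_cons.
Proof.
have /sigma_finiteP[F [TF ndF Foo]] := sigma_finiteT (@lebesgue_measure R).
have /sigma_finiteP[G [TG ndG Goo]] := sigma_finiteT m.
exists (fun k => @unconsp n @^-1` (F k `*` G k)).
  rewrite -preimage_bigcup -[LHS](@preimage_setT _ _ (@unconsp n)).
  congr (_ @^-1` _).
  rewrite -setXTT TF TG predeqE => -[x y]; split.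
    move=> [/= [i _ Fnx] [j _ Gky]]; exists (maxn i j) => //; split.
    - by move: x Fnx; exact/subsetPset/ndF/leq_maxl.
    - by move: y Gky; exact/subsetPset/ndG/leq_maxr.
  by move=> [i _ []/= ? ?]; split; exists i.
move=> k; have [mF Fy] := Foo k; have [mG Gy] := Goo k; split.
  rewrite -[X in measurable X]setTI; apply: measurable_unconsp => //.
  exact: measurableX.
rewrite /lebesgue_cons /pushforward -comp_preimage.
rewrite (_ : _ \o _ = id) ?preimage_id; last first.
  by apply/funext=> z /=; rewrite conspK.
by rewrite product_measure1E// lte_mul_pinfty// ge0_fin_numE.
Qed.

HB.instance Definition _ :=
  Measure_isSigmaFinite.Build _ _ _ lebesgue_cons sf.
End step.

Fixpoint lebesgue_tuple (n : nat) :
    {sigma_finite_measure set (n.-tuple RR) -> \bar R} :=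
  match n with
  | 0 => [the {sigma_finite_measure set _ -> \bar R} of dirac [tuple]]
  | n'.+1 => [the {sigma_finite_measure set _ -> \bar R} of
                lebesgue_cons (lebesgue_tuple n')]
  end.

Definition box n (A : 'I_n -> set RR) : set (n.-tuple RR) :=
  [set x | forall i, A i (tnth x i)].

Lemma measurable_box n (A : 'I_n -> set RR) :
  (forall i, measurable (A i)) -> measurable (box A).
Proof.
move=> mA.
rewrite (_ : box A = \big[setI/setT]_(i < n) ((@tnth _ _ ^~ i) @^-1` A i)).
  apply: bigsetI_measurable => i _; rewrite -[X in measurable X]setTI.
  exact: measurable_tnth.
rewrite -bigcap_seq; apply/seteqP; split=> x /=.
  by move=> xA i _; exact: xA.
by move=> xA i; apply: xA; rewrite /= mem_index_enum.
Qed.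

Lemma lebesgue_tuple_box n (A : 'I_n -> set RR) :
  (forall i, measurable (A i)) ->
  (lebesgue_tuple n (box A) = \prod_(i < n) lebesgue_measure (A i))%E.
Proof.
elim: n A => [|n IH] A mA.
  by rewrite big_ord0 /= diracE mem_set// => -[].
rewrite big_ord_recl /= /lebesgue_cons /pushforward.
rewrite (_ : _ @^-1` _ = A ord0 `*` box (fun i => A (lift ord0 i))).
  by rewrite product_measure1E// ?IH//; exact: measurable_box.
apply/seteqP; split=> -[a t] /=.
  move=> h; split; first by have := h ord0; rewrite /consp tnth0.
  by move=> i; have := h (lift ord0 i); rewrite /consp tnthS.
move=> [h0 h] i; case: (unliftP ord0 i) => [j ->|->].
  by rewrite /consp tnthS; exact: h.
by rewrite /consp tnth0.
Qed.

Definition unit_cube n : set (n.-tuple RR) :=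
  [set x | forall i, 0 < (tnth x i : R) < 1].

Arguments unit_cube : clear implicits.

Lemma unit_cubeE n : unit_cube n = box (fun=> `]0%R, 1%R[%classic).
Proof. by apply/seteqP; split=> x xA i /=; have := xA i; rewrite /= in_itv. Qed.

Lemma measurable_unit_cube n : measurable (unit_cube n).
Proof.
by rewrite unit_cubeE; apply: measurable_box => i; exact: measurable_itv.
Qed.

Arguments measurable_unit_cube : clear implicits.

(* L_q((0,1)^n) is taken as L_q of R^n for Lebesgue measure restricted to the
   cube. *)
Definition cube_measure n : set (n.-tuple RR) -> \bar R :=
  mrestr (lebesgue_tuple n) (measurable_unit_cube n).
Arguments cube_measure : clear implicits.

HB.instance Definition _ n := Measure.on (cube_measure n).

Lemma cube_measureT n : cube_measure n setT = 1%E.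
Proof.
rewrite /cube_measure /mrestr setTI unit_cubeE lebesgue_tuple_box; last first.
  by move=> i; exact: measurable_itv.
rewrite big1// => i _.
by rewrite lebesgue_measure_itv/= lte_fin ltr01 oppr0 adde0.
Qed.
HB.instance Definition _ n :=
  Measure_isProbability.Build _ _ _ (cube_measure n) (cube_measureT n).
End lebesgue_tuple.
Arguments unit_cube : clear implicits.
Arguments measurable_unit_cube : clear implicits.
Arguments cube_measure : clear implicits.
Arguments cube_measureT : clear implicits.

(* Multi-indices have entries in {1, 2, ...} and enumerations start at k = 1:
   [sigma2 k] is the k-th item of the concatenation of the successive shells
   {max = N}; its value at k = 0 is irrelevant. *)
Definition square_shell (N : nat) : seq (nat * nat) :=
  [seq (i, N) | i <- iota 1 N] ++ [seq (N, i) | i <- rev (iota 1 N.-1)].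

Definition square_list (N : nat) : seq (nat * nat) :=
  flatten [seq square_shell M | M <- iota 1 N].

Definition sigma2 (k : nat) : nat * nat :=
  nth (0, 0)%N (square_list k) k.-1.

(* [square_orderS m] is the ordering of multi-indices of length m + 1. *)
Fixpoint square_orderS (m k : nat) : m.+1.-tuple nat :=
  if m is m'.+1 then
    let ab := sigma2 k in rcons_tuple (square_orderS m' ab.1) ab.2
  else [tuple k].

Definition square_order (n : nat) : nat -> n.-tuple nat :=
  if n is m.+1 then square_orderS m else fun=> [tuple].

Section triangle_system.
Variable R : realType.
Local Notation RR := (measurableTypeR R).

Definition tent (t : R) : R := if t <= 2^-1 then 2 * t else 2 * (1 - t).
Definition triangle_wave (t : R) : R :=
  (-1) ^ Num.floor t * tent (t - (Num.floor t)%:~R).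

Lemma measurable_tent : measurable_fun setT tent.
Proof.
apply: measurable_fun_ifT => /=.
- by apply: measurable_fun_ler.
- by apply: measurable_funM.
- by apply: measurable_funM => //; exact: measurable_funB.
Qed.

Lemma measurable_triangle_wave : measurable_fun setT triangle_wave.
Proof.
pose E (i : nat) : set R :=
  if @choice.unpickle int i is Some m then `[m%:~R, (m + 1)%:~R[%classic
  else set0.
have UE : \bigcup_i E i = setT.
  apply/seteqP; split => // t _.
  exists (choice.pickle (Num.floor t)) => //.
  rewrite /E choice.pickleK /= in_itv/=.
  by rewrite floor_le floorD1_gt.
rewrite -UE; apply/measurable_fun_bigcup => i.
  by rewrite /E; case: choice.unpickle => // m; exact: measurable_itv.
rewrite /E; case: choice.unpickle => [m|]; last exact: measurable_fun_set0.
apply: (eq_measurable_fun (fun t : R => ((-1) ^ m * tent (t - m%:~R) : R))).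
  move=> t; rewrite inE/= in_itv/= => /floor_def.
  by rewrite /triangle_wave => ->.
apply: measurable_funTS; apply: measurable_funM => //.
by apply: (measurableT_comp measurable_tent); exact: measurable_funB.
Qed.

Lemma triangle_wave_le1 t : `|triangle_wave t| <= 1.
Proof.
have sgn m : `|(-1) ^ m : R| = 1.
  by case: m => k; rewrite /exprz ?normfV normrX normrN1 expr1n ?invr1.
rewrite /triangle_wave normrM sgn mul1r.
have : 0 <= t - (Num.floor t)%:~R < 1.
  by rewrite subr_ge0 floor_le ltrBlDl; have := floorD1_gt t; rewrite intrD.
move: (_ - _) => s /andP[s0 s1]; rewrite /tent ler_norml.
by case: (leP s 2^-1) => h; apply/andP; split; lra.
Qed.

Definition triangle_prod n (k : n.-tuple nat) (x : n.-tuple RR) : R :=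
  \prod_(i < n) triangle_wave ((tnth k i)%:R * tnth x i).

Lemma measurable_triangle_prod n (k : n.-tuple nat) :
  measurable_fun setT (triangle_prod k).
Proof.
apply: measurable_prod => i _.
apply: (measurableT_comp measurable_triangle_wave).
apply: measurable_funM => //; exact: measurable_tnth.
Qed.

Lemma triangle_prod_le1 n (k : n.-tuple nat) x : `|triangle_prod k x| <= 1.
Proof.
rewrite normr_prod; apply: prodr_ile1 => i _.
by rewrite normr_ge0 triangle_wave_le1.
Qed.

Lemma triangle_prod_Lfun n (k : n.-tuple nat) q :
  1 <= q -> triangle_prod k \in Lfun (cube_measure R n) q%:E.
Proof.
move=> q1; apply/andP; split; rewrite inE/=.
  exact: measurable_triangle_prod.
have q0 : 0 < q by exact: lt_le_trans q1.
rewrite /finite_norm unlock poweR_lty//.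
apply: (@le_lt_trans _ _ (\int[cube_measure R n]_x (cst 1%E x))%E); last first.
  rewrite integral_cst// mul1e; have := ltry (1 : R).
  by rewrite -(cube_measureT R n).
apply: ge0_le_integral => //.
- by move=> x _; apply: poweR_ge0.
- apply/measurable_EFinP.
  apply: (@measurableT_comp _ _ _ _ _ _ (@powR R ^~ q)) => //.
  by apply: measurableT_comp => //; exact: measurable_triangle_prod.
- move=> x _ /=; rewrite lee_fin (le_trans (y := 1 `^ q))//; last first.
    by rewrite powR1.
  by rewrite ge0_ler_powR ?nnegrE ?triangle_prod_le1// ltW.
Qed.

Lemma ltr1_lee1_fin (q : R) : 1 < q -> (1 <= q%:E)%E.
Proof. by move=> /ltW; rewrite lee_fin. Qed.

Definition Lq_cube n (q : R) (q1 : 1 < q) : normedModType R :=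
  LspaceType (cube_measure R n) (ltr1_lee1_fin q1).

Definition triangle_Lq n (q : R) (q1 : 1 < q) (k : n.-tuple nat) :
    Lq_cube n q1 :=
  Lclass (Lfun_Sub (ltr1_lee1_fin q1) (triangle_prod_Lfun k (ltW q1))).

End triangle_system.

(* Main.v *)
(* The indices preceding a given one in the square ordering are a Boolean
   combination of a bounded number of slabs [k_i <= N]. By Fubini, it is thus
   enough to bound in L_q(0,1), uniformly in [N], the partial sums of sums of
   [c_k S(k x)]. There the triangle wave is a small perturbation of a sine:
   up to a constant, [S(x)] is [sin (pi x)] plus sines of total weight
   [1/9 + 1/25 + ... <= 1/4], so that replacing [S(k x)] by [sin (k pi x)] gives
   equivalent norms, and the partial sums of sine series are bounded by
   M. Riesz's theorem on conjugate functions: the circular means of a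
   subharmonic function of an analytic polynomial [u + iv] increase with the
   radius, and comparing them at radii 0 and 1 bounds the norm of [v] by that
   of [u].
   As for density, triangle sums approximate uniformly the functions
   [P (cos (pi x)) * sin (pi x)], hence in L_q those of the form
   [1_(x < c) * sin (pi x)]; a monotone class argument then shows that
   everything of the form [h (x) * \prod_i sin (pi x_i)] is in the closed span. *)
Require Import Defs.
From HB Require Import structures.
From mathcomp Require Import all_boot all_order all_algebra ring lra zify.
From mathcomp Require Import all_classical all_reals all_analysis.
From mathcomp Require Import measurable_realfun.

Set Implicit Arguments.
Unset Strict Implicit.
Unset Printing Implicit Defensive.
Import Order.TTheory GRing.Theory Num.Theory.
Import numFieldNormedType.Exports.

Local Open Scope classical_set_scope.
Local Open Scope ring_scope.

(** * Real analysis *)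

(** Riesz's inequality is obtained for every exponent without duality or interpolation. For [p <= 2]
    a multiple of the power of [u ^ 2] minus the power of [u ^ 2 + v ^ 2] is, after regularisation,
    subharmonic; for [p > 2] the Laplacians compare the wrong way, and a product of [u ^ 2] with a
    power of [u ^ 2 + v ^ 2] replaces the first term. Triangles can be compared with sines because
    dilation by an integer preserves the L_p norm over (0,1) of an odd 2-periodic function. The
    operator producing the higher harmonics is therefore a signed combination of isometries of total
    weight at most 1/4, small enough to absorb the factors [2 ^ p] lost in each use of a crude
    triangle inequality for p-th powers. For density, every triangle sum vanishes as soon as one
    coordinate is an integer, so constants cannot be approximated uniformly. This imposes the weight
    [sin (pi x)] in each coordinate; being positive on the open cube, it can be divided out at the
    very end. *)

Section continuity.
Context {R : realType} {T : topologicalType}.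
Implicit Types f g : T -> R.

Lemma continuous_cst_fun c : continuous (fun _ : T => c : R).
Proof. by move=> x; exact: cvg_cst. Qed.

Lemma continuousD_fun f g : continuous f -> continuous g ->
  continuous (fun x => f x + g x).
Proof. by move=> cf cg x; apply: cvgD; [exact: cf|exact: cg]. Qed.

Lemma continuousN_fun f : continuous f -> continuous (fun x => - f x).
Proof. by move=> cf x; apply: cvgN; exact: cf. Qed.

Lemma continuousM_fun f g : continuous f -> continuous g ->
  continuous (fun x => f x * g x).
Proof. by move=> cf cg x; apply: cvgM; [exact: cf|exact: cg]. Qed.

Lemma continuousX_fun f n : continuous f -> continuous (fun x => f x ^+ n).
Proof.
move=> cf; elim: n => [|n IH].
  by under eq_fun do rewrite expr0; exact: continuous_cst_fun.
by under eq_fun do rewrite exprS; exact: continuousM_fun.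
Qed.

Lemma continuous_sum_seq (I : Type) (s : seq I) (F : I -> T -> R) :
  (forall i, continuous (F i)) -> continuous (fun x => \sum_(i <- s) F i x).
Proof.
move=> cF; elim: s => [|i s IH].
  by under eq_fun do rewrite big_nil; exact: continuous_cst_fun.
by under eq_fun do rewrite big_cons; exact: continuousD_fun.
Qed.

Lemma continuous_comp_fun (U : topologicalType) (h : R -> U) f :
  continuous h -> continuous f -> continuous (fun x => h (f x)).
Proof. by move=> ch cf x; apply: continuous_comp; [exact: cf|exact: ch]. Qed.

Lemma continuous_powR_fun f p : (forall x, 0 < f x) -> continuous f ->
  continuous (fun x => f x `^ p).
Proof.
move=> f0 cf x; apply: (continuous_comp (g := fun y => y `^ p)); first exact: cf.
have [d _] := is_derive1_powR p (f0 x).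
by apply: differentiable_continuous; exact/derivable1_diffP.
Qed.
End continuity.

(** * Derivatives and integrals of functions of one real variable *)

Section calculus.
Context {R : realType}.
Implicit Types (f g h : R -> R) (a b c t x : R).
Local Notation mu := (@lebesgue_measure R).

Lemma is_deriveD_fun f g t a b : is_derive t 1 f a -> is_derive t 1 g b ->
  is_derive t 1 (fun x => f x + g x) (a + b).
Proof. by move=> df dg; exact: is_deriveD. Qed.

Lemma is_deriveN_fun f t a : is_derive t 1 f a ->
  is_derive t 1 (fun x => - f x) (- a).
Proof. by move=> df; exact: is_deriveN. Qed.

Lemma is_deriveM_fun f g t a b : is_derive t 1 f a -> is_derive t 1 g b ->
  is_derive t 1 (fun x => f x * g x) (a * g t + f t * b).
Proof.
move=> df dg; apply: is_derive_eq (is_deriveM df dg) _.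
by rewrite /GRing.scale/= addrC [g t * a]mulrC.
Qed.

Lemma is_deriveZ_fun f t a c : is_derive t 1 f a ->
  is_derive t 1 (fun x => c * f x) (c * a).
Proof. by move=> df; exact: (is_deriveZ c df). Qed.

Lemma is_derive_sum_seq (I : Type) (s : seq I) (F : I -> R -> R) (dF : I -> R)
    t : (forall i, is_derive t 1 (F i) (dF i)) ->
  is_derive t 1 (fun x => \sum_(i <- s) F i x) (\sum_(i <- s) dF i).
Proof.
move=> dFi; elim: s => [|i s IH].
  rewrite big_nil; under eq_fun do rewrite big_nil.
  exact: is_derive_cst.
rewrite big_cons; under eq_fun do rewrite big_cons.
exact: is_deriveD_fun.
Qed.

Lemma is_derive_comp_fun f g t a b : is_derive (g t) 1 f a ->
  is_derive t 1 g b -> is_derive t 1 (fun x => f (g x)) (a * b).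
Proof. by move=> df dg; exact: is_derive1_comp. Qed.

Lemma is_deriveX_fun f n t a : is_derive t 1 f a ->
  is_derive t 1 (fun x => f x ^+ n) (n%:R * f t ^+ n.-1 * a).
Proof.
move=> df; elim: n => [|n IH].
  by rewrite mulr0n !mul0r; under eq_fun do rewrite expr0; exact: is_derive_cst.
under eq_fun do rewrite exprS.
apply: is_derive_eq (is_deriveM_fun df IH) _.
case: n {IH} => [|n] /=; first by rewrite !expr0; ring.
by rewrite exprS -[n.+2%:R]natr1; ring.
Qed.

Lemma is_derive_powR_fun f t a p : 0 < f t -> is_derive t 1 f a ->
  is_derive t 1 (fun x => f x `^ p) (p * f t `^ (p - 1) * a).
Proof.
move=> f0 df; apply: (is_derive_comp_fun (f := fun y => y `^ p)) => //.
exact: is_derive1_powR.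
Qed.

Lemma is_derive_by f t b :
  (exists2 a, is_derive t 1 f a & a = b) -> is_derive t 1 f b.
Proof. by move=> [a ? <-]. Qed.

Lemma is_derive_lin c t : is_derive t 1 (fun x => c * x) c.
Proof.
by apply: is_derive_eq (is_deriveZ_fun c (is_derive_id t 1)) _; rewrite mulr1.
Qed.

Lemma is_derive_continuous f t a : is_derive t 1 f a -> {for t, continuous f}.
Proof.
by move=> [df _]; apply: differentiable_continuous; exact/derivable1_diffP.
Qed.

Lemma is_derive_continuousT f f' : (forall t, is_derive t 1 f (f' t)) ->
  continuous f.
Proof. by move=> df t; exact: is_derive_continuous (df t). Qed.

Lemma derive_ge0_le f f' a b : a <= b ->
  (forall x, a <= x <= b -> is_derive x 1 f (f' x)) ->
  (forall x, a < x < b -> 0 <= f' x) -> f a <= f b.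
Proof.
rewrite le_eqVlt => /predU1P[->//|ab] df f'0.
have H1 x : x \in `]a, b[%R -> is_derive x 1 f (f' x).
  by rewrite in_itv/= => /andP[ax xb]; apply: df; rewrite !ltW.
have H2 : {within `[a, b], continuous f}.
  apply: derivable_within_continuous => x; rewrite in_itv/= => xab.
  by have [] := df x xab.
have [c + fab] := MVT ab H1 H2.
rewrite in_itv/= => cab; rewrite -subr_ge0 fab mulr_ge0 ?f'0//.
by rewrite subr_ge0 ltW.
Qed.

Lemma derive_le_norm f f' C a b : a <= b ->
  (forall x, a <= x <= b -> is_derive x 1 f (f' x)) ->
  (forall x, a <= x <= b -> `|f' x| <= C) ->
  `|f b - f a| <= C * (b - a).
Proof.
rewrite le_eqVlt => /predU1P[->|ab] df f'C; first by rewrite !subrr normr0 mulr0.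
have H1 x : x \in `]a, b[%R -> is_derive x 1 f (f' x).
  by rewrite in_itv/= => /andP[ax xb]; apply: df; rewrite !ltW.
have H2 : {within `[a, b], continuous f}.
  apply: derivable_within_continuous => x; rewrite in_itv/= => xab.
  by have [] := df x xab.
have [c + ->] := MVT ab H1 H2.
rewrite in_itv/= => /andP[ac cb]; rewrite normrM (ger0_norm (x := b - a)).
  by rewrite ler_wpM2r ?f'C ?subr_ge0 ?ltW//.
by rewrite subr_ge0 ltW.
Qed.

Lemma continuous_integrable f a b : continuous f ->
  mu.-integrable `[a, b] (EFin \o f).
Proof.
move=> cf; apply: continuous_compact_integrable; first exact: segment_compact.
exact: continuous_subspaceT.
Qed.

Lemma Rintegral_FTC f F a b : a < b -> continuous f ->
  (forall x, a <= x <= b -> is_derive x 1 F (f x)) ->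
  \int[mu]_(x in `[a, b]) f x = F b - F a.
Proof.
move=> ab cf dF; have cF x xab := is_derive_continuous (dF x xab).
rewrite /Rintegral (@continuous_FTC2 _ f F a b)//.
- exact: continuous_subspaceT.
- split.
  + move=> x; rewrite in_itv/= => /andP[ax xb].
    have xab : a <= x <= b by rewrite !ltW.
    by have [] := dF x xab.
  + by apply: cvg_at_right_filter; apply: cF; rewrite lexx ltW.
  + by apply: cvg_at_left_filter; apply: cF; rewrite lexx ltW.
- move=> x; rewrite in_itv/= => /andP[ax xb].
  have xab : a <= x <= b by rewrite !ltW.
  by rewrite derive1E; have [_] := dF x xab.
Qed.

Lemma le_Rintegral_cont f g a b : continuous f -> continuous g ->
  (forall x, a <= x <= b -> f x <= g x) ->
  \int[mu]_(x in `[a, b]) f x <= \int[mu]_(x in `[a, b]) g x.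
Proof.
move=> cf cg fg; apply: le_Rintegral => //.
- exact: continuous_integrable.
- exact: continuous_integrable.
Qed.

Lemma RintegralD_cont f g a b : continuous f -> continuous g ->
  \int[mu]_(x in `[a, b]) (f x + g x) =
  \int[mu]_(x in `[a, b]) f x + \int[mu]_(x in `[a, b]) g x.
Proof. by move=> cf cg; apply: RintegralD => //; exact: continuous_integrable. Qed.

Lemma RintegralZ_cont f c a b : continuous f ->
  \int[mu]_(x in `[a, b]) (c * f x) = c * \int[mu]_(x in `[a, b]) f x.
Proof. by move=> cf; apply: RintegralZl => //; exact: continuous_integrable. Qed.

Lemma Rintegral_cst_itv c a b : a <= b ->
  \int[mu]_(x in `[a, b]) c = c * (b - a).
Proof.
move=> ab; rewrite Rintegral_cst//; congr (_ * _).
transitivity (fine (lebesgue_measure `[a, b]%classic)); first by [].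
rewrite lebesgue_measure_itv/= lte_fin; case: ltP => //= ba.
by rewrite (@le_anti _ _ a b) ?ab ?ba// subrr.
Qed.

(** The radii are confined to []-2, 2[], an open interval around [[0, 1]] on which polynomials in
    [r] are bounded, so that a constant dominates the derivative. *)
Lemma derive_under_integral (f f' : R -> R -> R) (C a b r0 : R) :
  (forall r x : R, is_derive r 1 (f^~ x) (f' r x)) ->
  (forall r, continuous (f r)) ->
  (forall r x, `|r| < 2 -> `|f' r x| <= C) -> `|r0| < 2 ->
  is_derive r0 1 (fun r => \int[mu]_(x in `[a, b]) f r x)
    (\int[mu]_(x in `[a, b]) f' r0 x).
Proof.
move=> df cf f'C; rewrite ltr_norml => r02.
have I0 : `](-2), 2[%classic r0 by rewrite /= in_itv/=.
have C0 : 0 <= C by apply: le_trans (f'C 0 0 _); rewrite ?normr0.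
have d1E r x : partial1of2 f r x = f' r x.
  by rewrite partial1of2E; have [_] := df r x.
have H1 r : `](-2), 2[%classic r -> mu.-integrable `[a, b] (EFin \o f r).
  by move=> _; exact: continuous_integrable.
have H2 r x : `](-2), 2[%classic r -> `[a, b]%classic x -> derivable (f^~ x) r 1.
  by move=> _ _; have [] := df r x.
have H3 : mu.-integrable `[a, b] (EFin \o (fun=> C)).
  by apply: continuous_integrable => ?; exact: cvg_cst.
have H4 r x : `](-2), 2[%classic r -> `[a, b]%classic x ->
    `|partial1of2 f r x| <= C.
  by rewrite /= in_itv/= => rI _; rewrite d1E f'C// ltr_norml.
have m : measurable `[a, b]%classic by [].
have := @derivable_under_integral R _ _ mu f _ m r0 (-2) 2 I0 H1 H2
   (fun=> C) (fun=> C0) H3 H4.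
have := @differentiation_under_integral R _ _ mu f _ m r0 (-2) 2 I0 H1 H2
   (fun=> C) (fun=> C0) H3 H4.
rewrite derive1E => dE d; apply: DeriveDef => //; rewrite dE.
by apply: eq_Rintegral => x _; exact: d1E.
Qed.
End calculus.

(** * M. Riesz's theorem on conjugate trigonometric polynomials *)

Section harmonic_sums.
Context {R : realType}.
Implicit Types (s : seq (R * R * nat)) (r x : R) (j : nat).

(* [harm 0 s] and [harm 0 (rot s)] are the real and imaginary parts of a
   polynomial in [r * exp (i * pi * x)]; [harm j] is its image under
   [(r d/dr)^j] and [harmd j] the [r]-derivative of [harm j]. *)
Definition harm j s r x : R := \sum_(e <- s)
  e.2%:R ^+ j * r ^+ e.2 *
  (e.1.1 * cos (e.2%:R * pi * x) + e.1.2 * sin (e.2%:R * pi * x)).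

Definition harmd j s r x : R := \sum_(e <- s)
  e.2%:R ^+ j * (e.2%:R * r ^+ e.2.-1) *
  (e.1.1 * cos (e.2%:R * pi * x) + e.1.2 * sin (e.2%:R * pi * x)).

(** With [z = r * exp (i * pi * x)], a term [r ^ k * (a cos + b sin)] is the real part of
    [(a - i b) * z ^ k], whose imaginary part is [r ^ k * (- b cos + a sin)]. *)
Definition rot s : seq (R * R * nat) :=
  [seq (- e.1.2, e.1.1, e.2) | e <- s].

Lemma harm_rotrot j s r x : harm j (rot (rot s)) r x = - harm j s r x.
Proof.
rewrite /harm /rot -map_comp big_map -sumrN; apply: eq_bigr => e _ /=.
by ring.
Qed.

(** The Cauchy-Riemann equation in polar coordinates; the factor [pi] appears because the angle is
    [pi * x]. *)
Lemma is_derive_harm_x j s r x :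
  is_derive x 1 (harm j s r) (- pi * harm j.+1 (rot s) r x).
Proof.
rewrite /harm /rot big_map mulr_sumr; apply: is_derive_sum_seq => -[[a b] k] /=.
have dl := is_derive_lin (k%:R * pi : R) x.
have dc := is_derive_comp_fun (is_derive_cos _) dl.
have ds := is_derive_comp_fun (is_derive_sin _) dl.
have := is_deriveZ_fun (k%:R ^+ j * r ^+ k)
  (is_deriveD_fun (is_deriveZ_fun a dc) (is_deriveZ_fun b ds)).
by move=> h; apply: is_derive_eq h _; rewrite exprS; ring.
Qed.

Lemma is_derive_harm_r j s r x :
  is_derive r 1 (fun r => harm j s r x) (harmd j s r x).
Proof.
rewrite /harm /harmd; apply: is_derive_sum_seq => -[[a b] k] /=.
set w := _ + _.
have dr := is_deriveX_fun k (is_derive_id r 1).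
have := is_deriveM_fun (is_deriveZ_fun (k%:R ^+ j) dr) (is_derive_cst w r 1).
by move=> h; apply: is_derive_eq h _; rewrite /=; ring.
Qed.

Lemma harmd_r j s r x : r * harmd j s r x = harm j.+1 s r x.
Proof.
rewrite /harm /harmd mulr_sumr; apply: eq_bigr => -[[a b] [|k]] _ /=.
  by rewrite !mul0r exprS !(mul0r, mulr0).
by rewrite !exprS; ring.
Qed.

Lemma harm_r0 j s x : all (fun e => 0 < e.2)%N s -> harm j s 0 x = 0.
Proof.
move=> /allP s0; rewrite /harm; apply: big1_seq => e /s0.
by rewrite lt0n => k0; rewrite expr0n (negbTE k0) mulr0 mul0r.
Qed.

Lemma continuous_harm j s r : continuous (harm j s r).
Proof. by apply: is_derive_continuousT; exact: is_derive_harm_x. Qed.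

Lemma continuous_harmd j s r : continuous (harmd j s r).
Proof.
have [->|r0] := eqVneq r 0; last first.
  suff -> : harmd j s r = (fun x => r^-1 * harm j.+1 s r x).
    by move=> x; apply: cvgM; [exact: cvg_cst|exact: continuous_harm].
  by apply/funext => x; rewrite -harmd_r mulKf.
apply: continuous_sum_seq => e; apply: continuousM_fun.
  exact: continuous_cst_fun.
have cl : continuous (fun x : R => e.2%:R * pi * x).
  by apply: continuousM_fun; [exact: continuous_cst_fun|move=> ?; exact: cvg_id].
apply: continuousD_fun; apply: continuousM_fun; try exact: continuous_cst_fun.
- by apply: continuous_comp_fun => //; exact: continuous_cos.
- by apply: continuous_comp_fun => //; exact: continuous_sin.
Qed.

Lemma norm_trig_le (a b y : R) : `|a * cos y + b * sin y| <= `|a| + `|b|.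
Proof.
rewrite (le_trans (ler_normD _ _))// !normrM lerD//.
  by rewrite ler_piMr// cos_max.
by rewrite ler_piMr// sin_max.
Qed.

Lemma harm_bounded j s : exists2 M : R, 0 <= M &
  forall r x, `|r| < 2 -> `|harm j s r x| <= M /\ `|harmd j s r x| <= M.
Proof.
elim: s => [|[[a b] k] s [M M0 IH]].
  by exists 0 => // r x _; rewrite /harm /harmd !big_nil normr0.
exists (k%:R ^+ j * 2 ^+ k * (`|a| + `|b|) +
        k%:R ^+ j * (k%:R * 2 ^+ k.-1) * (`|a| + `|b|) + M).
  by rewrite !addr_ge0// !mulr_ge0// ?exprn_ge0// ?mulr_ge0// addr_ge0.
move=> r x r2; have [H1 H2] := IH r x r2.
have rk m : `|r| ^+ m <= 2 ^+ m by rewrite lerXn2r ?nnegrE// ltW.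
have ab := norm_trig_le a b (k%:R * pi * x).
have n0 m : 0 <= k%:R ^+ m :> R by rewrite exprn_ge0.
rewrite /harm /harmd !big_cons /=; split.
- rewrite (le_trans (ler_normD _ _))// lerD//.
  rewrite (le_trans (y := k%:R ^+ j * 2 ^+ k * (`|a| + `|b|)))//.
    rewrite !normrM !normrX (ger0_norm (x := k%:R))//.
    by rewrite ler_pM// ?mulr_ge0// ?exprn_ge0// ler_wpM2l.
  by rewrite lerDl !mulr_ge0// ?exprn_ge0// addr_ge0.
- rewrite (le_trans (ler_normD _ _))// lerD//.
  rewrite (le_trans (y := k%:R ^+ j * (k%:R * 2 ^+ k.-1) * (`|a| + `|b|)))//.
    rewrite !normrM !normrX (ger0_norm (x := k%:R))//.
    by rewrite ler_pM// ?mulr_ge0// ?mulr_ge0// ?exprn_ge0// ler_wpM2l// ler_wpM2l.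
  by rewrite lerDr !mulr_ge0// ?exprn_ge0// addr_ge0.
Qed.
End harmonic_sums.

(** * Functions of two real variables along curves *)

Section two_variables.
Context {R : realType}.
Implicit Types (f g : R -> R -> R).

Definition continuous2 f := continuous (fun z : R * R => f z.1 z.2).

(** Partial derivatives are specified by the chain rule along differentiable curves, the only form
    in which they are used; no differential on the plane is involved. *)
Definition chain2 f f1 f2 := forall (u v : R -> R) (t du dv : R),
  is_derive t 1 u du -> is_derive t 1 v dv ->
  is_derive t 1 (fun t => f (u t) (v t)) (f1 (u t) (v t) * du + f2 (u t) (v t) * dv).

Lemma continuous2_curve f (u v : R -> R) : continuous2 f ->
  continuous u -> continuous v -> continuous (fun t => f (u t) (v t)).
Proof.
move=> cf cu cv t.
apply: (continuous_comp (f := fun t => (u t, v t)) (g := fun z => f z.1 z.2)).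
  exact: (cvg_pair (cu t) (cv t)).
exact: cf.
Qed.

Lemma continuous2_bounded f M : continuous2 f ->
  exists2 C : R, 0 <= C & forall u v, `|u| <= M -> `|v| <= M -> `|f u v| <= C.
Proof.
move=> cf.
have K : compact (`[-M, M]%classic `*` `[-M, M]%classic : set (R * R)).
  by apply: compact_setX; exact: segment_compact.
have /compact_bounded[N [_ NP]] := continuous_compact (continuous_subspaceT cf) K.
exists (`|N| + 1); first by rewrite addr_ge0.
move=> u v uM vM; apply: (NP (`|N| + 1)).
  by rewrite (le_lt_trans (ler_norm _))// ltrDl.
by exists (u, v) => //; split; rewrite /= in_itv/= -ler_norml.
Qed.
End two_variables.

(* If [f] is subharmonic, so is its composite with an analytic polynomial, and
   the circular means increase with the radius. *)
Section subharmonic.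
Context {R : realType}.
Local Notation mu := (@lebesgue_measure R).
Variables f f1 f2 f11 f12 f22 : R -> R -> R.
Hypotheses (df : chain2 f f1 f2) (df1 : chain2 f1 f11 f12)
  (df2 : chain2 f2 f12 f22).
Hypotheses (cf : continuous2 f) (cf1 : continuous2 f1) (cf2 : continuous2 f2)
  (cf11 : continuous2 f11) (cf12 : continuous2 f12) (cf22 : continuous2 f22).
Hypothesis lap_ge0 : forall u v, 0 <= f11 u v + f22 u v.
Variable s : seq (R * R * nat).
Hypothesis s_gt0 : all (fun e => 0 < e.2)%N s.

Let U j := harm j s.
Let V j := harm j (rot s).
Let Ud j := harmd j s.
Let Vd j := harmd j (rot s).
Let at_ (g : R -> R -> R) r x := g (U 0 r x) (V 0 r x).

Let cU j r : continuous (U j r). Proof. exact: continuous_harm. Qed.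
Let cV j r : continuous (V j r). Proof. exact: continuous_harm. Qed.
Let cUd j r : continuous (Ud j r). Proof. exact: continuous_harmd. Qed.
Let cVd j r : continuous (Vd j r). Proof. exact: continuous_harmd. Qed.

Let cat g r : continuous2 g -> continuous (at_ g r).
Proof. by move=> cg; apply: continuous2_curve cg _ _; [exact: cU|exact: cV]. Qed.

(** [A] is [r d/dr] of [f (u, v)] and [B] its derivative in the angle [pi * x]; [A'] and [B'] are
    the derivatives of [A] in [r] and of [B] in the angle. Thus [r * A' + B'] is [r ^ 2] times the
    Laplacian of [f (u, v)] in polar coordinates. *)
Let A r x := at_ f1 r x * U 1 r x + at_ f2 r x * V 1 r x.
Let A' r x :=
  (at_ f11 r x * Ud 0 r x + at_ f12 r x * Vd 0 r x) * U 1 r x +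
  at_ f1 r x * Ud 1 r x +
  ((at_ f12 r x * Ud 0 r x + at_ f22 r x * Vd 0 r x) * V 1 r x +
  at_ f2 r x * Vd 1 r x).
Let B r x := at_ f1 r x * - V 1 r x + at_ f2 r x * U 1 r x.
Let B' r x :=
  (at_ f11 r x * (- V 1 r x) + at_ f12 r x * U 1 r x) * - V 1 r x +
  at_ f1 r x * - U 2 r x +
  ((at_ f12 r x * (- V 1 r x) + at_ f22 r x * U 1 r x) * U 1 r x +
  at_ f2 r x * - V 2 r x).

Let dU_r j (r x : R) : is_derive r 1 (fun r => U j r x) (Ud j r x).
Proof. exact: is_derive_harm_r. Qed.
Let dV_r j (r x : R) : is_derive r 1 (fun r => V j r x) (Vd j r x).
Proof. exact: is_derive_harm_r. Qed.
Let dU_x j (r x : R) : is_derive x 1 (U j r) (- pi * V j.+1 r x).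
Proof. exact: is_derive_harm_x. Qed.
Let dV_x j (r x : R) : is_derive x 1 (V j r) (pi * U j.+1 r x).
Proof.
apply: is_derive_eq (is_derive_harm_x j (rot s) r x) _.
by rewrite harm_rotrot mulrNN.
Qed.

Let dF (r x : R) : is_derive r 1 (fun r => at_ f r x)
  (at_ f1 r x * Ud 0 r x + at_ f2 r x * Vd 0 r x).
Proof. exact: df. Qed.

Let dA (r x : R) : is_derive r 1 (fun r => A r x) (A' r x).
Proof.
have h1 := is_deriveM_fun (df1 (dU_r 0 r x) (dV_r 0 r x)) (dU_r 1 r x).
have h2 := is_deriveM_fun (df2 (dU_r 0 r x) (dV_r 0 r x)) (dV_r 1 r x).
exact: is_deriveD_fun h1 h2.
Qed.

Let dB (r x : R) : is_derive x 1 (B r) (pi * B' r x).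
Proof.
have h1 := is_deriveM_fun (df1 (dU_x 0 r x) (dV_x 0 r x))
  (is_deriveN_fun (dV_x 1 r x)).
have h2 := is_deriveM_fun (df2 (dU_x 0 r x) (dV_x 0 r x)) (dU_x 1 r x).
apply: is_derive_eq (is_deriveD_fun h1 h2) _.
by rewrite /B' /at_; ring.
Qed.

(** Composition with an analytic function multiplies the Laplacian by the squared modulus of its
    derivative: by the Cauchy-Riemann equations the terms in [f1], [f2] and [f12] cancel. *)
Let AB (r x : R) : 0 <= r * A' r x + B' r x.
Proof.
have -> : r * A' r x + B' r x = (at_ f11 r x + at_ f22 r x) *
    (U 1 r x ^+ 2 + V 1 r x ^+ 2).
  have hU j : r * Ud j r x = U j.+1 r x by exact: harmd_r.
  have hV j : r * Vd j r x = V j.+1 r x by exact: harmd_r.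
  have -> : r * A' r x =
      (at_ f11 r x * (r * Ud 0 r x) + at_ f12 r x * (r * Vd 0 r x)) * U 1 r x +
      at_ f1 r x * (r * Ud 1 r x) +
      ((at_ f12 r x * (r * Ud 0 r x) + at_ f22 r x * (r * Vd 0 r x)) * V 1 r x +
      at_ f2 r x * (r * Vd 1 r x)) by rewrite /A'; ring.
  by rewrite !hU !hV /B'; ring.
by apply: mulr_ge0; [exact: lap_ge0|rewrite addr_ge0 ?sqr_ge0].
Qed.

Let B_per (r : R) : B r 2 = B r 0.
Proof.
have per t j : harm j t r 2 = harm j t r 0.
  apply: eq_bigr => e _.
  have -> : e.2%:R * pi * 2 = 0 + pi *+ 2 *+ e.2 :> R.
    by rewrite add0r -[RHS]mulr_natl -[pi *+ 2]mulr_natr mulrA.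
  by rewrite mulr0 (periodicn (@cosD2pi R)) (periodicn (@sinD2pi R)).
by rewrite /B /at_ /U /V !per.
Qed.

Let bd (j : nat) : exists2 M : R, 0 <= M & forall r x, `|r| < 2 ->
  [/\ `|U j r x| <= M, `|V j r x| <= M, `|Ud j r x| <= M & `|Vd j r x| <= M].
Proof.
have [M M0 HM] := harm_bounded j s; have [N N0 HN] := harm_bounded j (rot s).
exists (M + N); first by rewrite addr_ge0.
move=> r x r2; have [H1 H2] := HM r x r2; have [H3 H4] := HN r x r2.
have MN : M <= M + N by rewrite lerDl.
have NM : N <= M + N by rewrite lerDr.
by split; [exact: le_trans H1 MN|exact: le_trans H3 NM
  |exact: le_trans H2 MN|exact: le_trans H4 NM].
Qed.

Let bdat g : continuous2 g ->
  exists2 C : R, 0 <= C & forall r x, `|r| < 2 -> `|at_ g r x| <= C.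
Proof.
move=> cg; have [M M0 HM] := bd 0.
have [C C0 HC] := continuous2_bounded M cg; exists C => // r x r2.
by have [H1 H2 _ _] := HM r x r2; exact: HC.
Qed.

Let bdM (g h : R -> R -> R) :
  (exists2 C : R, 0 <= C & forall r x, `|r| < 2 -> `|g r x| <= C) ->
  (exists2 C : R, 0 <= C & forall r x, `|r| < 2 -> `|h r x| <= C) ->
  exists2 C : R, 0 <= C & forall r x, `|r| < 2 -> `|g r x * h r x| <= C.
Proof.
move=> [C C0 HC] [D D0 HD]; exists (C * D); first by rewrite mulr_ge0.
by move=> r x r2; rewrite normrM ler_pM// ?HC ?HD.
Qed.

Let bdD (g h : R -> R -> R) :
  (exists2 C : R, 0 <= C & forall r x, `|r| < 2 -> `|g r x| <= C) ->
  (exists2 C : R, 0 <= C & forall r x, `|r| < 2 -> `|h r x| <= C) ->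
  exists2 C : R, 0 <= C & forall r x, `|r| < 2 -> `|g r x + h r x| <= C.
Proof.
move=> [C C0 HC] [D D0 HD]; exists (C + D); first by rewrite addr_ge0.
by move=> r x r2; rewrite (le_trans (ler_normD _ _))// lerD// ?HC ?HD.
Qed.

Let bdU j : exists2 C : R, 0 <= C & forall r x, `|r| < 2 -> `|U j r x| <= C.
Proof. by have [M M0 H] := bd j; exists M => // r x r2; case: (H r x r2). Qed.
Let bdV j : exists2 C : R, 0 <= C & forall r x, `|r| < 2 -> `|V j r x| <= C.
Proof. by have [M M0 H] := bd j; exists M => // r x r2; case: (H r x r2). Qed.
Let bdUd j : exists2 C : R, 0 <= C & forall r x, `|r| < 2 -> `|Ud j r x| <= C.
Proof. by have [M M0 H] := bd j; exists M => // r x r2; case: (H r x r2). Qed.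
Let bdVd j : exists2 C : R, 0 <= C & forall r x, `|r| < 2 -> `|Vd j r x| <= C.
Proof. by have [M M0 H] := bd j; exists M => // r x r2; case: (H r x r2). Qed.

Let J r := \int[mu]_(x in `[0, 2]) at_ f r x.
Let K r := \int[mu]_(x in `[0, 2]) A r x.

Let cA r : continuous (A r).
Proof.
exact: continuousD_fun (continuousM_fun (@cat _ r cf1) (@cU 1 r))
  (continuousM_fun (@cat _ r cf2) (@cV 1 r)).
Qed.

Let cA' r : continuous (A' r).
Proof.
have h g h (cg : continuous2 g) (ch : continuous2 h) := continuousD_fun
  (continuousM_fun (@cat _ r cg) (@cUd 0 r)) (continuousM_fun (@cat _ r ch) (@cVd 0 r)).
exact: continuousD_fun
  (continuousD_fun (continuousM_fun (h _ _ cf11 cf12) (@cU 1 r))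
    (continuousM_fun (@cat _ r cf1) (@cUd 1 r)))
  (continuousD_fun (continuousM_fun (h _ _ cf12 cf22) (@cV 1 r))
    (continuousM_fun (@cat _ r cf2) (@cVd 1 r))).
Qed.

Let cB' r : continuous (B' r).
Proof.
have h g h (cg : continuous2 g) (ch : continuous2 h) := continuousD_fun
  (continuousM_fun (@cat _ r cg) (continuousN_fun (@cV 1 r)))
  (continuousM_fun (@cat _ r ch) (@cU 1 r)).
exact: continuousD_fun
  (continuousD_fun (continuousM_fun (h _ _ cf11 cf12) (continuousN_fun (@cV 1 r)))
    (continuousM_fun (@cat _ r cf1) (continuousN_fun (@cU 2 r))))
  (continuousD_fun (continuousM_fun (h _ _ cf12 cf22) (@cU 1 r))
    (continuousM_fun (@cat _ r cf2) (continuousN_fun (@cV 2 r)))).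
Qed.

Let dJ (r : R) : `|r| < 2 -> is_derive r 1 J
  (\int[mu]_(x in `[0, 2]) (at_ f1 r x * Ud 0 r x + at_ f2 r x * Vd 0 r x)).
Proof.
have [C C0 HC] : exists2 C : R, 0 <= C & forall r x, `|r| < 2 ->
    `|at_ f1 r x * Ud 0 r x + at_ f2 r x * Vd 0 r x| <= C.
  by apply: bdD; apply: bdM; (exact: bdat || exact: bdUd || exact: bdVd).
by move=> r2; apply: (derive_under_integral _ _ _ _ HC r2) => // r'; exact: cat.
Qed.

Let dK (r : R) : `|r| < 2 -> is_derive r 1 K (\int[mu]_(x in `[0, 2]) A' r x).
Proof.
have [C C0 HC] : exists2 C : R, 0 <= C & forall r x, `|r| < 2 -> `|A' r x| <= C.
  by do !(apply: bdD || apply: bdM || exact: bdat || exact: bdUd || exact: bdVd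
    || exact: bdU || exact: bdV).
by move=> r2; exact: (derive_under_integral _ _ _ _ HC r2).
Qed.

(** [B'] is up to [pi] the derivative of the 2-periodic function [B], so its integral over a period
    vanishes and it can be added to [r * A'] for free. *)
Let K'_ge0 (r : R) : 0 < r -> 0 <= \int[mu]_(x in `[0, 2]) A' r x.
Proof.
move=> r0; rewrite -(pmulr_rge0 _ r0) -RintegralZ_cont//.
have Bint : \int[mu]_(x in `[0, 2]) (pi * B' r x) = 0.
  have cpB : continuous (fun x => pi * B' r x).
    by apply: continuousM_fun; [exact: continuous_cst_fun|exact: cB'].
  by rewrite (Rintegral_FTC (F := B r) _ cpB (fun x _ => dB r x)) ?B_per ?subrr.
have crA : continuous (fun x => r * A' r x).
  by apply: continuousM_fun; [exact: continuous_cst_fun|exact: cA'].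
have cB := @cB' r.
have {}Bint : \int[mu]_(x in `[0, 2]) B' r x = 0.
  move/eqP: Bint; rewrite RintegralZ_cont// mulf_eq0 gt_eqF ?pi_gt0//=.
  by move/eqP.
have -> : \int[mu]_(x in `[0, 2]) (r * A' r x) =
    \int[mu]_(x in `[0, 2]) (r * A' r x + B' r x).
  by rewrite RintegralD_cont// Bint addr0.
by apply: Rintegral_ge0 => x _; exact: AB.
Qed.

Let small (r x : R) : r <= 1 -> 0 <= x <= r -> `|x| < 2.
Proof. by move=> r1 /andP[x0 xr]; rewrite ger0_norm//; lra. Qed.

Let K_ge0 (r : R) : 0 < r <= 1 -> 0 <= K r.
Proof.
move=> /andP[r0 r1]; have <- : K 0 = 0.
  rewrite /K (@eq_Rintegral _ _ _ _ _ (fun=> 0)); last first.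
    move=> x _; rewrite /A /U /V !harm_r0// ?mulr0 ?addr0//.
    by rewrite /rot all_map.
  by rewrite Rintegral_cst_itv ?mul0r.
apply: derive_ge0_le (ltW r0) (fun x xr => dK (small r1 xr)) _.
by move=> x /andP[x0 _]; exact: K'_ge0.
Qed.

(** [r * J' = K], where [K] vanishes at 0 and has a nonnegative derivative, so [J] is nondecreasing.
    At radius 0 both polynomials vanish because all frequencies are positive; the factor 2 is the
    length of the period. *)
Lemma subharmonic_mean : 2 * f 0 0 <=
  \int[mu]_(x in `[0, 2]) f (harm 0 s 1 x) (harm 0 (rot s) 1 x).
Proof.
have <- : J 0 = 2 * f 0 0.
  rewrite /J (@eq_Rintegral _ _ _ _ _ (fun=> f 0 0)); last first.
    move=> x _; rewrite /at_ /U /V !harm_r0//.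
    by rewrite /rot all_map.
  by rewrite Rintegral_cst_itv// subr0 mulrC.
change (J 0 <= J 1).
apply: derive_ge0_le ler01 (fun x xr => dJ (small (lexx 1) xr)) _.
move=> r /andP[r0 r1]; rewrite -(pmulr_rge0 _ r0) -RintegralZ_cont; last first.
  by apply: continuousD_fun; apply: continuousM_fun;
    (exact: cat || exact: cUd || exact: cVd).
have -> : \int[mu]_(x in `[0, 2])
    (r * (at_ f1 r x * Ud 0 r x + at_ f2 r x * Vd 0 r x)) = K r.
  by apply: eq_Rintegral => x _; rewrite /A /U /V -!harmd_r /Ud /Vd; ring.
by apply: K_ge0; rewrite r0 ltW.
Qed.
End subharmonic.

(** * Real powers *)

Section powers.
Context {R : realType}.
Implicit Types (x y p a : R).

Lemma powR_invK x p : 0 <= x -> p != 0 -> (x `^ p^-1) `^ p = x.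
Proof. by move=> x0 p0; rewrite -powRrM mulVf// powRr1. Qed.

Lemma continuous_norm_powR p : 0 < p -> continuous (fun y : R => `|y| `^ p).
Proof.
move=> p0 y; have [->|y0] := eqVneq y 0; last first.
  apply: (continuous_comp (f := @Num.norm R R) (g := fun y => y `^ p)).
    exact: norm_continuous.
  have ny : 0 < `|y| by rewrite normr_gt0.
  exact: is_derive_continuous (is_derive1_powR p ny).
apply/cvgrPdist_lt => e e0; near=> z.
rewrite normr0 powR0 ?gt_eqF// sub0r normrN ger0_norm ?powR_ge0//.
rewrite -[ltRHS](@powR_invK e p) ?gt_eqF ?ltW//.
rewrite gt0_ltr_powR ?nnegrE ?powR_ge0//.
near: z; exists (e `^ p^-1); first exact: powR_gt0.
by move=> t /=; rewrite sub0r normrN.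
Unshelve. all: end_near. Qed.

Lemma continuous_norm_powR_fun (T : topologicalType) p (f : T -> R) : 0 < p ->
  continuous f -> continuous (fun t => `|f t| `^ p).
Proof.
move=> p0 cf t; apply: (continuous_comp (g := fun y => `|y| `^ p)).
  exact: cf.
exact: continuous_norm_powR.
Qed.

Lemma sqr_powR x a : (x ^+ 2) `^ a = `|x| `^ (2 * a).
Proof. by rewrite powRrM powR_mulrn// real_normK// num_real. Qed.

Lemma powR_addn x a n : 0 < x -> x `^ (a + n%:R) = x `^ a * x ^+ n.
Proof.
by move=> x0; rewrite powRD ?powR_mulrn ?(ltW x0)// (gt_eqF x0) implybT.
Qed.

Lemma le0_ger_powR a x y : a <= 0 -> 0 < x -> x <= y -> y `^ a <= x `^ a.
Proof.
move=> a0 x0 xy; have y0 := lt_le_trans x0 xy.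
have -> : a = - (- a) by rewrite opprK.
move: (- a) (oppr_ge0 a) => b; rewrite a0 => b0.
rewrite !powRN lef_pV2 ?posrE ?powR_gt0//.
by rewrite ge0_ler_powR ?nnegrE// ltW.
Qed.

(** Valid for exponents on both sides of 1, because [x + y] is at most twice the larger term. *)
Lemma powR_add_le x y a : 0 <= a -> 0 <= x -> 0 <= y ->
  (x + y) `^ a <= 2 `^ a * (x `^ a + y `^ a).
Proof.
move=> a0; wlog xy : x y / x <= y => [H|] x0 y0.
  by have [/H->//|/ltW/H] := leP x y; rewrite addrC [y `^ _ + _]addrC; apply.
apply: (@le_trans _ _ ((2 * y) `^ a)).
  by rewrite ge0_ler_powR ?nnegrE ?addr_ge0// ?mulr_ge0//; lra.
by rewrite powRM// ler_wpM2l ?powR_ge0// lerDr powR_ge0.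
Qed.
End powers.

(** Reads the derivative off the syntax of the function into an existential variable; [ring]
    compares it with the intended value afterwards. *)
Ltac der := lazymatch goal with
  | |- is_derive _ _ (fun x => @?f x `^ _) _ =>
      eapply is_derive_powR_fun; [by []|der]
  | |- is_derive _ _ (fun x => @?f x + @?g x) _ =>
      eapply is_deriveD_fun; [der|der]
  | |- is_derive _ _ (fun x => - @?f x) _ => eapply is_deriveN_fun; der
  | |- is_derive _ _ (fun x => @?f x ^+ _) _ => eapply is_deriveX_fun; der
  | |- is_derive _ _ (fun x => @?f x * @?g x) _ =>
      eapply is_deriveM_fun; [der|der]
  | |- _ => first [eassumption|exact: is_derive_cst]
  end.

Ltac cont := lazymatch goal with
  | |- continuous (fun x => @?f x `^ _) =>
      apply: continuous_powR_fun; [by move=> ?|cont]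
  | |- continuous (fun x => @?f x + @?g x) =>
      apply: continuousD_fun; [cont|cont]
  | |- continuous (fun x => - @?f x) => apply: continuousN_fun; cont
  | |- continuous (fun x => @?f x ^+ _) => apply: continuousX_fun; cont
  | |- continuous (fun x => @?f x * @?g x) =>
      apply: continuousM_fun; [cont|cont]
  | |- _ => first [ assumption | exact: continuous_cst_fun
      | by move=> ?; exact: cvg_fst | by move=> ?; exact: cvg_snd ]
  end.

(** * Subharmonic functions comparing the powers of [u ^ 2 + v ^ 2] with those of [u ^ 2] *)

Section subharmonic_functions.
Context {R : realType}.
Local Notation mu := (@lebesgue_measure R).
Variable eps : R.
Hypothesis eps_gt0 : 0 < eps.

(** Adding [eps] keeps the bases away from 0, where their real powers may fail to be twice
    differentiable; [eps] tends to 0 in [conjugate_bound]. *)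
Let al (u v : R) := eps + u ^+ 2.
Let rho (u v : R) := eps + u ^+ 2 + v ^+ 2.

Let al_gt0 u v : 0 < al u v.
Proof. by rewrite /al ltr_wpDr// sqr_ge0. Qed.
Let rho_gt0 u v : 0 < rho u v.
Proof. by rewrite /rho ltr_wpDr ?al_gt0 ?sqr_ge0. Qed.

Let cal : continuous2 al.
Proof. rewrite /continuous2 /al /=. cont. Qed.
Let crho : continuous2 rho.
Proof. rewrite /continuous2 /rho /=. cont. Qed.

Let dal (u v : R -> R) (t du : R) : is_derive t 1 u du ->
  is_derive t 1 (fun t => al (u t) (v t)) (2 * u t * du).
Proof.
move=> hu; rewrite /al; apply: is_derive_by; eexists; first by der.
by rewrite /=; ring.
Qed.

Let drho (u v : R -> R) (t du dv : R) : is_derive t 1 u du ->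
  is_derive t 1 v dv ->
  is_derive t 1 (fun t => rho (u t) (v t)) (2 * u t * du + 2 * v t * dv).
Proof.
move=> hu hv; rewrite /rho; apply: is_derive_by; eexists; first by der.
by rewrite /=; ring.
Qed.

Section small_exponent.
Variable a : R.
Hypothesis a12 : 1 / 2 < a <= 1.
(* [A] is such that the Laplacian of [A * al ^ a] dominates that of [rho ^ a]. *)
Let A := (2 * a - 1)^-1 * 2.

Let f u v := A * al u v `^ a - rho u v `^ a.
Let f1 u v := A * (2 * a * u * al u v `^ (a - 1))
  - 2 * a * u * rho u v `^ (a - 1).
Let f2 u v := - (2 * a * v * rho u v `^ (a - 1)).
Let f11 u v := A * (2 * a * al u v `^ (a - 1) +
    2 * a * u * ((a - 1) * al u v `^ (a - 1 - 1) * (2 * u)))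
  - (2 * a * rho u v `^ (a - 1) +
    2 * a * u * ((a - 1) * rho u v `^ (a - 1 - 1) * (2 * u))).
Let f12 u v := - (2 * a * u * ((a - 1) * rho u v `^ (a - 1 - 1) * (2 * v))).
Let f22 u v := - (2 * a * rho u v `^ (a - 1) +
    2 * a * v * ((a - 1) * rho u v `^ (a - 1 - 1) * (2 * v))).

Let df : chain2 f f1 f2.
Proof.
move=> u v t du dv hu hv; have ha := dal v hu; have hr := drho hu hv.
apply: is_derive_by; eexists; first by rewrite /f; der.
by rewrite /f1 /f2; ring.
Qed.
Let df1 : chain2 f1 f11 f12.
Proof.
move=> u v t du dv hu hv; have ha := dal v hu; have hr := drho hu hv.
apply: is_derive_by; eexists; first by rewrite /f1; der.
by rewrite /f11 /f12; ring.
Qed.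
Let df2 : chain2 f2 f12 f22.
Proof.
move=> u v t du dv hu hv; have ha := dal v hu; have hr := drho hu hv.
apply: is_derive_by; eexists; first by rewrite /f2; der.
by rewrite /f12 /f22; ring.
Qed.

Let cf : continuous2 f.
Proof. rewrite /continuous2 /f. move: cal crho => ? ?; cont. Qed.
Let cf1 : continuous2 f1.
Proof. rewrite /continuous2 /f1. move: cal crho => ? ?; cont. Qed.
Let cf2 : continuous2 f2.
Proof. rewrite /continuous2 /f2. move: cal crho => ? ?; cont. Qed.
Let cf11 : continuous2 f11.
Proof. rewrite /continuous2 /f11. move: cal crho => ? ?; cont. Qed.
Let cf12 : continuous2 f12.
Proof. rewrite /continuous2 /f12. move: cal crho => ? ?; cont. Qed.
Let cf22 : continuous2 f22.
Proof. rewrite /continuous2 /f22. move: cal crho => ? ?; cont. Qed.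

(** The Laplacian of [al ^ a] is at least [2 * a * (2 * a - 1) * al ^ (a - 1)], with
    [2 * a - 1 > 0]; that of [rho ^ a] is at most [4 * a * rho ^ (a - 1)]. Since [al <= rho] and
    [a - 1 <= 0], the choice [A * (2 * a - 1) = 2] suffices. *)
Let lap u v : 0 <= f11 u v + f22 u v.
Proof.
have [a2 a1] := andP a12; have a0 : 0 <= a by lra.
have pa x : 0 < x -> x `^ (a - 1) = x `^ (a - 1 - 1) * x.
  by move=> x0; rewrite -[in RHS](expr1 x) -powR_addn// subrK.
have al0 := al_gt0 u v; have rho0 := rho_gt0 u v.
have X0 := powR_ge0 (rho u v) (a - 1 - 1).
have Y0 := powR_ge0 (al u v) (a - 1 - 1).
have XY : rho u v `^ (a - 1) <= al u v `^ (a - 1).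
  by rewrite le0_ger_powR// ?subr_le0// /rho /al lerDl sqr_ge0.
rewrite /f11 /f22; move: XY; rewrite !pa//.
set X := rho u v `^ _ in X0 *; set Y := al u v `^ _ in Y0 *.
have A0 : 0 <= A by rewrite mulr_ge0// invr_ge0; lra.
have A2 : A * (2 * a - 1) = 2 by rewrite /A mulrAC mulVf ?mul1r// gt_eqF//; lra.
move=> XY; suff : 0 <= (A * (2 * a - 1) - 2) * (2 * a * (Y * al u v))
  + A * (2 * a) * (2 * (1 - a) * (Y * eps))
  + 4 * a * (Y * al u v - X * rho u v)
  + 4 * a * (1 - a) * (X * (u ^+ 2 + v ^+ 2)).
  move=> /le_trans; apply; rewrite le_eqVlt; apply/orP; left; apply/eqP.
  by rewrite /al /rho; ring.
rewrite A2 subrr mul0r add0r.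
have e0 : 0 <= eps by exact: ltW.
have b0 : 0 <= 1 - a by lra.
have uv0 : 0 <= u ^+ 2 + v ^+ 2 by rewrite addr_ge0 ?sqr_ge0.
apply: addr_ge0; first apply: addr_ge0.
- by rewrite !mulr_ge0// invr_ge0; lra.
- by apply: mulr_ge0; [rewrite mulr_ge0|rewrite subr_ge0].
- by rewrite !mulr_ge0.
Qed.

Lemma small_exponent_mean s : all (fun e => 0 < e.2)%N s ->
  \int[mu]_(x in `[0, 2]) (rho (harm 0 s 1 x) (harm 0 (rot s) 1 x)) `^ a <=
  A * \int[mu]_(x in `[0, 2]) (al (harm 0 s 1 x) (harm 0 (rot s) 1 x)) `^ a.
Proof.
move=> s0; have cu := @continuous_harm R 0 s 1.
have cv := @continuous_harm R 0 (rot s) 1.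
have ca : continuous (fun x => al (harm 0 s 1 x) (harm 0 (rot s) 1 x) `^ a).
  apply: continuous_powR_fun; first by move=> x; exact: al_gt0.
  exact: continuous2_curve cal cu cv.
have cr : continuous (fun x => rho (harm 0 s 1 x) (harm 0 (rot s) 1 x) `^ a).
  apply: continuous_powR_fun; first by move=> x; exact: rho_gt0.
  exact: continuous2_curve crho cu cv.
have := subharmonic_mean df df1 df2 cf cf1 cf2 cf11 cf12 cf22 lap s0.
rewrite /f RintegralD_cont; last 2 first.
- by apply: continuousM_fun => //; exact: continuous_cst_fun.
- exact: continuousN_fun.
rewrite RintegralZ_cont//.
under [X in _ <= _ + X -> _]eq_Rintegral do rewrite -mulN1r.
rewrite RintegralZ_cont// mulN1r -[in X in X -> _]subr_ge0.
rewrite -[in X in _ -> X]subr_ge0 => h; apply: le_trans h _.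
(* It remains to see that [f 0 0 = (A - 1) * eps ^ a] is nonnegative: [A >= 2] because
   [2 * a - 1 <= 1]. *)
rewrite lerBlDr lerDl mulr_ge0// /al /rho !(expr0n, addr0)/=.
rewrite -[X in _ - X]mul1r -mulrBl mulr_ge0 ?powR_ge0// subr_ge0.
have [a2 a1] := andP a12.
rewrite /A mulrC ler_pdivlMr; lra.
Qed.
End small_exponent.

Section large_exponent.
Variable b : R.
Hypothesis b_ge0 : 0 <= b.
(* The Laplacian of [c * (u ^+ 2 * rho ^ b)] dominates that of [rho ^ (b + 1)],
   and [c * (u ^+ 2 * rho ^ b)] is at most [rho ^ (b + 1) / 2] or
   [c * (2 * c) ^ b * (u ^+ 2) ^ (b + 1)]. *)
Let c := 2 * (b + 1) ^+ 2.

Let f u v := c * (u ^+ 2 * rho u v `^ b) - rho u v `^ (b + 1).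
Let f1 u v := c * (2 * u * rho u v `^ b +
    u ^+ 2 * (b * rho u v `^ (b - 1) * (2 * u)))
  - (b + 1) * rho u v `^ b * (2 * u).
Let f2 u v := c * (u ^+ 2 * (b * rho u v `^ (b - 1) * (2 * v)))
  - (b + 1) * rho u v `^ b * (2 * v).
Let f11 u v := c * (2 * rho u v `^ b + 10 * b * u ^+ 2 * rho u v `^ (b - 1)
    + 4 * b * (b - 1) * u ^+ 4 * rho u v `^ (b - 1 - 1))
  - (b + 1) * (4 * b * u ^+ 2 * rho u v `^ (b - 1) + 2 * rho u v `^ b).
Let f12 u v := c * (4 * b * u * v * rho u v `^ (b - 1)
    + 4 * b * (b - 1) * u ^+ 3 * v * rho u v `^ (b - 1 - 1))
  - (b + 1) * (4 * b * u * v * rho u v `^ (b - 1)).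
Let f22 u v := c * (2 * b * u ^+ 2 * rho u v `^ (b - 1)
    + 4 * b * (b - 1) * u ^+ 2 * v ^+ 2 * rho u v `^ (b - 1 - 1))
  - (b + 1) * (4 * b * v ^+ 2 * rho u v `^ (b - 1) + 2 * rho u v `^ b).

Let df : chain2 f f1 f2.
Proof.
move=> u v t du dv hu hv; have hr := drho hu hv.
apply: is_derive_by; eexists; first by rewrite /f; der.
by rewrite /f1 /f2 /= addrK; ring.
Qed.
Let df1 : chain2 f1 f11 f12.
Proof.
move=> u v t du dv hu hv; have hr := drho hu hv.
apply: is_derive_by; eexists; first by rewrite /f1; der.
by rewrite /f11 /f12 /=; ring.
Qed.
Let df2 : chain2 f2 f12 f22.
Proof.
move=> u v t du dv hu hv; have hr := drho hu hv.
apply: is_derive_by; eexists; first by rewrite /f2; der.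
by rewrite /f12 /f22 /=; ring.
Qed.

Let cf : continuous2 f.
Proof. rewrite /continuous2 /f. move: crho => ?; cont. Qed.
Let cf1 : continuous2 f1.
Proof. rewrite /continuous2 /f1. move: crho => ?; cont. Qed.
Let cf2 : continuous2 f2.
Proof. rewrite /continuous2 /f2. move: crho => ?; cont. Qed.
Let cf11 : continuous2 f11.
Proof. rewrite /continuous2 /f11. move: crho => ?; cont. Qed.
Let cf12 : continuous2 f12.
Proof. rewrite /continuous2 /f12. move: crho => ?; cont. Qed.
Let cf22 : continuous2 f22.
Proof. rewrite /continuous2 /f22. move: crho => ?; cont. Qed.

Let lap u v : 0 <= f11 u v + f22 u v.
Proof.
have pa x : 0 < x -> x `^ b = x `^ (b - 1 - 1) * x ^+ 2.
  by move=> x0; rewrite -powR_addn//; congr (_ `^ _); ring.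
have pb x : 0 < x -> x `^ (b - 1) = x `^ (b - 1 - 1) * x.
  by move=> x0; rewrite -[in RHS](expr1 x) -powR_addn// subrK.
have rho0 := ltW (rho_gt0 u v).
have X0 := powR_ge0 (rho u v) (b - 1 - 1).
rewrite /f11 /f22 !pb ?pa//.
set X := rho u v `^ _ in X0 *.
(* The value of [c] makes the [rho ^ b] terms cancel, as [2 * c = 4 * (b + 1) ^ 2]. The possibly
   negative coefficient [b - 1] is compensated by writing [u ^ 2 + v ^ 2] as [rho - eps]. *)
suff : 0 <= X * (c * (b * u ^+ 2 * (8 * rho u v + 4 * eps
    + 4 * b * (u ^+ 2 + v ^+ 2))) + 4 * (b + 1) * b * eps * rho u v).
  move=> /le_trans; apply; rewrite le_eqVlt; apply/orP; left; apply/eqP.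
  by rewrite /c /rho; ring.
have e0 : 0 <= eps by exact: ltW.
have c0 : 0 <= c by rewrite /c mulr_ge0// sqr_ge0.
have uv0 : 0 <= u ^+ 2 + v ^+ 2 by rewrite addr_ge0 ?sqr_ge0.
have b1 : 0 <= b + 1 by rewrite addr_ge0.
apply: mulr_ge0 => //; apply: addr_ge0; last by rewrite !mulr_ge0.
apply: mulr_ge0 => //; apply: mulr_ge0; first by rewrite mulr_ge0 ?sqr_ge0.
have r1 : 0 <= 8 * rho u v + 4 * eps by rewrite addr_ge0// mulr_ge0.
by rewrite addr_ge0// !mulr_ge0.
Qed.

Lemma large_exponent_mean s : all (fun e => 0 < e.2)%N s ->
  \int[mu]_(x in `[0, 2]) (rho (harm 0 s 1 x) (harm 0 (rot s) 1 x)) `^ (b + 1)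
  <= 4 * eps `^ (b + 1) + 2 * (c * (2 * c) `^ b) *
    \int[mu]_(x in `[0, 2]) (harm 0 s 1 x ^+ 2) `^ (b + 1).
Proof.
move=> s0; have cu := @continuous_harm R 0 s 1.
have cv := @continuous_harm R 0 (rot s) 1.
set U := harm 0 s 1 in cu *; set V := harm 0 (rot s) 1 in cv *.
have crp e : continuous (fun x => rho (U x) (V x) `^ e).
  apply: continuous_powR_fun; first by move=> x; exact: rho_gt0.
  exact: continuous2_curve crho cu cv.
have cup : continuous (fun x => (U x ^+ 2) `^ (b + 1)).
  under eq_fun do rewrite sqr_powR.
  apply: continuous_norm_powR_fun => //.
  by rewrite mulr_gt0// ltr_wpDl.
have b1 : 0 <= b + 1 by rewrite addr_ge0.
have c0 : 0 < c by rewrite /c mulr_gt0// exprn_gt0// ltr_wpDl.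
have cur : continuous (fun x => U x ^+ 2 * rho (U x) (V x) `^ b).
  by apply: continuousM_fun => //; exact: continuousX_fun.
set I := Rintegral _ _ _; set J := Rintegral _ _ _.
have H1 : I <= 2 * eps `^ (b + 1) +
    c * \int[mu]_(x in `[0, 2]) (U x ^+ 2 * rho (U x) (V x) `^ b).
  have := subharmonic_mean df df1 df2 cf cf1 cf2 cf11 cf12 cf22 lap s0.
  rewrite /f RintegralD_cont; last 2 first.
  - by apply: continuousM_fun => //; exact: continuous_cst_fun.
  - exact: continuousN_fun.
  rewrite RintegralZ_cont//.
  under [X in _ <= _ + X -> _]eq_Rintegral do rewrite -mulN1r.
  rewrite RintegralZ_cont// mulN1r -/U -/V -/I.
  rewrite /rho !(expr0n, addr0)/= !(mul0r, mulr0) sub0r mulrN.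
  by move: (c * _) (2 * _) => x y; lra.
(* Half of [I] may stay on the right: it is moved to the left-hand side of [H1] at the end, which
   doubles the constants. *)
have H2 : c * \int[mu]_(x in `[0, 2]) (U x ^+ 2 * rho (U x) (V x) `^ b) <=
    2^-1 * I + c * (2 * c) `^ b * J.
  rewrite -!RintegralZ_cont// -RintegralD_cont; last 2 first.
  - by apply: continuousM_fun => //; exact: continuous_cst_fun.
  - by apply: continuousM_fun => //; exact: continuous_cst_fun.
  apply: le_Rintegral_cont.
  - by apply: continuousM_fun => //; exact: continuous_cst_fun.
  - apply: continuousD_fun; apply: continuousM_fun => //;
      exact: continuous_cst_fun.
  move=> x _; have r0 := rho_gt0 (U x) (V x).
  have u0 : 0 <= U x ^+ 2 by exact: sqr_ge0.
  move: (rho _ _) (U x ^+ 2) r0 u0 => r w r0 w0.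
  have [wr|rw] := leP (2 * c * w) r.
    rewrite -[leLHS]addr0 lerD ?mulr_ge0 ?powR_ge0 ?(ltW c0)//.
    rewrite (powR_addn b 1 r0) expr1.
    have : 0 <= r `^ b * (r - 2 * c * w) by rewrite mulr_ge0 ?powR_ge0 ?subr_ge0.
    by move: (r `^ b) => y; lra.
  apply: (@le_trans _ _ (c * (2 * c) `^ b * w `^ (b + 1))); last first.
    by rewrite lerDr mulr_ge0 ?powR_ge0.
  have w0' : 0 < w.
    rewrite lt_def w0 andbT; apply: contraTneq rw => ->.
    by rewrite mulr0 -leNgt ltW.
  rewrite (powR_addn b 1 w0') expr1.
  have h : r `^ b <= (2 * c) `^ b * w `^ b.
    have c2 : 0 <= 2 * c by rewrite mulr_ge0// ltW.
    by rewrite -powRM// ge0_ler_powR ?nnegrE ?mulr_ge0// ltW.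
  have := ler_wpM2l (mulr_ge0 (ltW c0) w0) h.
  by move: (r `^ b) ((2 * c) `^ b) (w `^ b) => x1 x2 x3; lra.
move: H1 H2; rewrite -/J; set X := Rintegral _ _ _.
by move: (c * X) (c * _ `^ _) (eps `^ _) => x y z; lra.
Qed.
End large_exponent.
End subharmonic_functions.

(** The two ranges [p <= 2] and [p > 2] need different subharmonic functions, because [al ^ (a - 1)]
    dominates [rho ^ (a - 1)] only for [a <= 1]. Both give a constant independent of [eps], which
    then tends to 0. *)
Lemma conjugate_bound (R : realType) (p : R) : 1 < p ->
  exists2 C : R, 0 <= C & forall s : seq (R * R * nat),
    all (fun e => 0 < e.2)%N s ->
    \int[lebesgue_measure]_(x in `[0, 2]) (`|harm 0 (rot s) 1 x| `^ p) <=
    C * \int[lebesgue_measure]_(x in `[0, 2]) (`|harm 0 s 1 x| `^ p).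
Proof.
move=> p1; pose a := p / 2.
have a0 : 0 < a by rewrite divr_gt0//; lra.
have pa : p = 2 * a by rewrite /a mulrC divfK.
have [C C0 HC] : exists2 C : R, 0 <= C & forall (s : seq (R * R * nat)) (eps : R),
    all (fun e => 0 < e.2)%N s -> 0 < eps ->
    \int[lebesgue_measure]_(x in `[0, 2])
      (eps + harm 0 s 1 x ^+ 2 + harm 0 (rot s) 1 x ^+ 2) `^ a <=
    C * (eps `^ a + \int[lebesgue_measure]_(x in `[0, 2])
      ((harm 0 s 1 x ^+ 2) `^ a)).
  have [a1|a1] := leP a 1.
    have A0 : 0 <= (2 * a - 1)^-1 * 2 by rewrite mulr_ge0// invr_ge0; lra.
    move AE : (_^-1 * 2) A0 => A A0.
    exists (A * (2 `^ a) * 2); first exact: mulr_ge0 (mulr_ge0 A0 (powR_ge0 _ _)) (ler0n _ 2).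
    move=> s eps s0 e0.
    have cu := @continuous_harm R 0 s 1.
    have cup : continuous (fun x => (harm 0 s 1 x ^+ 2) `^ a).
      under eq_fun do rewrite sqr_powR.
      by apply: continuous_norm_powR_fun => //; rewrite mulr_gt0.
    have a12 : 1 / 2 < a <= 1 by rewrite a1 andbT; lra.
    apply: le_trans (small_exponent_mean e0 a12 s0) _.
    rewrite AE -!mulrA ler_wpM2l// mulrDr.
    have -> : 2 `^ a * (2 * eps `^ a + 2 * \int[lebesgue_measure]_(x in `[0, 2])
        ((harm 0 s 1 x ^+ 2) `^ a)) =
        \int[lebesgue_measure]_(x in `[0, 2]) (2 `^ a * eps `^ a) +
        2 `^ a * (2 * \int[lebesgue_measure]_(x in `[0, 2])
        ((harm 0 s 1 x ^+ 2) `^ a)).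
      by rewrite Rintegral_cst_itv// subr0 mulrDr; ring.
    have I0 : 0 <= \int[lebesgue_measure]_(x in `[0, 2]) ((harm 0 s 1 x ^+ 2) `^ a).
      by apply: Rintegral_ge0 => x _; rewrite powR_ge0.
    apply: (@le_trans _ _ (\int[lebesgue_measure]_(x in `[0, 2])
        (2 `^ a * eps `^ a) + 2 `^ a * \int[lebesgue_measure]_(x in `[0, 2])
        ((harm 0 s 1 x ^+ 2) `^ a))); last first.
      by rewrite lerD2l ler_wpM2l ?powR_ge0//; lra.
    rewrite -RintegralZ_cont// -RintegralD_cont; last 2 first.
    - exact: continuous_cst_fun.
    - by apply: continuousM_fun => //; exact: continuous_cst_fun.
    apply: le_Rintegral_cont.
    - apply: continuous_powR_fun.
        by move=> x; rewrite ltr_wpDr// sqr_ge0.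
      apply: continuousD_fun; first exact: continuous_cst_fun.
      exact: continuousX_fun.
    - apply: continuousD_fun; first exact: continuous_cst_fun.
      by apply: continuousM_fun => //; exact: continuous_cst_fun.
    by move=> x _; rewrite -mulrDr powR_add_le ?sqr_ge0// ltW.
  have b0 : 0 <= a - 1 by lra.
  have c0 : 0 <= 2 * (a - 1 + 1) ^+ 2 by rewrite mulr_ge0// sqr_ge0.
  move cE : (2 * _) c0 => c c0.
  have d0 : 0 <= c * (2 * c) `^ (a - 1) by rewrite mulr_ge0// powR_ge0.
  exists (4 + 2 * (c * (2 * c) `^ (a - 1))).
    by rewrite addr_ge0// mulr_ge0.
  move=> s eps s0 e0; have := large_exponent_mean e0 b0 s0.
  rewrite cE subrK => /le_trans; apply.
  have I0 : 0 <= \int[lebesgue_measure]_(x in `[0, 2]) ((harm 0 s 1 x ^+ 2) `^ a).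
    by apply: Rintegral_ge0 => x _; rewrite powR_ge0.
  have e1 := powR_ge0 eps a.
  move: (Rintegral _ _ _) (c * _ `^ _) (eps `^ a) I0 d0 e1 => x y z x0 y0 z0.
  by nra.
exists C => // s s0; rewrite pa.
under eq_Rintegral do rewrite -sqr_powR.
under [X in _ <= _ * X]eq_Rintegral do rewrite -sqr_powR.
apply/ler_addgt0Pr => e e0.
(* With [eps = d ^ (1 / a)] the extra term is [C * d], at most [e]. *)
pose d := e / (C + 1).
have C1 : 0 < C + 1 by rewrite ltr_wpDl.
have d0 : 0 < d by rewrite divr_gt0.
have eps0 : 0 < d `^ a^-1 by exact: powR_gt0.
apply: (@le_trans _ _ (C * ((d `^ a^-1) `^ a + \int[lebesgue_measure]_(x in `[0, 2])
      ((harm 0 s 1 x ^+ 2) `^ a)))); last first.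
  rewrite powR_invK ?(ltW d0)// ?gt_eqF// mulrDr addrC lerD2l.
  by rewrite /d mulrCA ler_piMr ?(ltW e0)// ler_pdivrMr// mul1r; lra.
apply: le_trans (HC _ _ s0 eps0).
have cu := @continuous_harm R 0 s 1.
have cv := @continuous_harm R 0 (rot s) 1.
apply: le_Rintegral_cont.
- under eq_fun do rewrite sqr_powR.
  by apply: continuous_norm_powR_fun => //; rewrite mulr_gt0.
- apply: continuous_powR_fun.
    by move=> x; rewrite !ltr_wpDr// sqr_ge0.
  by apply: continuousD_fun; [apply: continuousD_fun; [exact: continuous_cst_fun|]|];
    exact: continuousX_fun.
move=> x _; rewrite ge0_ler_powR ?nnegrE ?sqr_ge0// ?(ltW a0)//.
- by rewrite !addr_ge0 ?sqr_ge0// ltW.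
- by rewrite lerDr addr_ge0 ?sqr_ge0// ltW.
Qed.

(** * Partial sums of sine series *)

Section dilation.
Context {R : realType}.
Local Notation mu := (@lebesgue_measure R).
Variable h : R -> R.
Hypotheses (ch : continuous h) (h_even : forall x, h (- x) = h x)
  (h_per : forall x, h (x + 2) = h x).

(** The base point [-2] leaves room to the left of 0, so that [P] has a two-sided derivative on all
    of [[0, +oo[]. *)
Let P (x : R) : R := \int[mu]_(t in `[-2, x]) h t.

Let dP (x : R) : -2 < x -> is_derive x 1 P (h x).
Proof.
move=> x2; have x1 : x < x + 1 by rewrite ltrDl.
have := continuous_FTC1_closed x1 (@continuous_integrable _ _ (-2) (x + 1) ch) x2
  (ch (x := x)).
by rewrite derive1E => -[d dE]; apply: DeriveDef.
Qed.

Let derive0_cst (f : R -> R) (a b : R) : a <= b ->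
  (forall x, a <= x <= b -> is_derive x 1 f 0) -> f b = f a.
Proof.
move=> ab df; apply/eqP; rewrite -subr_eq0 -normr_le0.
by rewrite -[leRHS](mul0r (b - a)) (derive_le_norm ab df)// => x _; rewrite normr0.
Qed.

Let P_per (x : R) : 0 <= x -> P (x + 2) = P x + (P 2 - P 0).
Proof.
move=> x0; have : P (x + 2) - P x = P (0 + 2) - P 0; last first.
  by rewrite add0r => <-; rewrite [RHS]addrC subrK.
apply: (@derive0_cst (fun t => P (t + 2) - P t) 0 x x0) => t /andP[t0 _].
have t2 : -2 < t by lra.
have t4 : -2 < t + 2 by lra.
apply: is_derive_by; eexists.
  eapply is_deriveD_fun; last by eapply is_deriveN_fun; exact: dP.
  eapply is_derive_comp_fun; first exact: dP.
  by eapply is_deriveD_fun; [exact: is_derive_id|exact: is_derive_cst].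
by rewrite h_per; ring.
Qed.

(** By evenness and periodicity [h] is symmetric about 1, so half a period carries half the
    integral. This is why dilations by odd integers, too, preserve the integral over [[0, 1]]. *)
Let P1 : P 1 - P 0 = (P 2 - P 0) / 2.
Proof.
have : P (2 - 1) + P 1 = P (2 - 0) + P 0.
  apply: (@derive0_cst (fun t => P (2 - t) + P t) 0 1 ler01) => t /andP[t0 t1].
  have t2 : -2 < t by lra.
  have t4 : -2 < 2 - t by lra.
  apply: is_derive_by; eexists.
    eapply is_deriveD_fun; last exact: dP.
    eapply is_derive_comp_fun; first exact: dP.
    eapply is_deriveD_fun; first exact: is_derive_cst.
    by eapply is_deriveN_fun; exact: is_derive_id.
  by rewrite -(h_even t) -(h_per (- t)) [2 + _]addrC; ring.
have -> : 2 - 1 = 1 :> R by ring.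
by rewrite subr0; lra.
Qed.

Let P_nat m : P m%:R - P 0 = m%:R * (P 1 - P 0).
Proof.
rewrite P1; elim/ltn_ind: m => -[|[|m]] IH.
- by rewrite subrr mul0r.
- by rewrite mul1r P1.
- rewrite -addn2 natrD P_per ?ler0n// addrAC (IH m) ?leqnSn//. by field.
Qed.

Lemma Rintegral_scale (a c : R) : 0 < a -> 0 < c ->
  \int[mu]_(x in `[0, a]) h (c * x) = (P (c * a) - P 0) / c.
Proof.
move=> a0 c0; have chc : continuous (fun x => h (c * x)).
  apply: continuous_comp_fun => // x.
  by apply: cvgM; [exact: cvg_cst|exact: cvg_id].
have dPc (x : R) : 0 <= x <= a -> is_derive x 1 (fun x => P (c * x) / c) (h (c * x)).
  move=> /andP[x0 _]; have cx : -2 < c * x.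
    by rewrite (lt_le_trans (y := 0))// ?mulr_ge0 ?(ltW c0)// ltrNl oppr0.
  apply: is_derive_by; eexists.
    eapply is_deriveM_fun; last exact: is_derive_cst.
    by eapply is_derive_comp_fun; [exact: dP|exact: is_derive_lin].
  by rewrite mulr0 addr0 mulfK// gt_eqF.
by rewrite (Rintegral_FTC a0 chc dPc) mulr0 -mulrBl.
Qed.

Lemma Rintegral_dilate m : (0 < m)%N ->
  \int[mu]_(x in `[0, 1]) h (m%:R * x) = \int[mu]_(x in `[0, 1]) h x.
Proof.
move=> m0; have m0R : 0 < m%:R :> R by rewrite ltr0n.
rewrite (Rintegral_scale ltr01 m0R) mulr1 P_nat mulrAC mulfV ?gt_eqF// mul1r.
transitivity (\int[mu]_(x in `[0, 1]) h (1 * x)).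
  by rewrite (Rintegral_scale ltr01 ltr01) mulr1 divr1.
by apply: eq_Rintegral => x _; rewrite mul1r.
Qed.

Lemma Rintegral_02_double :
  \int[mu]_(x in `[0, 2]) h (2 * x) = 2 * \int[mu]_(x in `[0, 1]) h x.
Proof.
have -> : \int[mu]_(x in `[0, 1]) h x = \int[mu]_(x in `[0, 1]) h (1 * x).
  by apply: eq_Rintegral => x _; rewrite mul1r.
rewrite !Rintegral_scale// mulr1 divr1.
have -> : 2 * 2 = 4%:R :> R by rewrite -natrM.
by rewrite P_nat; field.
Qed.
End dilation.

(** * Sine polynomials and their truncation by modulation *)

Section sine_sums.
Context {R : realType}.
Implicit Types (f : R -> R) (l : seq (R * nat)) (p t x : R).
Local Notation mu := (@lebesgue_measure R).

Definition dilate_sum f l x : R := \sum_(e <- l) e.1 * f (e.2%:R * x).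

Definition sinpi t : R := sin (pi * t).

Definition odd_periodic f := (forall t, f (- t) = - f t) /\
  (forall t, f (t + 2) = f t).

Lemma odd_periodic_nat f k t : odd_periodic f -> f (t + 2 * k%:R) = f t.
Proof.
move=> [_ fp]; elim: k => [|k IH]; first by rewrite mulr0 addr0.
by rewrite -[k.+1%:R]natr1 mulrDr mulr1 addrA fp.
Qed.

Lemma odd_periodic_dilate_sum f l :
  odd_periodic f -> odd_periodic (dilate_sum f l).
Proof.
move=> of_; have [fo fp] := of_; split=> t; rewrite /dilate_sum.
  by rewrite -sumrN; apply: eq_bigr => e _; rewrite mulrN fo mulrN.
apply: eq_bigr => e _; congr (_ * _).
by rewrite mulrDr [_%:R * 2]mulrC odd_periodic_nat.
Qed.

Lemma continuous_dilate_sum f l : continuous f -> continuous (dilate_sum f l).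
Proof.
move=> cf; apply: continuous_sum_seq => e; apply: continuousM_fun.
  exact: continuous_cst_fun.
apply: continuous_comp_fun => //.
by move=> t; apply: cvgM; [exact: cvg_cst|exact: cvg_id].
Qed.

Lemma odd_periodic_sinpi : odd_periodic sinpi.
Proof.
split=> t; rewrite /sinpi; first by rewrite mulrN sinN.
rewrite mulrDr; have -> : pi * 2 = pi *+ 2 *+ 1 :> R by rewrite mulr_natr.
by rewrite (periodicn (@sinD2pi R)).
Qed.

Lemma continuous_sinpi : continuous sinpi.
Proof.
move=> t; apply: (continuous_comp (f := fun t => pi * t)).
  by apply: cvgM; [exact: cvg_cst|exact: cvg_id].
exact: continuous_sin.
Qed.

Lemma Rintegral_norm_dilate f p m : 0 < p -> continuous f -> odd_periodic f ->
  (0 < m)%N -> \int[mu]_(x in `[0, 1]) (`|f (m%:R * x)| `^ p) =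
  \int[mu]_(x in `[0, 1]) (`|f x| `^ p).
Proof.
move=> p0 cf [fo fp]; apply: (Rintegral_dilate (h := fun x => `|f x| `^ p)).
- exact: continuous_norm_powR_fun.
- by move=> x; rewrite fo normrN.
- by move=> x; rewrite fp.
Qed.

Lemma Rintegral_norm_02 f p : 0 < p -> continuous f -> odd_periodic f ->
  \int[mu]_(x in `[0, 2]) (`|f (2 * x)| `^ p) =
  2 * \int[mu]_(x in `[0, 1]) (`|f x| `^ p).
Proof.
move=> p0 cf [fo fp]; apply: (Rintegral_02_double (h := fun x => `|f x| `^ p)).
- exact: continuous_norm_powR_fun.
- by move=> x; rewrite fo normrN.
- by move=> x; rewrite fp.
Qed.

(* With [M = 2N+1], the sum of the first [N] terms of [f] at [2x] is
   [sin (M pi x) H (cos (M pi x) f) - cos (M pi x) H (sin (M pi x) f)], [H]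
   being conjugation; [modc] and [mods] list the coefficients of the two
   products. The odd frequency [M] differs from all the even ones [2k]. *)
Section modulation.
Variable N : nat.
Let M := (N.*2.+1)%N.
(** Frequencies are natural numbers, so the integer [2k - M] is kept as its absolute value [d k] and
    its sign [sg k]. *)
Let d k := if (k <= N)%N then (M - k.*2)%N else (k.*2 - M)%N.
Let sg k : R := if (k <= N)%N then -1 else 1.

Definition modc l : seq (R * R * nat) := flatten [seq
  [:: (0, e.1 / 2, (e.2.*2 + M)%N); (0, sg e.2 * (e.1 / 2), d e.2)] | e <- l].
Definition mods l : seq (R * R * nat) := flatten [seq
  [:: (e.1 / 2, 0, d e.2); (- (e.1 / 2), 0, (e.2.*2 + M)%N)] | e <- l].

Lemma modc_gt0 l : all (fun e => 0 < e.2)%N (modc l).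
Proof.
elim: l => [//|[c k] l IH]; rewrite /modc /= IH andbT /d /M.
by apply/andP; split; [rewrite addnS|case: (leqP k N) => h; lia].
Qed.

Lemma mods_gt0 l : all (fun e => 0 < e.2)%N (mods l).
Proof.
elim: l => [//|[c k] l IH]; rewrite /mods /= IH andbT /d /M.
by apply/andP; split; [case: (leqP k N) => h; lia|rewrite addnS].
Qed.

Let dE k x : (d k)%:R * pi * x =
  sg k * (pi * (k%:R * (2 * x)) - M%:R * pi * x).
Proof.
rewrite /d /sg; case: (leqP k N) => h; rewrite natrB -?muln2 ?natrM; try ring.
- by rewrite /M; lia.
- by rewrite /M; lia.
Qed.

Let sE k x : (k.*2 + M)%:R * pi * x = pi * (k%:R * (2 * x)) + M%:R * pi * x.
Proof. by rewrite natrD -muln2 natrM; ring. Qed.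

Lemma harm_modc l x : harm 0 (modc l) 1 x =
  cos (M%:R * pi * x) * dilate_sum sinpi l (2 * x).
Proof.
rewrite /harm /dilate_sum /modc big_flatten big_map /= mulr_sumr.
apply: eq_bigr => -[c k] _ /=; rewrite !big_cons big_nil /= dE sE /sinpi.
set A := pi * _; set B := M%:R * _ * _.
rewrite !expr1n !expr0 sinD /sg.
by case: ifP => _; rewrite ?mulN1r ?mul1r ?sinN sinB; field.
Qed.

Lemma harm_mods l x : harm 0 (mods l) 1 x =
  sin (M%:R * pi * x) * dilate_sum sinpi l (2 * x).
Proof.
rewrite /harm /dilate_sum /mods big_flatten big_map /= mulr_sumr.
apply: eq_bigr => -[c k] _ /=; rewrite !big_cons big_nil /= dE sE /sinpi.
set A := pi * _; set B := M%:R * _ * _.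
rewrite !expr1n !expr0 cosD /sg.
by case: ifP => _; rewrite ?mulN1r ?mul1r ?cosN cosB; field.
Qed.

(** Conjugation distinguishes the sign of the shifted frequency [2k - M]. For [k <= N] the two
    demodulated halves add up to the term times [cos ^ 2 + sin ^ 2]; for [k > N] they cancel. *)
Lemma demodulate l x :
  dilate_sum sinpi [seq e <- l | (e.2 <= N)%N] (2 * x) =
  sin (M%:R * pi * x) * harm 0 (rot (modc l)) 1 x -
  cos (M%:R * pi * x) * harm 0 (rot (mods l)) 1 x.
Proof.
rewrite /harm /dilate_sum /mods /modc /rot !map_flatten -!map_comp.
rewrite !big_flatten !big_map /= big_filter big_mkcond !mulr_sumr -sumrB.
apply: eq_bigr => -[c k] _ /=; rewrite !big_cons !big_nil /= dE sE /sinpi.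
set A := pi * _; set B := M%:R * _ * _.
rewrite !expr1n !expr0 cosD sinD /sg.
case: ifP => _; rewrite ?mulN1r ?mul1r ?cosN ?sinN cosB sinB.
  transitivity (c * sin A * (cos B ^+ 2 + sin B ^+ 2)); last by field.
  by rewrite cos2Dsin2 mulr1.
by field.
Qed.
End modulation.

Lemma sine_partial_sum p : 1 < p -> exists2 K : R, 0 <= K & forall l N,
  \int[mu]_(x in `[0, 1])
    (`|dilate_sum sinpi [seq e <- l | (e.2 <= N)%N] x| `^ p) <=
  K * \int[mu]_(x in `[0, 1]) (`|dilate_sum sinpi l x| `^ p).
Proof.
move=> p1; have p0 : 0 < p by lra.
have [C C0 HC] := conjugate_bound p1.
exists (2 `^ p * (C + C)); first by rewrite mulr_ge0 ?powR_ge0 ?addr_ge0.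
move=> l N; set f := dilate_sum sinpi l; set g := dilate_sum sinpi _.
have op k := odd_periodic_dilate_sum k odd_periodic_sinpi.
have cs k : continuous (dilate_sum sinpi k).
  by apply: continuous_dilate_sum; exact: continuous_sinpi.
have [cf cg] : continuous f /\ continuous g by split; exact: cs.
have [of_ og] : odd_periodic f /\ odd_periodic g by split; exact: op.
(* Passing to [f (2 * x)] on [[0, 2]] makes all frequencies even and the interval a full period of
   the modulated polynomials. *)
rewrite -(ler_pM2l (ltr0n R 2)) mulrCA -!Rintegral_norm_02//.
have cf2 : continuous (fun x => `|f (2 * x)| `^ p).
  apply: continuous_norm_powR_fun => //; apply: continuous_comp_fun; first exact: cs.
  by move=> t; apply: cvgM; [exact: cvg_cst|exact: cvg_id].
have cg2 : continuous (fun x => `|g (2 * x)| `^ p).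
  apply: continuous_norm_powR_fun => //; apply: continuous_comp_fun; first exact: cs.
  by move=> t; apply: cvgM; [exact: cvg_cst|exact: cvg_id].
have ch s : continuous (fun x => `|harm 0 s 1 x| `^ p).
  by apply: continuous_norm_powR_fun => //; exact: continuous_harm.
have H s : all (fun e => 0 < e.2)%N s ->
    (forall x, `|harm 0 s 1 x| <= `|f (2 * x)|) ->
    \int[mu]_(x in `[0, 2]) (`|harm 0 (rot s) 1 x| `^ p) <=
    C * \int[mu]_(x in `[0, 2]) (`|f (2 * x)| `^ p).
  move=> s0 sf; apply: le_trans (HC s s0) _; rewrite ler_wpM2l//.
  apply: le_Rintegral_cont => // x _.
  by rewrite ge0_ler_powR ?nnegrE// ltW.
have H1 : \int[mu]_(x in `[0, 2]) (`|harm 0 (rot (modc N l)) 1 x| `^ p) <=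
    C * \int[mu]_(x in `[0, 2]) (`|f (2 * x)| `^ p).
  apply: H => [|x]; first exact: modc_gt0.
  by rewrite harm_modc normrM ler_piMl// cos_max.
have H2 : \int[mu]_(x in `[0, 2]) (`|harm 0 (rot (mods N l)) 1 x| `^ p) <=
    C * \int[mu]_(x in `[0, 2]) (`|f (2 * x)| `^ p).
  apply: H => [|x]; first exact: mods_gt0.
  by rewrite harm_mods normrM ler_piMl// sin_max.
rewrite -mulrA mulrDl.
apply: le_trans (ler_wpM2l (powR_ge0 _ _) (lerD H1 H2)).
rewrite -RintegralD_cont// -RintegralZ_cont; last exact: continuousD_fun.
apply: le_Rintegral_cont => //.
  by apply: continuousM_fun; [exact: continuous_cst_fun|exact: continuousD_fun].
move=> x _; apply: le_trans (powR_add_le (ltW p0) (normr_ge0 _) (normr_ge0 _)).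
rewrite ge0_ler_powR ?nnegrE ?addr_ge0 ?(ltW p0)//.
rewrite /g demodulate (le_trans (ler_normB _ _))// !normrM lerD//.
  by rewrite ler_piMl// sin_max.
by rewrite ler_piMl// cos_max.
Qed.
End sine_sums.

(** * The sine series of the triangle wave *)

Section triangle_series.
Context {R : realType}.
Implicit Types (t x : R) (j J : nat).

Definition oddn j : nat := j.*2.+1.
Definition wt j : R := (oddn j)%:R ^- 2.

(* Partial sums of the sine series of the triangle wave, up to a constant. *)
Definition tsum J t : R :=
  \sum_(0 <= j < J) (-1) ^+ j * wt j * sinpi ((oddn j)%:R * t).

Lemma wt_ge0 j : 0 <= wt j.
Proof. by rewrite /wt invr_ge0 exprn_ge0. Qed.

Lemma wt0 : wt 0 = 1.
Proof. by rewrite /wt /oddn expr1n invr1. Qed.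

(** Telescoping, from [(2j + 1) ^ 2 >= 4 * j * (j + 1)]. For [m = 1] it bounds the total weight of
    the higher harmonics by 1/4. *)
Lemma sum_wt_le m J : (0 < m)%N -> \sum_(m <= j < J) wt j <= (4 * m%:R)^-1.
Proof.
move=> m0; have m0R : 0 < m%:R :> R by rewrite ltr0n.
have [Jm|mJ] := leqP J m.
  by rewrite big_geq// invr_ge0 mulr_ge0.
have step j : (0 < j)%N -> wt j <= (4 * j%:R)^-1 - (4 * j.+1%:R)^-1.
  move=> j0; have j0R : 0 < j%:R :> R by rewrite ltr0n.
  have -> : (4 * j%:R)^-1 - (4 * j.+1%:R)^-1 = (4 * j%:R * (j%:R + 1))^-1 :> R.
    rewrite -[j.+1%:R]natr1; field; rewrite gt_eqF//=.
    by rewrite gt_eqF// addr_gt0.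
  rewrite /wt lef_pV2 ?posrE ?exprn_gt0 ?mulr_gt0 ?addr_gt0 ?ltr0n//.
  by rewrite /oddn -[j.*2.+1%:R]natr1 -muln2 natrM; lra.
suff : \sum_(m <= j < J) wt j <= (4 * m%:R)^-1 - (4 * J%:R)^-1.
  by move=> /le_trans; apply; rewrite gerBl invr_ge0 mulr_ge0.
elim: J mJ => [//|J IH]; rewrite ltnS leq_eqVlt => /predU1P[<-{IH}|mJ].
  by rewrite big_nat1 step.
rewrite big_nat_recr ?(ltnW mJ)//= -[leRHS](subrKA (4 * J%:R)^-1).
by rewrite lerD ?IH ?step// (leq_trans m0)// ltnW.
Qed.

Lemma norm_tsumB J J' t : (0 < J)%N -> (J <= J')%N ->
  `|tsum J' t - tsum J t| <= (4 * J%:R)^-1.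
Proof.
move=> J0 JJ'; rewrite /tsum (big_cat_nat (n := J) (leq0n J) JJ')/= addrAC subrr add0r.
apply: le_trans (sum_wt_le J' J0); apply: le_trans (ler_norm_sum _ _ _) _.
apply: ler_sum => j _; rewrite !normrM normrX normrN1 expr1n mul1r.
by rewrite ger0_norm ?wt_ge0// ler_piMr ?wt_ge0// sin_max.
Qed.

Lemma inv4_small (e : R) : 0 < e ->
  exists2 J, (0 < J)%N & forall J', (J <= J')%N -> (4 * J'%:R)^-1 < e.
Proof.
move=> e0; exists (Num.truncn e^-1).+1 => // J' JJ'.
have J'0 : 0 < J'%:R :> R by rewrite ltr0n (leq_trans _ JJ').
rewrite invf_plt ?posrE ?mulr_gt0//.
have : e^-1 < J'%:R.
  apply: lt_le_trans (_ : (Num.truncn e^-1).+1%:R <= _); last by rewrite ler_nat.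
  exact: truncnS_gt.
by lra.
Qed.

Lemma tsum_limit : exists T : R -> R,
  forall J t, (0 < J)%N -> `|T t - tsum J t| <= (4 * J%:R)^-1.
Proof.
have ct t : cvgn (tsum ^~ t).
  apply: cauchy_cvg; apply: cauchy_exP => e e0.
  have [J J0 HJ] := inv4_small e0; exists (tsum J t).
  exists J => // J' /= JJ'; rewrite /ball/= distrC.
  exact: le_lt_trans (norm_tsumB _ J0 JJ') (HJ J (leqnn J)).
exists (fun t => limn (tsum ^~ t)) => J t J0; apply/ler_addgt0Pr => e e0.
move/cvgrPdist_le : (ct t) => /(_ e e0)[N _ HN].
pose J' := maxn N J.
have h1 : `|limn (tsum ^~ t) - tsum J' t| <= e by apply: HN; exact: leq_maxl.
have h2 := norm_tsumB t J0 (leq_maxr N J).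
rewrite -(subrKA (tsum J' t)) (le_trans (ler_normD _ _))// addrC lerD//.
Qed.

(** Up to the factors [pi] and [- pi], the derivatives of [tsum] and of [wsum]; the point of
    differentiating twice is that [zsum] has a closed form. *)
Definition wsum J t : R :=
  \sum_(0 <= j < J) (-1) ^+ j / (oddn j)%:R * cos (pi * ((oddn j)%:R * t)).
Definition zsum J t : R :=
  \sum_(0 <= j < J) (-1) ^+ j * sin (pi * ((oddn j)%:R * t)).

Let dpi k t : is_derive t 1 (fun t : R => pi * (k%:R * t)) (pi * k%:R).
Proof. by apply: is_deriveZ_fun; exact: is_derive_lin. Qed.

Let odd_neq0 j : (oddn j)%:R != 0 :> R.
Proof. by rewrite pnatr_eq0. Qed.

Lemma is_derive_tsum J t : is_derive t 1 (tsum J) (pi * wsum J t).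
Proof.
rewrite /wsum mulr_sumr; apply: is_derive_sum_seq => j; rewrite /sinpi.
apply: is_derive_by; eexists.
  eapply is_deriveZ_fun; eapply is_derive_comp_fun; last exact: dpi.
  exact: is_derive_sin.
by rewrite /wt; field.
Qed.

Lemma is_derive_wsum J t : is_derive t 1 (wsum J) (- pi * zsum J t).
Proof.
rewrite /zsum mulr_sumr; apply: is_derive_sum_seq => j.
apply: is_derive_by; eexists.
  eapply is_deriveZ_fun; eapply is_derive_comp_fun; last exact: dpi.
  exact: is_derive_cos.
by field.
Qed.

(** An alternating Dirichlet kernel: [2 * cos b * sin a = sin (a + b) + sin (a - b)] makes the
    alternating sum telescope. *)
Lemma zsumE J t :
  2 * cos (pi * t) * zsum J t = - (-1) ^+ J * sin (pi * ((J.*2)%:R * t)).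
Proof.
elim: J => [|J IH]; rewrite /zsum.
  by rewrite big_geq// !mulr0 mul0r mulr0 sin0 mulr0.
rewrite big_nat_recr//= mulrDr -/(zsum J t) IH exprS.
have -> : pi * ((J.*2)%:R * t) = pi * ((oddn J)%:R * t) - pi * t.
  by rewrite /oddn -[J.*2.+1%:R]natr1; ring.
have -> : pi * ((J.+1.*2)%:R * t) = pi * ((oddn J)%:R * t) + pi * t.
  by rewrite doubleS /oddn -[J.*2.+2%:R]natr1; ring.
by rewrite sinB sinD; ring.
Qed.

(* [wsum J] has the oscillating derivative [sin (2J pi t) / cos (pi t)], whose
   primitive is [O(1/J)] away from [t = 1/2]: so [tsum J] is nearly linear. *)
Lemma wsum_near_cst J t b : (0 < J)%N -> 0 <= t <= b -> b < 2^-1 ->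
  `|wsum J t - wsum J 0| <= (pi + 2) * (4 * J%:R)^-1 * cos (pi * b) ^- 2.
Proof.
move=> J0 /andP[t0 tb] b2; have pi0 := pi_gt0 R.
have JR : 0 < J%:R :> R by rewrite ltr0n.
have b0 : 0 <= b by exact: le_trans tb.
have d0 : 0 < cos (pi * b).
  apply: cos_gt0_pihalf; apply/andP; split; last by rewrite ltr_pM2l.
  by rewrite (lt_le_trans (y := 0)) ?oppr_lt0 ?divr_gt0// mulr_ge0// ltW.
have cd s : 0 <= s <= b -> cos (pi * b) <= cos (pi * s).
  move=> /andP[s0 sb]; rewrite leNgt ltr_cos.
  - by rewrite -leNgt ler_pM2l.
  - by rewrite in_itv/= mulr_ge0 ?(ltW pi0)//= ler_piMr ?(ltW pi0)//; lra.
  - by rewrite in_itv/= mulr_ge0 ?(ltW pi0)//= ler_piMr ?(ltW pi0)//; lra.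
move: (cos (pi * b)) (cos_le1 (pi * b)) d0 cd => d d1 d0 cd.
pose C := (-1) ^+ J * (4 * J%:R)^-1 : R.
have CE : `|C| = (4 * J%:R)^-1.
  by rewrite /C normrM normrX normrN1 expr1n mul1r ger0_norm//.
(* Integration by parts in disguise: the added term is of size 1/J, and its derivative cancels the
   oscillating part of [wsum'], leaving a remainder that is again of size 1/J. *)
pose Y s := wsum J s + C * (cos (pi * ((J.*2)%:R * s)) * (cos (pi * s))^-1).
have dY s : 0 <= s <= b -> is_derive s 1 Y
    (C * (pi * cos (pi * ((J.*2)%:R * s)) * sin (pi * s) * cos (pi * s) ^- 2)).
  move=> sb; have c0 : cos (pi * s) != 0 by rewrite gt_eqF// (lt_le_trans d0) ?cd.
  have zE : zsum J s = - (-1) ^+ J * sin (pi * ((J.*2)%:R * s)) / (2 * cos (pi * s)).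
    by rewrite -zsumE mulrAC mulfV ?mul1r// mulf_neq0.
  apply: is_derive_by; eexists.
    eapply is_deriveD_fun; first exact: is_derive_wsum.
    eapply is_deriveZ_fun; eapply is_deriveM_fun.
      by eapply is_derive_comp_fun; [exact: is_derive_cos|exact: dpi].
    exact: is_deriveV.
  rewrite /GRing.scale/= zE /C -muln2 natrM; field.
  by rewrite c0 gt_eqF.
have dY' s : 0 <= s <= b -> `|C * (pi * cos (pi * ((J.*2)%:R * s)) *
    sin (pi * s) * cos (pi * s) ^- 2)| <= (4 * J%:R)^-1 * (pi * d ^- 2).
  move=> sb; rewrite normrM CE ler_wpM2l ?invr_ge0 ?mulr_ge0 ?(ltW JR)//.
  have cs0 := lt_le_trans d0 (cd s sb).
  rewrite !normrM (ger0_norm (ltW pi0)) -!mulrA ler_wpM2l ?(ltW pi0)// mulrA.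
  rewrite -[leRHS]mul1r ler_pM ?mulr_ge0//.
    by rewrite -[leRHS]mul1r ler_pM ?cos_max ?sin_max.
  rewrite ger0_norm ?invr_ge0 ?exprn_ge0 ?(ltW cs0)//.
  rewrite lef_pV2 ?posrE ?exprn_gt0//.
  by rewrite lerXn2r ?nnegrE ?(ltW d0) ?(ltW cs0) ?cd.
have YW s : 0 <= s <= b -> `|Y s - wsum J s| <= (4 * J%:R)^-1 * d ^- 2.
  move=> sb; rewrite /Y addrAC subrr add0r normrM CE.
  rewrite ler_wpM2l ?invr_ge0 ?mulr_ge0 ?(ltW JR)// normrM.
  have cs0 := lt_le_trans d0 (cd s sb).
  rewrite -[leRHS]mul1r ler_pM ?cos_max//.
  rewrite ger0_norm ?invr_ge0 ?(ltW cs0)// lef_pV2 ?posrE ?exprn_gt0//.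
  by rewrite (le_trans _ (cd s sb))// expr2 ler_piMr// ltW.
have Yt : `|Y t - Y 0| <= (4 * J%:R)^-1 * (pi * d ^- 2).
  have sub s : 0 <= s <= t -> 0 <= s <= b.
    by move=> /andP[-> /le_trans ->].
  have := derive_le_norm t0 (fun s st => dY s (sub s st)) (fun s st => dY' s (sub s st)).
  move=> /le_trans; apply; rewrite ler_piMr//; last by lra.
  by rewrite !mulr_ge0 ?invr_ge0 ?mulr_ge0 ?(ltW JR) ?(ltW pi0) ?exprn_ge0 ?(ltW d0).
have Wt : `|wsum J t - Y t| <= (4 * J%:R)^-1 * d ^- 2.
  by rewrite distrC YW// t0.
have W0 := YW 0; rewrite lexx b0 in W0; have {}W0 := W0 isT.
have -> : wsum J t - wsum J 0 =
    (wsum J t - Y t) + (Y t - Y 0) + (Y 0 - wsum J 0) by ring.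
rewrite (le_trans (ler_normD _ _))//.
have := lerD (le_trans (ler_normD _ _) (lerD Wt Yt)) W0.
by move=> /le_trans; apply; rewrite le_eqVlt; apply/orP; left; apply/eqP; ring.
Qed.

Lemma tsum_near_linear J t b : (0 < J)%N -> 0 <= t <= b -> b < 2^-1 ->
  `|tsum J t - t * (pi * wsum J 0)| <=
  pi * ((pi + 2) * cos (pi * b) ^- 2) * (4 * J%:R)^-1.
Proof.
move=> J0 /andP[t0 tb] b2; have pi0 := pi_gt0 R.
have JR : 0 < J%:R :> R by rewrite ltr0n.
pose f s := tsum J s - s * (pi * wsum J 0).
have df s : 0 <= s <= t -> is_derive s 1 f (pi * (wsum J s - wsum J 0)).
  move=> _; apply: is_derive_by; eexists.
    eapply is_deriveD_fun; first exact: is_derive_tsum.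
    eapply is_deriveN_fun; eapply is_deriveM_fun; first exact: is_derive_id.
    exact: is_derive_cst.
  by rewrite /=; ring.
have f'C s : 0 <= s <= t -> `|pi * (wsum J s - wsum J 0)| <=
    pi * ((pi + 2) * cos (pi * b) ^- 2) * (4 * J%:R)^-1.
  move=> /andP[s0 st]; rewrite normrM (ger0_norm (ltW pi0)) -mulrA.
  rewrite ler_wpM2l ?(ltW pi0)// mulrAC.
  by apply: wsum_near_cst; rewrite ?s0 ?(le_trans st).
have f0 : f 0 = 0.
  rewrite /f mul0r subr0 /tsum big1_seq// => j _.
  by rewrite /sinpi !mulr0 sin0 mulr0.
have := derive_le_norm t0 df f'C; rewrite f0 subr0 /f subr0 => /le_trans; apply.
rewrite ler_piMr//; last by lra.
have c0 : 0 <= cos (pi * b) ^- 2 by rewrite invr_ge0 sqr_ge0.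
apply: mulr_ge0; last by rewrite invr_ge0 mulr_ge0// ltW.
apply: mulr_ge0; first exact: ltW.
by apply: mulr_ge0 => //; rewrite addr_ge0// ltW.
Qed.

Lemma eq0_inv4 (x K : R) : 0 <= K ->
  (forall J, (0 < J)%N -> `|x| <= K * (4 * J%:R)^-1) -> x = 0.
Proof.
move=> K0 H; apply/eqP; rewrite -normr_le0; apply/ler_addgt0Pr => e e0.
have K1 : 0 < K + 1 by rewrite ltr_wpDl.
have [J J0 HJ] := inv4_small (divr_gt0 e0 K1).
apply: le_trans (H J J0) _; rewrite add0r.
apply: le_trans (ler_wpM2l K0 (ltW (HJ J (leqnn J)))) _.
by rewrite mulrCA ler_piMr ?(ltW e0)// ler_pdivrMr// mul1r; lra.
Qed.

Section limit.
Variable T : R -> R.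
Hypothesis TT : forall J t, (0 < J)%N -> `|T t - tsum J t| <= (4 * J%:R)^-1.

(** Near [s] and near [t] the partial sums follow the same slope [pi * wsum J 0]; the combination
    [t * T s - s * T t] eliminates it. *)
Let T_linear s t : 0 <= s <= t -> t < 2^-1 -> t * T s = s * T t.
Proof.
move=> /andP[s0 st] t2; apply/eqP; rewrite -subr_eq0; apply/eqP.
have t0 := le_trans s0 st; have pi0 := pi_gt0 R.
pose K := pi * ((pi + 2) * cos (pi * t) ^- 2).
have K0 : 0 <= K.
  have c0 : 0 <= cos (pi * t) ^- 2 by rewrite invr_ge0 sqr_ge0.
  apply: mulr_ge0; first exact: ltW.
  by apply: mulr_ge0 => //; rewrite addr_ge0// ltW.
apply: (@eq0_inv4 _ (2 * (K + 1))) => [|J J0]; first by rewrite mulr_ge0 ?addr_ge0.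
have hs : `|tsum J s - s * (pi * wsum J 0)| <= K * (4 * J%:R)^-1.
  by apply: tsum_near_linear => //; rewrite s0.
have ht : `|tsum J t - t * (pi * wsum J 0)| <= K * (4 * J%:R)^-1.
  by apply: tsum_near_linear => //; rewrite t0 lexx.
have Hs := TT s J0; have Ht := TT t J0.
move: (pi * wsum J 0) (tsum J s) (tsum J t) ((4 * J%:R)^-1) hs ht Hs Ht.
move=> w a b e hs ht Hs Ht.
have -> : t * T s - s * T t = t * (T s - a) + t * (a - s * w) - s * (T t - b)
  - s * (b - t * w) by ring.
have bnd y z c : 0 <= y -> y <= t -> `|z| <= c -> `|y * z| <= 2^-1 * c.
  move=> y0 yt zc; rewrite normrM ger0_norm// ler_pM//; lra.
have := bnd t _ _ t0 (lexx t) Hs; have := bnd t _ _ t0 (lexx t) hs.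
have := bnd s _ _ s0 st Ht; have := bnd s _ _ s0 st ht.
set x1 := s * _; set x2 := s * _; set x3 := t * _; set x4 := t * _.
move=> h1 h2 h3 h4.
have -> : 2 * (K + 1) * e = 2^-1 * e + 2^-1 * (K * e) + 2^-1 * e + 2^-1 * (K * e)
   + (K * e + e) by field.
have Ke : 0 <= K * e + e.
  by apply: addr_ge0; [apply: le_trans hs|apply: le_trans Hs].
apply: (@le_trans _ _ (2^-1 * e + 2^-1 * (K * e) + 2^-1 * e + 2^-1 * (K * e))).
  rewrite (le_trans (ler_normB _ _))// lerD//.
  rewrite (le_trans (ler_normB _ _))// lerD//.
  by rewrite (le_trans (ler_normD _ _))// lerD.
by rewrite lerDl.
Qed.

Let eqT (c : R) a b : `|c| = 1 -> (forall J, tsum J a = c * tsum J b) ->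
  T a = c * T b.
Proof.
move=> c1 ab; apply/eqP; rewrite -subr_eq0; apply/eqP.
apply: (@eq0_inv4 _ 2) => // J J0.
have -> : T a - c * T b = (T a - tsum J a) - c * (T b - tsum J b).
  by rewrite (ab J); ring.
rewrite (le_trans (ler_normB _ _))// normrM c1 mul1r mulr2n mulrDl mul1r.
by rewrite lerD ?TT.
Qed.

(** At 1/2 the estimate [tsum_near_linear] degenerates, since [cos (pi / 2) = 0]. For each [J], a
    point [z < 1/2] is chosen by continuity of the single sum [tsum J], at a cost of the same order
    as its truncation error. *)
Let T_half t : 0 <= t -> t < 2^-1 -> 2^-1 * T t = t * T 2^-1.
Proof.
move=> t0 t2; apply/eqP; rewrite -subr_eq0; apply/eqP.
apply: (@eq0_inv4 _ (`|T t| + 3)) => [|J J0]; first by rewrite addr_ge0.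
have e0 : 0 < (4 * J%:R)^-1 :> R by rewrite invr_gt0 mulr_gt0 ?ltr0n.
have ct : {for 2^-1, continuous (tsum J)}.
  exact: is_derive_continuous (is_derive_tsum J 2^-1).
have /cvgrPdist_le/(_ _ e0) ctl : tsum J z @[z --> (2^-1)^'-] --> tsum J 2^-1.
  by apply: cvg_at_left_filter; exact: ct.
near ((2^-1 : R)^'-)%classic => z.
have zt : t < z by near: z; exact: nbhs_left_gt.
have z2 : z < 2^-1 by near: z; exact: nbhs_left_lt.
have ze : 2^-1 - (4 * J%:R)^-1 < z by near: z; apply: nbhs_left_gt; rewrite gtrBl.
have Hz : `|tsum J 2^-1 - tsum J z| <= (4 * J%:R)^-1.
  by near: z; exact: ctl.
have Tz := T_linear (t := z) (s := t); rewrite t0 ltW// z2 in Tz.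
have {}Tz := Tz isT isT.
have Hz1 := TT z J0; have H2 := TT 2^-1 J0.
have -> : 2^-1 * T t - t * T 2^-1 = (2^-1 - z) * T t +
    t * ((T z - tsum J z) - (T 2^-1 - tsum J 2^-1) - (tsum J 2^-1 - tsum J z)).
  by transitivity (2^-1 * T t - z * T t + (t * T z - t * T 2^-1)); [rewrite Tz|]; ring.
rewrite [leRHS]mulrDl (le_trans (ler_normD _ _))// lerD//.
  by rewrite normrM mulrC ler_wpM2l// ger0_norm; lra.
rewrite normrM -[leRHS]mul1r ler_pM//; first by rewrite ger0_norm; lra.
have -> : 3 * (4 * J%:R)^-1 = (4 * J%:R)^-1 + (4 * J%:R)^-1 + (4 * J%:R)^-1 :> R.
  by ring.
by rewrite (le_trans (ler_normB _ _))// lerD// (le_trans (ler_normB _ _))// lerD.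
Unshelve. all: by end_near. Qed.

Let tsumN J t : tsum J (- t) = -1 * tsum J t.
Proof.
rewrite /tsum mulr_sumr; apply: eq_bigr => j _.
by rewrite mulrN (odd_periodic_sinpi).1; ring.
Qed.

Let tsumD1 J t : tsum J (t + 1) = -1 * tsum J t.
Proof.
rewrite /tsum mulr_sumr; apply: eq_bigr => j _.
rewrite /sinpi mulrDr mulr1 mulrDr.
have -> : pi * (oddn j)%:R = pi *+ oddn j :> R by rewrite mulr_natr.
rewrite (alternatingn (@sinDpi R)) [in (-1) ^+ oddn j]/oddn exprS -muln2 exprM sqrr_sign.
by ring.
Qed.

Let norm1 : `|-1 : R| = 1. Proof. by rewrite normrN1. Qed.

Let TD1 t : T (t + 1) = - T t.
Proof. by rewrite (eqT norm1 (fun J => tsumD1 J t)) mulN1r. Qed.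

Let TN t : T (- t) = - T t.
Proof. by rewrite (eqT norm1 (fun J => tsumN J t)) mulN1r. Qed.

Let TDn t n : T (t + n%:R) = (-1) ^+ n * T t.
Proof.
elim: n => [|n IH]; first by rewrite addr0 mul1r.
by rewrite -[n.+1%:R]natr1 addrA TD1 IH exprS mulN1r mulNr.
Qed.

Let TDz t (n : int) : T (t + n%:~R) = (-1) ^ n * T t.
Proof.
case: n => n; first exact: TDn.
have -> : (Negz n)%:~R = - n.+1%:R :> R by rewrite NegzE mulrNz.
rewrite -[in RHS](subrK n.+1%:R t) TDn mulrA.
have -> : (-1) ^ Negz n = ((-1) ^+ n.+1)^-1 :> R by [].
by rewrite mulVf ?mul1r// expf_neq0// oppr_eq0 oner_neq0.
Qed.

Let T_tent t : 0 <= t -> t < 1 -> T t = T 2^-1 * tent t.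
Proof.
move=> t0 t1; rewrite /tent; case: ifPn => [|]; last rewrite -ltNge.
  rewrite le_eqVlt => /predU1P[->|t2]; first by rewrite mulfV ?mulr1.
  have := T_half t0 t2; lra.
(* Oddness and antiperiodicity give symmetry about 1/2, which carries the linear branch over to the
   descending one. *)
move=> t2; have -> : T t = T (1 - t) by rewrite addrC TD1 TN opprK.
have h0 : 0 <= 1 - t by lra.
have h2 : 1 - t < 2^-1 by lra.
have := T_half h0 h2; lra.
Qed.

Let T_triangle t : T t = T 2^-1 * triangle_wave t.
Proof.
rewrite /triangle_wave mulrCA -T_tent ?subr_ge0 ?floor_le//.
  by rewrite -TDz subrK.
by rewrite ltrBlDl; have := floorD1_gt t; rewrite intrD.
Qed.

(** The first partial sum is [sin (pi / 2) = 1] at 1/2, and the remainder is at most 1/4. *)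
Let T_gt0 : 0 < T 2^-1.
Proof.
have := TT 2^-1 (ltn0Sn 0).
rewrite /tsum big_nat1 wt0 expr0 !mul1r /sinpi.
rewrite sin_pihalf.
by rewrite ler_norml => /andP[+ _]; lra.
Qed.

Lemma triangle_series_of_limit : exists2 La : R, 0 < La & forall J t,
  (0 < J)%N -> `|La * triangle_wave t - tsum J t| <= (4 * J%:R)^-1.
Proof.
by exists (T 2^-1) => [|J t J0]; [exact: T_gt0|rewrite -T_triangle TT].
Qed.
End limit.

(** The constant is the sum of the inverse squares of the odd numbers, that is [pi ^ 2 / 8]; its
    positivity is all that is recorded. *)
Lemma triangle_series : exists2 La : R, 0 < La & forall J t,
  (0 < J)%N -> `|La * triangle_wave t - tsum J t| <= (4 * J%:R)^-1.
Proof. by have [T TT] := tsum_limit; exact: triangle_series_of_limit TT. Qed.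
End triangle_series.

(** * Partial sums of triangle series *)

Section comparison.
Context {R : realType}.
Implicit Types (l : seq (R * nat)) (p t x : R) (j J : nat).
Local Notation mu := (@lebesgue_measure R).
Local Notation S := (@triangle_wave R).

(** A uniform limit of sine sums; this avoids a case analysis at the points where the branches of
    the wave meet. *)
Lemma continuous_triangle_wave : continuous S.
Proof.
have [La La0 H] := @triangle_series R => t.
apply/cvgrPdist_le => e e0.
have e4 : 0 < e * La / 3 by rewrite divr_gt0// mulr_gt0.
have [J J0 HJ] := inv4_small e4; have {}HJ := ltW (HJ J (leqnn J)).
have ct : {for t, continuous (tsum J)}.
  exact: is_derive_continuous (is_derive_tsum J t).
move/cvgrPdist_le : ct => /(_ _ e4) ct.
near=> z; rewrite -(ler_pM2l La0).
have hz : `|tsum J t - tsum J z| <= e * La / 3 by near: z.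
have h1 := le_trans (H J t J0) HJ; have h2 := le_trans (H J z J0) HJ.
rewrite -[X in X * _ <= _](gtr0_norm La0) -normrM.
have -> : La * (S t - S z) = (La * S t - tsum J t) - (La * S z - tsum J z)
  + (tsum J t - tsum J z) by ring.
have -> : La * e = e * La / 3 + e * La / 3 + e * La / 3 by field.
by rewrite (le_trans (ler_normD _ _))// lerD// (le_trans (ler_normB _ _))// lerD.
Unshelve. all: by end_near. Qed.

(* Young's inequality at the points [a i] and [4 * \sum_i w i * a i]. *)
Lemma powR_sum_le (I : Type) (s : seq I) (w a : I -> R) p : 1 < p ->
  (forall i, 0 <= w i) -> (forall i, 0 <= a i) -> \sum_(i <- s) w i <= 4^-1 ->
  (4 * \sum_(i <- s) w i * a i) `^ p <= 4 * \sum_(i <- s) w i * a i `^ p.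
Proof.
move=> p1 w0 a0 w4; have p0 : 0 < p by lra.
set y := 4 * _; have y0 : 0 <= y.
  by rewrite mulr_ge0// sumr_ge0// => i _; rewrite mulr_ge0.
pose q := p / (p - 1).
have q0 : 0 < q by rewrite divr_gt0//; lra.
have pq : p^-1 + q^-1 = 1.
  by rewrite /q invfM invrK; field; rewrite gt_eqF.
have young i : p * (a i * y `^ (p - 1)) <= a i `^ p + (p - 1) * y `^ p.
  have := conjugate_powR (a0 i) (powR_ge0 y (p - 1)) p0 q0 pq.
  rewrite -[(y `^ _) `^ q]powRrM (_ : (p - 1) * q = p); last first.
    by rewrite /q mulrC divfK// gt_eqF//; lra.
  rewrite -(ler_pM2l p0) => /le_trans; apply; rewrite mulrDr.
  rewrite [p * (_ / p)]mulrC divfK ?gt_eqF// lerD2l /q invfM invrK.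
  by rewrite mulrCA mulrA mulrA mulfK ?gt_eqF// [leLHS]mulrC.
have : \sum_(i <- s) w i * (p * (a i * y `^ (p - 1))) <=
    \sum_(i <- s) w i * (a i `^ p + (p - 1) * y `^ p).
  by apply: ler_sum => i _; rewrite ler_wpM2l.
have -> : \sum_(i <- s) w i * (p * (a i * y `^ (p - 1))) = p / 4 * y `^ p.
  transitivity (\sum_(i <- s) (w i * a i) * (p * y `^ (p - 1))).
    by apply: eq_bigr => i _; ring.
  rewrite -mulr_suml -(mulr_powRB1 y0 p0).
  have -> : \sum_(i <- s) w i * a i = y / 4 by rewrite /y mulrC mulKf.
  by ring.
under eq_bigr do rewrite mulrDr.
rewrite big_split/= -mulr_suml.
have : (\sum_(i <- s) w i) * ((p - 1) * y `^ p) <= 4^-1 * ((p - 1) * y `^ p).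
  by rewrite ler_wpM2r// mulr_ge0 ?powR_ge0//; lra.
move: (\sum_(i <- s) w i) (\sum_(i <- s) w i * _) (y `^ p) => A B Y h1 h2.
have -> : Y = 4 * (p / 4 * Y - 4^-1 * ((p - 1) * Y)) by field.
by rewrite ler_pM2l//; lra.
Qed.

(* The series of [S] without its first term, with [g] in place of [sinpi]. *)
Definition tsum_tail (g : R -> R) J x : R :=
  \sum_(1 <= j < J) (-1) ^+ j * wt j * g ((oddn j)%:R * x).

(** Every dilate of [g] has the same integral of the p-th power, and the weights sum to at most 1/4:
    as an operator on odd 2-periodic functions the tail has norm at most 1/4. *)
Lemma tsum_tail_bound (g : R -> R) p J : 1 < p -> continuous g ->
  odd_periodic g ->
  4 `^ p * \int[mu]_(x in `[0, 1]) (`|tsum_tail g J x| `^ p) <=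
  \int[mu]_(x in `[0, 1]) (`|g x| `^ p).
Proof.
move=> p1 cg og; have p0 : 0 < p by lra.
have cod j : continuous (fun x => g ((oddn j)%:R * x)).
  apply: continuous_comp_fun => //.
  by move=> t; apply: cvgM; [exact: cvg_cst|exact: cvg_id].
have codp j : continuous (fun x => `|g ((oddn j)%:R * x)| `^ p).
  exact: continuous_norm_powR_fun.
have ctail : continuous (fun x => `|tsum_tail g J x| `^ p).
  apply: continuous_norm_powR_fun => //; apply: continuous_sum_seq => j.
  by apply: continuousM_fun; [exact: continuous_cst_fun|exact: cod].
rewrite -RintegralZ_cont//.
have w4 : \sum_(1 <= j < J) wt j <= 4^-1 :> R.
  by apply: le_trans (sum_wt_le J (ltn0Sn 0)) _; rewrite mulr1.
apply: (@le_trans _ _ (\int[mu]_(x in `[0, 1])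
    (4 * \sum_(1 <= j < J) wt j * `|g ((oddn j)%:R * x)| `^ p))).
  apply: le_Rintegral_cont.
  - by apply: continuousM_fun => //; exact: continuous_cst_fun.
  - apply: continuousM_fun; first exact: continuous_cst_fun.
    apply: continuous_sum_seq => j.
    by apply: continuousM_fun; [exact: continuous_cst_fun|exact: codp].
  move=> x _; rewrite -powRM//.
  apply: le_trans (powR_sum_le p1 _ (fun j => normr_ge0 (g ((oddn j)%:R * x))) w4).
    rewrite ge0_ler_powR ?nnegrE ?mulr_ge0 ?(ltW p0)//.
      by apply: sumr_ge0 => j _; rewrite mulr_ge0 ?wt_ge0.
    rewrite ler_wpM2l// (le_trans (ler_norm_sum _ _ _))//.
    apply: ler_sum => j _; rewrite !normrM normrX normrN1 expr1n mul1r.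
    by rewrite (ger0_norm (wt_ge0 j)).
  by move=> j; exact: wt_ge0.
have -> : \int[mu]_(x in `[0, 1])
    (4 * \sum_(1 <= j < J) wt j * `|g ((oddn j)%:R * x)| `^ p) =
    4 * \sum_(1 <= j < J) wt j * \int[mu]_(x in `[0, 1]) (`|g x| `^ p).
  rewrite RintegralZ_cont; last first.
    apply: continuous_sum_seq => j.
    by apply: continuousM_fun; [exact: continuous_cst_fun|exact: codp].
  congr (_ * _); elim: (index_iota 1 J) => [|j s IH].
    under eq_Rintegral do rewrite big_nil.
    by rewrite big_nil Rintegral_cst_itv ?mul0r.
  under eq_Rintegral do rewrite big_cons.
  rewrite big_cons RintegralD_cont ?IH; last 2 first.
  - by apply: continuousM_fun; [exact: continuous_cst_fun|exact: codp].
  - apply: continuous_sum_seq => i.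
    by apply: continuousM_fun; [exact: continuous_cst_fun|exact: codp].
  rewrite RintegralZ_cont; last exact: codp.
  have h := @Rintegral_norm_dilate R g p (oddn j) p0 cg og isT.
  by rewrite h.
rewrite -mulr_suml mulrA ler_piMl//; last by lra.
by apply: Rintegral_ge0 => x _; exact: powR_ge0.
Qed.
End comparison.

(** * Equivalence of the L_p norms of triangle sums and sine sums *)

Section triangle_sums.
Context {R : realType}.
Implicit Types (l : seq (R * nat)) (p t x : R) (j J : nat).
Local Notation mu := (@lebesgue_measure R).
Local Notation S := (@triangle_wave R).

Let ml l : R := \sum_(e <- l) `|e.1|.

(** Dilations commute, so the higher harmonics of a sum of dilates are the tail operator applied to
    the corresponding sine sum. *)
Lemma dilate_sum_tsum l J x : (0 < J)%N ->
  dilate_sum (tsum J) l x =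
  dilate_sum sinpi l x + tsum_tail (dilate_sum sinpi l) J x.
Proof.
move=> J0; have -> : dilate_sum sinpi l x + tsum_tail (dilate_sum sinpi l) J x =
    \sum_(0 <= j < J) (-1) ^+ j * wt j * dilate_sum sinpi l ((oddn j)%:R * x).
  by rewrite big_ltn// expr0 wt0 !mul1r.
rewrite /dilate_sum /tsum; under eq_bigr do rewrite mulr_sumr.
rewrite exchange_big/=; apply: eq_bigr => j _; rewrite mulr_sumr.
apply: eq_bigr => e _; rewrite mulrCA; congr (_ * (_ * sinpi _)).
by rewrite mulrCA.
Qed.

Lemma dilate_sum_err (f g : R -> R) e l x : (forall t, `|f t - g t| <= e) ->
  `|dilate_sum f l x - dilate_sum g l x| <= e * ml l.
Proof.
move=> fg; rewrite /dilate_sum -sumrB mulr_sumr.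
rewrite (le_trans (ler_norm_sum _ _ _))//; apply: ler_sum => i _.
by rewrite -mulrBr normrM mulrC ler_wpM2r.
Qed.

Lemma dilate_sumZ (f : R -> R) c l x :
  dilate_sum (fun t => c * f t) l x = c * dilate_sum f l x.
Proof. by rewrite /dilate_sum mulr_sumr; apply: eq_bigr => e _; rewrite mulrCA. Qed.

(** Up to a truncation error, [La * G] is [g] plus a tail of norm at most a quarter of that of [g]:
    the identity perturbed by a strict contraction. *)
Lemma sine_triangle_compare p : 1 < p -> exists2 C : R, 0 <= C & forall l,
  \int[mu]_(x in `[0, 1]) (`|dilate_sum sinpi l x| `^ p) <=
    C * \int[mu]_(x in `[0, 1]) (`|dilate_sum S l x| `^ p) /\
  \int[mu]_(x in `[0, 1]) (`|dilate_sum S l x| `^ p) <=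
    C * \int[mu]_(x in `[0, 1]) (`|dilate_sum sinpi l x| `^ p).
Proof.
move=> p1; have p0 : 0 < p by lra.
have [La La0 H] := @triangle_series R.
pose P := (2 : R) `^ p.
have P2 : 2 <= P by rewrite /P le1r_powR ?ltW//; lra.
have P0 : 0 <= P by lra.
have PP : P * P = 4 `^ p by rewrite -powRM// -natrM.
pose C0 := 2 * (P * P).
have C00 : 0 <= C0 by rewrite !mulr_ge0.
suff key l : let A := \int[mu]_(x in `[0, 1]) (`|dilate_sum sinpi l x| `^ p) in
    let B := \int[mu]_(x in `[0, 1]) (`|La * dilate_sum S l x| `^ p) in
    A <= C0 * B /\ B <= C0 * A.
  have L0 := powR_gt0 p La0; have L0' := ltW L0.
  exists (C0 * (La `^ p + (La `^ p)^-1)).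
    by rewrite mulr_ge0// addr_ge0 ?invr_ge0.
  move=> l; have := key l => /=.
  have -> : \int[mu]_(x in `[0, 1]) (`|La * dilate_sum S l x| `^ p) =
      La `^ p * \int[mu]_(x in `[0, 1]) (`|dilate_sum S l x| `^ p).
    rewrite -RintegralZ_cont; last first.
      apply: continuous_norm_powR_fun => //; apply: continuous_dilate_sum.
      exact: continuous_triangle_wave.
    apply: eq_Rintegral => x _.
    by rewrite normrM (gtr0_norm La0) powRM// ltW.
  have I0 (f : R -> R) : 0 <= \int[mu]_(x in `[0, 1]) (`|f x| `^ p).
    by apply: Rintegral_ge0 => x _; exact: powR_ge0.
  have := I0 (dilate_sum S l); have := I0 (dilate_sum sinpi l).
  move: (Rintegral _ _ _) (Rintegral _ _ _) => B A A0 B0 [AB BA].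
  have Li : 0 <= (La `^ p)^-1 by rewrite invr_ge0.
  split.
    apply: le_trans AB _; rewrite mulrA ler_wpM2r// ler_wpM2l//.
    by rewrite lerDl.
  rewrite -(ler_pM2l L0); apply: le_trans BA _.
  rewrite [leRHS](_ : _ = (La `^ p * La `^ p + 1) * (C0 * A)); last first.
    by field; rewrite gt_eqF.
  by rewrite ler_peMl ?mulr_ge0// lerDr mulr_ge0.
move=> A B; set g := dilate_sum sinpi l in A *; set G := dilate_sum S l in B *.
have cg : continuous g.
  by apply: continuous_dilate_sum; exact: continuous_sinpi.
have cG : continuous G.
  by apply: continuous_dilate_sum; exact: continuous_triangle_wave.
have og : odd_periodic g by apply: odd_periodic_dilate_sum; exact: odd_periodic_sinpi.
have cgp : continuous (fun x => `|g x| `^ p) by exact: continuous_norm_powR_fun.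
have cGp : continuous (fun x => `|La * G x| `^ p).
  apply: continuous_norm_powR_fun => //.
  by apply: continuousM_fun => //; exact: continuous_cst_fun.
have A0 : 0 <= A by apply: Rintegral_ge0 => x _; exact: powR_ge0.
suff step e : 0 < e -> A <= C0 * (B + e) /\ B <= C0 * (A + e).
  split; apply/ler_addgt0Pr => e e0; have C1 : 0 < C0 + 1 by rewrite ltr_wpDl.
    have [+ _] := step _ (divr_gt0 e0 C1); move=> /le_trans; apply.
    rewrite mulrDr lerD2l mulrCA ler_piMr ?(ltW e0)// ler_pdivrMr// mul1r; lra.
  have [_ +] := step _ (divr_gt0 e0 C1); move=> /le_trans; apply.
  rewrite mulrDr lerD2l mulrCA ler_piMr ?(ltW e0)// ler_pdivrMr// mul1r; lra.
move=> e0; have m0 : 0 <= ml l by apply: sumr_ge0.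
have m1 : 0 < ml l + 1 by rewrite ltr_wpDl.
(* The uniform error of the truncated series is multiplied by the sum [ml l] of the absolute
   coefficients; [J] is taken so that the p-th power of the product is at most [e]. *)
have [J J0 HJ] := inv4_small (divr_gt0 (powR_gt0 p^-1 e0) m1).
have {}HJ := HJ J (leqnn J).
pose er := (4 * J%:R)^-1 * ml l.
have er0 : 0 <= er by rewrite mulr_ge0// invr_ge0 mulr_ge0.
have erp : er `^ p <= e.
  rewrite -[leRHS](@powR_invK _ e p) ?(ltW e0) ?gt_eqF//.
  rewrite ge0_ler_powR ?nnegrE ?powR_ge0 ?(ltW p0)//.
  apply: (le_trans (ler_wpM2r m0 (ltW HJ))).
  rewrite mulrAC ler_pdivrMr// ler_wpM2l ?powR_ge0//; lra.
pose tl := tsum_tail g J.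
have ctl : continuous tl.
  apply: continuous_sum_seq => j; apply: continuousM_fun.
    exact: continuous_cst_fun.
  apply: continuous_comp_fun => //.
  by move=> t; apply: cvgM; [exact: cvg_cst|exact: cvg_id].
have ctlp : continuous (fun x => `|tl x| `^ p) by exact: continuous_norm_powR_fun.
have D4 := tsum_tail_bound J p1 cg og.
rewrite -/tl -/A -PP in D4.
have err x : `|La * G x - (g x + tl x)| <= er.
  rewrite -dilate_sumZ -dilate_sum_tsum//.
  by apply: dilate_sum_err => t; exact: H.
set D := \int[mu]_(x in `[0, 1]) (`|tl x| `^ p) in D4.
have D0 : 0 <= D by apply: Rintegral_ge0 => x _; exact: powR_ge0.
have three (u v : R -> R) w : continuous (fun x => `|u x| `^ p) ->
    continuous (fun x => `|v x| `^ p) -> continuous (fun x => `|w x| `^ p) ->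
    (forall x, `|w x| <= `|u x| + (`|v x| + er)) ->
    \int[mu]_(x in `[0, 1]) (`|w x| `^ p) <=
    P * \int[mu]_(x in `[0, 1]) (`|u x| `^ p) +
    P * P * (\int[mu]_(x in `[0, 1]) (`|v x| `^ p) + e).
  move=> cu cv cw wuv.
  have -> : \int[mu]_(x in `[0, 1]) (`|v x| `^ p) + e =
      \int[mu]_(x in `[0, 1]) (`|v x| `^ p + e).
    rewrite RintegralD_cont//; last exact: continuous_cst_fun.
    by rewrite Rintegral_cst_itv ?subr0 ?mulr1.
  have cve : continuous (fun x => `|v x| `^ p + e).
    by apply: continuousD_fun => //; exact: continuous_cst_fun.
  rewrite -!RintegralZ_cont// -RintegralD_cont; last 2 first.
  - by apply: continuousM_fun => //; exact: continuous_cst_fun.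
  - by apply: continuousM_fun => //; exact: continuous_cst_fun.
  apply: le_Rintegral_cont => //.
    by apply: continuousD_fun; apply: continuousM_fun => //; exact: continuous_cst_fun.
  move=> x _; apply: (@le_trans _ _ ((`|u x| + (`|v x| + er)) `^ p)).
    by rewrite ge0_ler_powR ?nnegrE ?addr_ge0 ?(ltW p0).
  have ve0 : 0 <= `|v x| + er by rewrite addr_ge0.
  apply: le_trans (powR_add_le (ltW p0) (normr_ge0 _) ve0) _.
  rewrite -/P -mulrA -mulrDr ler_wpM2l// lerD2l.
  apply: le_trans (powR_add_le (ltW p0) (normr_ge0 _) er0) _.
  by rewrite -/P ler_wpM2l// lerD2l.
have T1 : A <= P * D + P * P * (B + e).
  apply: three => // x.
  have -> : g x = - tl x + (La * G x - (La * G x - (g x + tl x))) by ring.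
  rewrite (le_trans (ler_normD _ _))// normrN lerD2l.
  by rewrite (le_trans (ler_normB _ _))// lerD2l.
have T2 : B <= P * A + P * P * (D + e).
  apply: three => // x.
  have -> : La * G x = g x + (tl x + (La * G x - (g x + tl x))) by ring.
  rewrite (le_trans (ler_normD _ _))// lerD2l.
  by rewrite (le_trans (ler_normD _ _))// lerD2l.
(* The factor [P = 2 ^ p] lost by splitting off the tail is recovered from [P * P * D <= A] and
   [P >= 2]; half of [A] remains and is absorbed. *)
have PD : P * D <= A / 2.
  have := ler_wpM2r (mulr_ge0 P0 D0) P2; rewrite !mulrA => h.
  have := le_trans h D4; rewrite -(mulrA 2); move: (P * D) => x; lra.
split; first by rewrite /C0; move: T1 PD; move: (P * D) => x; lra.
rewrite /C0; apply: le_trans T2 _; rewrite mulrDr.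
have PA : P * A <= (P * P - 1) * A.
  have h := ler_wpM2l P0 P2; rewrite ler_wpM2r// lerBrDr.
  by apply: le_trans h; move: P2; lra.
have e1 : 0 <= P * P * e by rewrite !mulr_ge0 ?(ltW e0).
have q1 : 0 <= P * P * A by rewrite !mulr_ge0.
by move: D4 PA e1 q1; move: (P * P) (P * A) => x y; lra.
Qed.

(** Sine and triangle sums share their list of coefficients, so truncating the list acts on both
    alike. *)
Lemma triangle_partial_sum p : 1 < p -> exists2 K : R, 0 <= K & forall l N,
  \int[mu]_(x in `[0, 1])
    (`|dilate_sum S [seq e <- l | (e.2 <= N)%N] x| `^ p) <=
  K * \int[mu]_(x in `[0, 1]) (`|dilate_sum S l x| `^ p).
Proof.
move=> p1; have [C C0 HC] := sine_triangle_compare p1.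
have [K K0 HK] := sine_partial_sum p1.
exists (C * (K * C)); first by rewrite !mulr_ge0.
move=> l N; set l' := [seq e <- l | _].
apply: le_trans (HC l').2 _; rewrite -mulrA ler_wpM2l//.
apply: le_trans (HK l N) _; rewrite -mulrA ler_wpM2l//.
exact: (HC l).1.
Qed.
End triangle_sums.

(** * Uniform approximation by triangle sums *)

Section uniform_approximation.
Context {R : realType}.
Implicit Types (l : seq (R * nat)) (f g : R -> R) (x : R) (c : R).
Local Notation S := (@triangle_wave R).

Definition tri_approx f := forall e, 0 < e ->
  exists2 l, all (fun i => 0 < i.2)%N l & forall x, `|f x - dilate_sum S l x| <= e.

Definition scale_list c l : seq (R * nat) := [seq (c * i.1, i.2) | i <- l].

Lemma dilate_sum_cat (h : R -> R) l1 l2 x :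
  dilate_sum h (l1 ++ l2) x = dilate_sum h l1 x + dilate_sum h l2 x.
Proof. by rewrite /dilate_sum big_cat. Qed.

Lemma dilate_sum_scale (h : R -> R) c l x :
  dilate_sum h (scale_list c l) x = c * dilate_sum h l x.
Proof.
by rewrite /dilate_sum big_map mulr_sumr; apply: eq_bigr => i _; rewrite mulrA.
Qed.

Lemma all_scale_list c l : all (fun i => 0 < i.2)%N (scale_list c l) =
  all (fun i => 0 < i.2)%N l.
Proof. by rewrite all_map. Qed.

Lemma tri_approx_ext f g : f =1 g -> tri_approx f -> tri_approx g.
Proof. by move=> fg af e /af[l l0 H]; exists l => // x; rewrite -fg. Qed.

Lemma tri_approx0 : tri_approx (fun=> 0).
Proof.
move=> e e0; exists [::] => // x.
by rewrite /dilate_sum big_nil subrr normr0 ltW.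
Qed.

Lemma tri_approxD f g : tri_approx f -> tri_approx g ->
  tri_approx (fun x => f x + g x).
Proof.
move=> af ag e e0; have e2 : 0 < e / 2 by rewrite divr_gt0.
have [l l0 Hl] := af _ e2; have [m m0 Hm] := ag _ e2.
exists (l ++ m); first by rewrite all_cat l0.
move=> x; rewrite dilate_sum_cat opprD addrACA (splitr e).
by rewrite (le_trans (ler_normD _ _))// lerD.
Qed.

Lemma tri_approxZ c f : tri_approx f -> tri_approx (fun x => c * f x).
Proof.
move=> af e e0; have c1 : 0 < `|c| + 1 by rewrite ltr_wpDl.
have [l l0 Hl] := af _ (divr_gt0 e0 c1).
exists (scale_list c l); first by rewrite all_scale_list.
move=> x; rewrite dilate_sum_scale -mulrBr normrM.
apply: le_trans (ler_wpM2l (normr_ge0 c) (Hl x)) _.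
by rewrite mulrCA ler_piMr ?(ltW e0)// ler_pdivrMr// mul1r; lra.
Qed.

(* [sin (k pi x)] is [La * S (k x)] minus sines of higher frequencies of total
   weight at most 1/4; approximate the latter by induction. *)
Lemma tri_approx_sin_pow2 n k : (0 < k)%N ->
  exists2 l, all (fun i => 0 < i.2)%N l &
  forall x, `|sinpi (k%:R * x) - dilate_sum S l x| <= 2^-1 ^+ n.
Proof.
have [La La0 H] := @triangle_series R.
elim: n k => [|n IH] k k0.
  exists [::] => // x; rewrite /dilate_sum big_nil subr0 expr0; exact: sin_max.
pose d : R := 2^-1 ^+ n.
have d0 : 0 < d by rewrite exprn_gt0.
have [J J0 HJ] := inv4_small (divr_gt0 d0 (ltr0n R 4)).
have {}HJ := HJ J (leqnn J).
have {IH} /choice[L HL] : forall k, exists l, (0 < k)%N ->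
    all (fun i => 0 < i.2)%N l /\
    forall x, `|sinpi (k%:R * x) - dilate_sum S l x| <= d.
  move=> m; have [->|m0] := posnP m; first by exists [::].
  by have [l l0 Hl] := IH m m0; exists l.
pose l := (La, k) :: flatten [seq scale_list (- ((-1) ^+ j * wt j))
  (L (oddn j * k)%N) | j <- index_iota 1 J].
exists l.
  rewrite /= k0; apply/allP => i /flattenP[_ /mapP[j _ ->]]; move: i; apply/allP.
  by rewrite all_scale_list; apply: (HL _ _).1; rewrite muln_gt0.
move=> x.
have -> : dilate_sum S l x = La * S (k%:R * x) - \sum_(1 <= j < J)
    (-1) ^+ j * wt j * dilate_sum S (L (oddn j * k)%N) x.
  rewrite /l /dilate_sum big_cons; congr (_ + _).
  rewrite big_flatten big_map -sumrN; apply: eq_bigr => j _.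
  rewrite -[LHS]/(dilate_sum S (scale_list _ _) x) dilate_sum_scale.
  by rewrite mulNr.
have sE : sinpi (k%:R * x) = tsum J (k%:R * x) - \sum_(1 <= j < J)
    (-1) ^+ j * wt j * sinpi ((oddn j * k)%:R * x).
  rewrite /tsum big_ltn// expr0 wt0 !mul1r.
  have hj j : (oddn j * k)%:R * x = (oddn j)%:R * (k%:R * x) by rewrite natrM mulrA.
  under [X in _ = _ - X]eq_bigr do rewrite hj.
  by rewrite addrK.
have -> : sinpi (k%:R * x) - (La * S (k%:R * x) - \sum_(1 <= j < J)
    (-1) ^+ j * wt j * dilate_sum S (L (oddn j * k)%N) x) =
  - (La * S (k%:R * x) - tsum J (k%:R * x)) - \sum_(1 <= j < J)
    (-1) ^+ j * wt j * (sinpi ((oddn j * k)%:R * x) -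
      dilate_sum S (L (oddn j * k)%N) x).
  rewrite sE; under [in RHS]eq_bigr do rewrite mulrBr.
  by rewrite sumrB; ring.
rewrite (le_trans (ler_normB _ _))// normrN.
(* The error is halved: a quarter of [d] for truncating the series, and a quarter for the higher
   harmonics, each known up to [d] with total weight at most 1/4. *)
have -> : 2^-1 ^+ n.+1 = d / 4 + 4^-1 * d :> R by rewrite exprS -/d; field.
apply: lerD; first exact: le_trans (H J _ J0) (ltW HJ).
apply: (@le_trans _ _ ((\sum_(1 <= j < J) wt j) * d)); last first.
  rewrite ler_wpM2r ?(ltW d0)//.
  by apply: le_trans (sum_wt_le J (ltn0Sn 0)) _; rewrite mulr1.
rewrite mulr_suml (le_trans (ler_norm_sum _ _ _))//; apply: ler_sum => j _.
rewrite !normrM normrX normrN1 expr1n mul1r (ger0_norm (wt_ge0 j)).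
by rewrite ler_wpM2l ?wt_ge0//; apply: (HL _ _).2; rewrite muln_gt0.
Qed.

Lemma tri_approx_sin k : tri_approx (fun x => sinpi (k%:R * x)).
Proof.
have [->|k0] := posnP k.
  apply: tri_approx_ext tri_approx0 => x.
  by rewrite /sinpi mul0r mulr0 sin0.
move=> e e0; have [n Hn] : exists n, (2^-1 : R) ^+ n <= e.
  have [n n0 Hn] := inv4_small e0; exists (4 * n)%N.
  apply: le_trans (ltW (Hn n (leqnn n))).
  rewrite exprVn lef_pV2 ?posrE ?exprn_gt0 ?mulr_gt0 ?ltr0n//.
  by rewrite -natrM -natrX ler_nat ltnW// ltn_expl.
have [l l0 Hl] := tri_approx_sin_pow2 n k0; exists l => // x.
exact: le_trans (Hl x) Hn.
Qed.

(** Multiplication by [cos (pi * x)] preserves sine sums: it averages the frequencies [k + 1] and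
    [k - 1]. *)
Lemma tri_approx_cos_sin j k :
  tri_approx (fun x => cos (pi * x) ^+ j * sinpi (k%:R * x)).
Proof.
elim: j k => [|j IH] k.
  by apply: tri_approx_ext (tri_approx_sin k) => x; rewrite expr0 mul1r.
case: k => [|k].
  apply: tri_approx_ext tri_approx0 => x.
  by rewrite /sinpi mul0r mulr0 sin0 mulr0.
have := tri_approxD (tri_approxZ 2^-1 (IH k.+2)) (tri_approxZ 2^-1 (IH k)).
apply: tri_approx_ext => x; rewrite /sinpi.
have -> : pi * (k.+2%:R * x) = pi * (k.+1%:R * x) + pi * x.
  by rewrite -[k.+2%:R]natr1; ring.
have -> : pi * (k%:R * x) = pi * (k.+1%:R * x) - pi * x.
  by rewrite -[k.+1%:R]natr1; ring.
by rewrite sinB sinD exprS; field.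
Qed.

Lemma tri_approx_horner (P : {poly R}) :
  tri_approx (fun x => P.[cos (pi * x)] * sinpi x).
Proof.
suff H n : tri_approx (fun x =>
    (\sum_(i < n) P`_i * cos (pi * x) ^+ i) * sinpi x).
  by apply: tri_approx_ext (H (size P)) => x; rewrite horner_coef.
elim: n => [|n IH].
  by apply: tri_approx_ext tri_approx0 => x; rewrite big_ord0 mul0r.
apply: tri_approx_ext (tri_approxD IH (tri_approxZ P`_n (tri_approx_cos_sin n 1))) => x.
by rewrite big_ord_recr/= (_ : 1%:R * x = x) ?mul1r//; ring.
Qed.
End uniform_approximation.

(** * The square ordering *)

Section square_ordering.
Local Open Scope nat_scope.
Implicit Types (a b k i m N M : nat).

(* The inverse of [sigma2] on positive pairs. *)
Definition rank2 a b : nat :=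
  if a <= b then b.-1 ^ 2 + a else a.-1 ^ 2 + (a.*2 - b).

(** The inverse of the iterated ordering on positive indices; since that ordering splits off the
    last coordinate first, it is a left fold. *)
Definition rank (s : seq nat) : nat := foldl rank2 (head 0 s) (behead s).

Lemma size_square_shell N : size (square_shell N) = N + N.-1.
Proof. by rewrite size_cat !size_map size_rev !size_iota. Qed.

Lemma square_listS N :
  square_list N.+1 = square_list N ++ square_shell N.+1.
Proof.
by rewrite /square_list -{1}[N.+1]addn1 iotaD map_cat flatten_cat/= cats0 add1n.
Qed.

Lemma size_square_list N : size (square_list N) = N ^ 2.
Proof.
elim: N => [//|N IH]; rewrite square_listS size_cat IH size_square_shell/=.
by rewrite -!mulnn; nia.
Qed.

Lemma nth_square_list N M i : N <= M -> i < N.*2.+1 -> N < M ->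
  nth (0, 0) (square_list M) (N ^ 2 + i) = nth (0, 0) (square_shell N.+1) i.
Proof.
move=> _ iN; elim: M => [//|M IH]; rewrite ltnS leq_eqVlt => /predU1P[->|NM].
  by rewrite square_listS nth_cat size_square_list ltnNge leq_addr/= addKn.
rewrite square_listS nth_cat size_square_list ifT ?IH//.
by rewrite -!mulnn; nia.
Qed.

Lemma nth_square_shell N i : i < N.*2.+1 ->
  nth (0, 0) (square_shell N.+1) i =
  if i <= N then (i.+1, N.+1) else (N.+1, N.*2.+1 - i).
Proof.
move=> iN; rewrite nth_cat size_map size_iota ltnS; case: leqP => Ni.
  by rewrite (nth_map 0) ?size_iota// nth_iota// add1n.
have h : i - N.+1 < size (rev (iota 1 N)) by rewrite size_rev size_iota; lia.
rewrite (nth_map 0)// nth_rev size_iota; last by move: h; rewrite size_rev size_iota.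
by rewrite nth_iota; [congr pair; lia|lia].
Qed.

(** The first [N] shells contain [N ^ 2] pairs, so shell [N + 1] starts at item [N ^ 2 + 1]; it runs
    up its column and back along its row. *)
Lemma sigma2E N i : i < N.*2.+1 -> sigma2 (N ^ 2 + i).+1 =
  if i <= N then (i.+1, N.+1) else (N.+1, N.*2.+1 - i).
Proof.
move=> iN; rewrite /sigma2 /= -nth_square_shell//.
by apply: nth_square_list => //; rewrite -?mulnn; nia.
Qed.

Lemma rank2K a b : 0 < a -> 0 < b -> sigma2 (rank2 a b) = (a, b).
Proof.
case: a b => [//|a] [//|b] _ _; rewrite /rank2 ltnS; case: leqP => ab /=.
  by rewrite addnS sigma2E ?ab//; lia.
have -> : a ^ 2 + (a.+1.*2 - b.+1) = (a ^ 2 + (a.*2 - b)).+1 by lia.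
rewrite sigma2E; last by lia.
by rewrite ifF; [congr pair; lia|lia].
Qed.

Lemma square_decomposition k : 0 < k ->
  exists N i, i < N.*2.+1 /\ k = (N ^ 2 + i).+1.
Proof.
elim: k => [//|[|k] IH] _; first by exists 0, 0.
have [N [i [iN ->]]] := IH (ltn0Sn k).
have [h|h] := ltnP i.+1 N.*2.+1; first by exists N, i.+1; rewrite addnS.
by exists N.+1, 0; split => //; rewrite -!mulnn; nia.
Qed.

Lemma sigma2_gt0 k : 0 < k -> 0 < (sigma2 k).1 /\ 0 < (sigma2 k).2.
Proof.
move=> /square_decomposition[N [i [iN ->]]]; rewrite sigma2E//.
by case: ifP => //=; split => //; lia.
Qed.

Lemma sigma2K k : 0 < k -> rank2 (sigma2 k).1 (sigma2 k).2 = k.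
Proof.
move=> /square_decomposition[N [i [iN ->]]]; rewrite sigma2E//.
case: (leqP i N) => h; rewrite /rank2 /=; first by rewrite ltnS h addnS.
by rewrite ifF; lia.
Qed.

(** An initial segment is a full square with part of the next shell, or a full square without the
    end of its last shell. Only separate thresholds on [a] and on [b] occur, so that [a] can itself
    be the rank of a shorter index. *)
Lemma rank2_le a b A B : 0 < a -> 0 < b -> 0 < A -> 0 < B ->
  (rank2 a b <= rank2 A B) =
  if A <= B then (a <= B.-1) && (b <= B.-1) ||
    [&& b <= B, ~~ (b <= B.-1) & a <= A]
  else [&& a <= A, b <= A & ~~ (~~ (a <= A.-1) && (b <= B.-1))].
Proof.
case: a b A B => [//|a] [//|b] [//|A] [//|B] _ _ _ _; rewrite /rank2 !ltnS /=.
rewrite -!mulnn.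
case: (leqP a b) => ab; case: (leqP A B) => AB.
- apply/idP/idP; nia.
- apply/idP/idP; nia.
- apply/idP/idP; nia.
- apply/idP/idP; nia.
Qed.
Lemma rank2_gt0 a b : 0 < a -> 0 < rank2 a b.
Proof. by rewrite /rank2; case: (leqP a b); lia. Qed.

Lemma rank_rcons s b : 0 < size s -> rank (rcons s b) = rank2 (rank s) b.
Proof. by case: s => [//|x s] _; rewrite /rank /= foldl_rcons. Qed.

Lemma rank_square_orderS m k : 0 < k ->
  rank (square_orderS m k) = k /\ all (ltn 0) (square_orderS m k).
Proof.
elim: m k => [|m IH] k k0; first by rewrite /rank /= k0.
have [a0 b0] := sigma2_gt0 k0; have [rE pos] := IH _ a0.
rewrite /= rank_rcons ?size_tuple// rE sigma2K//; split => //.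
rewrite all_rcons pos andbT; exact: b0.
Qed.

Lemma rank_gt0 s : 0 < size s -> all (ltn 0) s -> 0 < rank s.
Proof.
elim/last_ind: s => [//|s b IH] _; rewrite all_rcons => /andP[b0 s0].
case: s IH s0 => [//|x s] IH s0; rewrite rank_rcons//.
by apply: rank2_gt0; exact: IH.
Qed.

Lemma square_orderS_rank m (t : m.+1.-tuple nat) : all (ltn 0) t ->
  square_orderS m (rank t) = t.
Proof.
elim: m t => [|m IH] t.
  by case/tupleP: t => x t; rewrite tuple0 => _; apply: val_inj.
case: t => s; case/lastP: s => [//|s b] sz.
rewrite all_rcons => /andP[b0 s0].
have ss : size s == m.+1 by rewrite size_rcons eqSS in sz.
have s_gt0 : 0 < size s by rewrite (eqP ss).
have := IH (Tuple ss) s0 => /(congr1 val) /= E.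
by apply: val_inj; rewrite /= rank_rcons// rank2K ?rank_gt0//= E.
Qed.
End square_ordering.

(** * A criterion for Schauder bases *)

(* The coefficients of approximations of [x] are Cauchy in [R], and their limits
   are the coefficients of [x]. *)
Section basis_criterion.
Context {R : realType} {X : normedModType R}.
Variables (phi : nat -> X) (K : R).
Hypothesis K0 : 0 <= K.
Hypothesis phi0 : forall j, phi j != 0.

Let psum (a : nat -> R) m : X := \sum_(0 <= j < m) a j *: phi j.

Hypothesis basis_constant : forall a m l, (m <= l)%N ->
  `|psum a m| <= K * `|psum a l|.
Hypothesis dense_span : forall x e, 0 < e ->
  exists a l, `|x - psum a l| <= e.

Let psumB a b m : psum a m - psum b m = psum (a \- b) m.
Proof.
by rewrite /psum -sumrB; apply: eq_bigr => j _; rewrite -scalerBl.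
Qed.

Let coef_le a j l : (j < l)%N -> `|a j| * `|phi j| <= 2 * K * `|psum a l|.
Proof.
move=> jl; rewrite -normrZ.
have -> : a j *: phi j = psum a j.+1 - psum a j.
  by rewrite /psum big_nat_recr//= addrAC subrr add0r.
rewrite (le_trans (ler_normB _ _))// -mulrA mulr2n mulrDl mul1r.
by rewrite lerD// basis_constant// ltnW.
Qed.

Let cvg_psum a (u : nat -> nat -> R) m : (forall j, u n j @[n --> \oo] --> a j) ->
  psum (u n) m @[n --> \oo] --> psum a m.
Proof.
move=> ua; elim: m => [|m IH].
  rewrite /psum big_geq//; under eq_fun do rewrite big_geq//.
  exact: cvg_cst.
rewrite /psum big_nat_recr//=; under eq_fun do rewrite big_nat_recr//=.
by apply: cvgD => //; apply: cvgZr_tmp; exact: ua.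
Qed.

Lemma schauder_basis_criterion : schauder_basis phi.
Proof.
move=> x.
pose e (i : nat) : R := i.+1%:R^-1.
have e_gt0 i : 0 < e i by rewrite invr_gt0.
have small d : 0 < d -> exists N, forall i, (N <= i)%N -> e i <= d.
  move=> d0; exists (Num.truncn d^-1) => i Ni.
  rewrite /e invf_ple ?posrE//; apply/ltW.
  apply: lt_le_trans (_ : (Num.truncn d^-1).+1%:R <= _); first exact: truncnS_gt.
  by rewrite ler_nat.
have /choice[u Hu] : forall i, exists a : nat -> R, exists l,
    forall m, (l <= m)%N -> `|x - psum a m| <= e i.
  move=> i; have [a [l Hl]] := dense_span x (e_gt0 i).
  (* Padding the coefficients with zeros keeps all later partial sums equal to the approximation. *)
  exists (fun j => if (j < l)%N then a j else 0), l => m lm.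
  suff -> : psum (fun j => if (j < l)%N then a j else 0) m = psum a l by [].
  rewrite /psum (big_cat_nat (n := l))//= [X in _ + X]big1_seq ?addr0.
    by apply: eq_big_nat => j /andP[_ ->].
  move=> j; rewrite mem_index_iota => /andP[_ /andP[lj _]].
  by rewrite ltnNge lj scale0r.
have {Hu} /choice[L HL] := Hu.
(* At a sufficiently large common length both sums are near [x]; the basis constant transfers this
   closeness to every shorter length [m]. *)
have uu i i' m : `|psum (u i) m - psum (u i') m| <= K * (e i + e i').
  rewrite psumB; pose l := maxn m (maxn (L i) (L i')).
  apply: le_trans (basis_constant _ (leq_maxl m (maxn (L i) (L i')))) _.
  rewrite -/l ler_wpM2l// -psumB -(subrKA x) addrC.
  have h1 : `|x - psum (u i) l| <= e i by apply: HL; rewrite /l; lia.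
  have h2 : `|x - psum (u i') l| <= e i' by apply: HL; rewrite /l; lia.
  by rewrite (le_trans (ler_normD _ _))// addrC lerD// distrC.
have cau j : cvgn (fun i => u i j).
  apply: cauchy_cvg; apply: cauchy_exP => d d0.
  have pj : 0 < `|phi j| by rewrite normr_gt0.
  pose d' := d * `|phi j| / (4 * K * 2 + 1).
  have D0 : 0 < 4 * K * 2 + 1 by rewrite ltr_wpDl// !mulr_ge0.
  have d'0 : 0 < d' by rewrite divr_gt0// mulr_gt0.
  have [N HN] := small _ d'0; exists (u N j); exists N => // i /= Ni.
  rewrite /ball/= -(ltr_pM2r pj) -normrZ.
  have -> : (u N j - u i j) *: phi j = (psum (u N) j.+1 - psum (u i) j.+1) -
      (psum (u N) j - psum (u i) j).
    rewrite !psumB /psum big_nat_recr//= addrAC subrr add0r //.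
  apply: le_lt_trans (ler_normB _ _) _.
  apply: le_lt_trans (lerD (uu _ _ _) (uu _ _ _)) _.
  have hN := HN N (leqnn N); have hi := HN i Ni.
  apply: (@le_lt_trans _ _ (4 * K * d')).
    have : K * (e N + e i) <= K * (d' + d') by rewrite ler_wpM2l// lerD.
    lra.
  rewrite /d' mulrA ltr_pdivrMr// mulrC ltr_pM2l ?mulr_gt0//.
  have : 0 <= 4 * K by rewrite mulr_ge0.
  lra.
pose al j := limn (fun i => u i j).
(* The limit of [uu] in its second index; the rate does not depend on [m]. *)
have alE m i : `|psum (u i) m - psum al m| <= K * e i.
  have ca : psum (u n) m @[n --> \oo] --> psum al m.
    by apply: cvg_psum => j; exact: cau.
  apply/ler_addgt0Pr => d d0; have K1 : 0 < K + 1 by rewrite ltr_wpDl.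
  have d2 : 0 < d / 2 by rewrite divr_gt0.
  move/cvgrPdist_le : ca => /(_ _ d2)[N _ HN].
  have [N' HN'] := small _ (divr_gt0 d2 K1).
  pose i' := maxn N N'.
  have h1 : `|psum al m - psum (u i') m| <= d / 2 by apply: HN; exact: leq_maxl.
  have h2 := HN' i' (leq_maxr _ _).
  rewrite -(subrKA (psum (u i') m)) (le_trans (ler_normD _ _))//.
  have h3 : K * e i' <= d / 2.
    apply: le_trans (ler_wpM2l K0 h2) _.
    by rewrite mulrCA ler_piMr ?(ltW d2)// ler_pdivrMr// mul1r; lra.
  have := uu i i' m; rewrite distrC in h1; move: h1 h3; rewrite mulrDr.
  by move: (`|_|) (`|_|) (K * e i) (K * e i') => p q r s; lra.
have cal : psum al m @[m --> \oo] --> x.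
  apply/cvgrPdist_le => d d0; have K1 : 0 < 1 + K by rewrite ltr_pwDl.
  have [N HN] := small _ (divr_gt0 d0 K1).
  exists (L N) => // m /= Lm; rewrite -(subrKA (psum (u N) m)).
  rewrite (le_trans (ler_normD _ _))//.
  apply: le_trans (lerD (HL N m Lm) (alE m N)) _.
  rewrite -[X in X + _]mul1r -mulrDl -ler_pdivlMl// mulrC; exact: HN.
exists al; split; first exact: cal.
(* Uniqueness: the partial sums of the difference of two expansions tend to 0, and [coef_le] bounds
   each coefficient by arbitrarily long ones. *)
move=> b bx; apply/funext => j; apply/eqP; rewrite -subr_eq0 -normr_le0.
have pj : 0 < `|phi j| by rewrite normr_gt0.
rewrite -(ler_pM2r pj) mul0r; apply/ler_addgt0Pr => d d0.
have K2 : 0 < 2 * K + 1 by rewrite ltr_wpDl// mulr_ge0.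
have h0 : psum al m - psum b m @[m --> \oo] --> (0 : X).
  by rewrite -(subrr x); exact: cvgB cal bx.
move/cvgrPdist_le : h0 => /(_ _ (divr_gt0 d0 K2))[N _ HN].
pose l := maxn N j.+1.
have := HN l (leq_maxl _ _); rewrite sub0r normrN /= => Hl.
have {}Hl : `|psum (al \- b) l| <= d / (2 * K + 1) by rewrite -psumB.
have jl : (j < l)%N by exact: leq_maxr.
rewrite add0r; apply: le_trans (coef_le (al \- b) jl) _.
apply: (le_trans (ler_wpM2l _ Hl)); first by rewrite mulr_ge0.
by rewrite mulrCA ler_piMr ?(ltW d0)// ler_pdivrMr// mul1r; lra.
Qed.
End basis_criterion.

(** * Integration on the cube *)

Section restricted_integral.
Context d (T : measurableType d) (R : realType).
Variables (m : {measure set T -> \bar R}) (D : set T) (mD : measurable D).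
Local Open Scope ereal_scope.

Lemma ge0_integral_mrestr (f : T -> \bar R) : measurable_fun setT f ->
  (forall x, 0 <= f x) ->
  \int[mrestr m mD]_x f x = \int[m]_(x in D) f x.
Proof.
move=> mf f0; have DC0 : mrestr m mD (~` D) = 0.
  by rewrite /mrestr setICl measure0.
rewrite (ge0_negligible_integral (mu := mrestr m mD) (measurableC mD))//.
rewrite setTD setCK; apply: eq_measure_integral => A mA AD.
by rewrite /= /mrestr (setIidl AD).
Qed.
End restricted_integral.

Section unit_measure.
Context {R : realType}.
Local Notation RR := (measurableTypeR R).

Definition unit_measure : set RR -> \bar R :=
  mrestr (@lebesgue_measure R) (measurable_itv `]0, 1[%R).

HB.instance Definition _ := Measure.on unit_measure.

Lemma unit_measureT : unit_measure setT = 1%E.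
Proof.
rewrite /unit_measure /mrestr setTI lebesgue_measure_itv/= lte_fin ltr01.
by rewrite oppr0 adde0.
Qed.

HB.instance Definition _ :=
  Measure_isProbability.Build _ _ _ unit_measure unit_measureT.

Lemma integral_unit_measure (f : R -> R) : continuous f -> (forall x, 0 <= f x) ->
  (\int[unit_measure]_t (f t)%:E = (\int[lebesgue_measure]_(t in `[0, 1]) f t)%:E)%E.
Proof.
move=> cf f0; have mf : measurable_fun setT (EFin \o f).
  by apply/measurable_EFinP; exact: continuous_measurable_fun.
rewrite ge0_integral_mrestr//.
rewrite /Rintegral fineK; last first.
  by apply: integrable_fin_num => //; exact: continuous_integrable.
rewrite [RHS](@integral_itv_bndoo _ 0 1)//.
exact: measurable_funTS.
Qed.
End unit_measure.

Section resampling.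
Context {R : realType}.
Local Notation RR := (measurableTypeR R).
Local Notation cube := (cube_measure R).
Local Open Scope ereal_scope.

(** The restriction of a product is identified with the product of restrictions by uniqueness on
    rectangles, which opens the way to Fubini's theorem. *)
Lemma cube_measureS n (A : set (n.+1.-tuple RR)) : measurable A ->
  cube n.+1 A = (@unit_measure R \x cube n) (@consp R n @^-1` A).
Proof.
move=> mA; have mc B : measurable B -> measurable (@consp R n @^-1` B).
  by move=> mB; rewrite -[X in measurable X]setTI; exact: measurable_consp.
have mIC : measurable (`]0%R, 1%R[%classic `*` unit_cube R n : set (RR * n.-tuple RR)).
  by apply: measurableX; [exact: measurable_itv|exact: measurable_unit_cube].
pose m' := mrestr (@lebesgue_measure R \x lebesgue_tuple R n) mIC.
rewrite (@product_measure_unique _ _ _ _ _ (@unit_measure R) (cube n) m') ?mc//.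
  rewrite /cube_measure /mrestr /= /lebesgue_cons /pushforward /m' /mrestr.
  rewrite preimage_setI; congr (_ (_ `&` _)).
  apply/seteqP; split => -[t x] /=.
    move=> h; split; first by have := h ord0; rewrite /consp tnth0 /= in_itv.
    by move=> i; have := h (lift ord0 i); rewrite /consp tnthS.
  move=> [h0 h] i; case: (unliftP ord0 i) => [j ->|->].
    by rewrite /consp tnthS; exact: h.
  by rewrite /consp tnth0; move: h0; rewrite in_itv.
move=> A1 A2 mA1 mA2.
rewrite /m' /= /mrestr -setXI product_measure1E//; last first.
  by apply: measurableI => //; exact: measurable_unit_cube.
- exact: measurableI.
- exact: mc.
Qed.

Lemma integral_cubeS n (f : n.+1.-tuple RR -> \bar R) : measurable_fun setT f ->
  (forall x, 0 <= f x) ->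
  \int[cube n.+1]_x f x =
  \int[unit_measure]_t \int[cube n]_y f (consp (t, y)).
Proof.
move=> mf f0.
have mc := @measurable_consp R n.
transitivity (\int[@unit_measure R \x cube n]_z f (consp z)); last first.
  by rewrite fubini_tonelli1//=; exact: measurableT_comp.
have f0' : {in setT, forall x, 0 <= f x} by [].
have := @ge0_integral_pushforward _ _ _ _ R _ mc (@unit_measure R \x cube n)
  setT f measurableT mf f0'.
rewrite preimage_setT => <-.
by apply: eq_measure_integral => A mA _; exact: cube_measureS.
Qed.

Definition upd n (x : n.-tuple RR) (i : 'I_n) (t : RR) : n.-tuple RR :=
  [tuple (if j == i then t else tnth x j) | j < n].

Lemma measurable_upd n i :
  measurable_fun setT (fun z : n.-tuple RR * RR => upd z.1 i z.2).
Proof.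
apply/measurable_fun_tnthP => j; rewrite /comp.
under eq_fun do rewrite tnth_mktuple.
case: eqP => _; first exact: measurable_snd.
exact: measurableT_comp (measurable_tnth j) measurable_fst.
Qed.

Lemma upd_cons0 n (s t : RR) (y : n.-tuple RR) :
  upd (consp (s, y)) ord0 t = consp (t, y).
Proof.
apply: eq_from_tnth => j; rewrite tnth_mktuple /consp.
by case: (unliftP ord0 j) => [k ->|->]; rewrite ?tnthS ?tnth0.
Qed.

Lemma upd_consS n (s t : RR) (y : n.-tuple RR) (i : 'I_n) :
  upd (consp (s, y)) (lift ord0 i) t = consp (s, upd y i t).
Proof.
apply: eq_from_tnth => j; rewrite tnth_mktuple /consp.
case: (unliftP ord0 j) => [k ->|->]; rewrite ?tnthS ?tnth0//.
by rewrite tnth_mktuple (inj_eq lift_inj).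
Qed.

(** Fubini's theorem in a form that treats all coordinates alike: coordinate [i] is not separated
    from the others but drawn anew, at no cost because [unit_measure] is a probability. *)
Lemma integral_resample n (i : 'I_n) (f : n.-tuple RR -> \bar R) :
  measurable_fun setT f -> (forall x, 0 <= f x) ->
  \int[cube n]_x f x = \int[cube n]_x \int[unit_measure]_t f (upd x i t).
Proof.
elim: n i f => [[]//|n IH] i f mf f0.
have mg : measurable_fun setT (fun x => \int[unit_measure]_t f (upd x i t)).
  apply: (@measurable_fun_fubini_tonelli_F _ _ _ _ _ (@unit_measure R)
    (fun z => f (upd z.1 i z.2))) => //.
  by apply: measurableT_comp => //; exact: measurable_upd.
have g0 x : 0 <= \int[unit_measure]_t f (upd x i t) by exact: integral_ge0.
rewrite [RHS]integral_cubeS// integral_cubeS//.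
case: (unliftP ord0 i) => [k ->|->].
  apply: eq_integral => s _.
  under [RHS]eq_integral do under eq_integral do rewrite upd_consS.
  rewrite (IH k (fun y => f (consp (s, y))))//.
  apply: measurableT_comp => //; apply: measurableT_comp; first exact: measurable_consp.
  exact: pair1_measurable.
(* For the first coordinate the integrand no longer depends on the old value [s], whose integration
   contributes the total mass 1. *)
under [RHS]eq_integral do under eq_integral do under eq_integral do rewrite upd_cons0.
rewrite [RHS]integral_cst//= unit_measureT mule1.
apply: (fubini_tonelli (fun z => f (consp z))) => //.
by apply: measurableT_comp => //; exact: measurable_consp.
Qed.
End resampling.

(** * Partial sums on the cube *)

Section bounded_restrictions.
Context {R : realType} (n : nat) (q : R).
Hypothesis q1 : 1 < q.
Local Notation RR := (measurableTypeR R).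
Local Notation cube := (cube_measure R n).
Implicit Types (s : seq (R * n.-tuple nat)) (f g : n.-tuple RR -> R).

Definition powint f : \bar R := (\int[cube]_x (`|f x| `^ q)%:E)%E.

Definition tri_sum s (x : n.-tuple RR) : R :=
  \sum_(e <- s) e.1 * triangle_prod e.2 x.

Let q0 : 0 < q. Proof. by rewrite (lt_trans ltr01). Qed.

Lemma measurable_tri_sum s : measurable_fun setT (tri_sum s).
Proof.
apply: measurable_sum => e; apply: measurable_funM => //.
exact: measurable_triangle_prod.
Qed.

Lemma measurable_pow f : measurable_fun setT f ->
  measurable_fun setT (fun x => (`|f x| `^ q)%:E).
Proof.
move=> mf; apply/measurable_EFinP.
apply: (@measurableT_comp _ _ _ _ _ _ (@powR R ^~ q)) => //.
exact: measurableT_comp.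
Qed.

Lemma powint_ge0 f : (0 <= powint f)%E.
Proof. by apply: integral_ge0 => x _; rewrite lee_fin powR_ge0. Qed.

Lemma powintD f g : measurable_fun setT f -> measurable_fun setT g ->
  (powint (fun x => f x + g x)%R <= (2 `^ q)%:E * (powint f + powint g))%E.
Proof.
move=> mf mg.
have [mf' mg'] := (measurable_pow mf, measurable_pow mg).
rewrite -ge0_integralD// -ge0_integralZl_EFin ?powR_ge0//; last first.
  exact: emeasurable_funD.
  by move=> x _; rewrite adde_ge0 ?lee_fin ?powR_ge0.
rewrite /powint; apply: ge0_le_integral => //.
- by apply: measurable_pow; exact: measurable_funD.
- by apply: measurable_funeM; exact: emeasurable_funD.
move=> x _; rewrite -EFinD -EFinM lee_fin.
apply: le_trans (powR_add_le (ltW q0) (normr_ge0 _) (normr_ge0 _)).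
by rewrite ge0_ler_powR ?nnegrE ?addr_ge0 ?(ltW q0)// ler_normD.
Qed.

Definition positive s := all (fun e : R * n.-tuple nat => all (ltn 0) e.2) s.

(* The bound [K] is uniform in [t]. *)
Definition ubounded (T : Type) (E : T -> pred (n.-tuple nat)) :=
  exists2 K : R, 0 <= K & forall t s, positive s ->
  (powint (tri_sum [seq e <- s | E t e.2]) <= K%:E * powint (tri_sum s))%E.

Lemma positive_filter (a : pred (R * n.-tuple nat)) s :
  positive s -> positive (seq.filter a s).
Proof.
rewrite /positive all_filter => /allP h; apply/allP => e /h ee /=.
by rewrite ee implybT.
Qed.

Lemma ubounded_ext (T : Type) (E F : T -> pred (n.-tuple nat)) :
  (forall t (k : n.-tuple nat), all (ltn 0) k -> E t k = F t k) -> ubounded E -> ubounded F.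
Proof.
move=> EF [K K0 HK]; exists K; [exact: K0|move=> t s s0].
suff -> : [seq e <- s | F t e.2] = [seq e <- s | E t e.2] by exact: HK.
apply: eq_in_filter => e es; rewrite EF//.
by move/allP : s0 => /(_ e es).
Qed.

Lemma ubounded_reindex (T U : Type) (h : U -> T) (E : T -> pred (n.-tuple nat)) :
  ubounded E -> ubounded (E \o h).
Proof. by move=> [K K0 HK]; exists K; [exact: K0|move=> u s; exact: (HK (h u))]. Qed.

Lemma ubounded_and (T : Type) (E F : T -> pred (n.-tuple nat)) :
  ubounded E -> ubounded F -> ubounded (fun t => [pred k | E t k && F t k]).
Proof.
move=> [K K0 HK] [L L0 HL]; exists (K * L); first by rewrite mulr_ge0.
move=> t s s0; rewrite EFinM.
rewrite (_ : seq.filter _ s = [seq e <- [seq e <- s | F t e.2] | E t e.2]); last first.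
  by rewrite -filter_predI.
apply: le_trans (HK t _ (positive_filter _ s0)) _.
by rewrite -muleA lee_wpmul2l ?lee_fin// HL.
Qed.

Lemma ubounded_not (T : Type) (E : T -> pred (n.-tuple nat)) :
  ubounded E -> ubounded (fun t => [pred k | ~~ E t k]).
Proof.
move=> [K K0 HK]; exists (2 `^ q * (1 + K)).
  by rewrite mulr_ge0 ?powR_ge0 ?addr_ge0.
move=> t s s0.
have -> : powint (tri_sum [seq e <- s | ~~ E t e.2]) =
    powint (fun x => tri_sum s x + - tri_sum [seq e <- s | E t e.2] x).
  congr powint; apply/funext => x.
  have -> : tri_sum s x = tri_sum [seq e <- s | E t e.2] x +
      tri_sum [seq e <- s | ~~ E t e.2] x.
    by rewrite /tri_sum !big_filter (bigID (fun e => E t e.2)).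
  by rewrite addrAC subrr add0r.
apply: le_trans (powintD _ _) _.
- exact: measurable_tri_sum.
- by apply: measurable_funN; exact: measurable_tri_sum.
rewrite EFinM -muleA lee_wpmul2l ?lee_fin ?powR_ge0//.
rewrite EFinD ge0_muleDl ?mul1e ?lee_fin// leeD2l//.
apply: le_trans (HK t s s0); rewrite le_eqVlt; apply/orP; left; apply/eqP.
by congr integral; apply/funext => x; rewrite normrN.
Qed.

Lemma ubounded_or (T : Type) (E F : T -> pred (n.-tuple nat)) :
  ubounded E -> ubounded F -> ubounded (fun t => [pred k | E t k || F t k]).
Proof.
move=> bE bF; apply: ubounded_ext (ubounded_not (ubounded_and
  (ubounded_not bE) (ubounded_not bF))) => t k _ /=.
by rewrite negb_and !negbK.
Qed.

Lemma ubounded_if (T : Type) (b : T -> bool) (E F : T -> pred (n.-tuple nat)) :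
  ubounded E -> ubounded F ->
  ubounded (fun t => [pred k | if b t then E t k else F t k]).
Proof.
move=> [K K0 HK] [L L0 HL]; exists (K + L); first by rewrite addr_ge0.
move=> t s s0; rewrite /=; case: (b t).
  by rewrite (le_trans (HK t s s0))// lee_wpmul2r ?powint_ge0// lee_fin lerDl.
by rewrite (le_trans (HL t s s0))// lee_wpmul2r ?powint_ge0// lee_fin lerDr.
Qed.

Lemma triangle_prod_upd (k : n.-tuple nat) (x : n.-tuple RR) i t :
  triangle_prod k (upd x i t) =
  (\prod_(j < n | j != i) triangle_wave ((tnth k j)%:R * tnth x j)) *
  triangle_wave ((tnth k i)%:R * t).
Proof.
rewrite /triangle_prod (bigD1 i)//= tnth_mktuple eqxx mulrC; congr (_ * _).
by apply: eq_bigr => j ji; rewrite tnth_mktuple (negbTE ji).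
Qed.

(** With the other coordinates frozen, a triangle sum is one-dimensional in coordinate [i], the
    other factors being absorbed in its coefficients. The one-dimensional constant does not depend
    on the coefficients, so it survives integration. *)
Lemma ubounded_slab (i : 'I_n) : ubounded (fun N => [pred k | (tnth k i <= N)%N]).
Proof.
have [K K0 HK] := @triangle_partial_sum R q q1; exists K => // N s _.
pose sl s x := [seq (e.1 * \prod_(j < n | j != i)
  triangle_wave ((tnth e.2 j)%:R * tnth x j), tnth e.2 i) | e : R * n.-tuple nat <- s].
have slE s' x t : tri_sum s' (upd x i t) = dilate_sum (@triangle_wave R) (sl s' x) t.
  rewrite /tri_sum /dilate_sum big_map; apply: eq_bigr => e _.
  by rewrite triangle_prod_upd mulrA.
have inner s' x : (\int[@unit_measure R]_t (`|tri_sum s' (upd x i t)| `^ q)%:E =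
    (\int[lebesgue_measure]_(t in `[0, 1])
      (`|dilate_sum (@triangle_wave R) (sl s' x) t| `^ q))%:E)%E.
  rewrite -integral_unit_measure.
  - by apply: eq_integral => t _; rewrite slE.
  - apply: continuous_norm_powR_fun => //; apply: continuous_dilate_sum.
    exact: continuous_triangle_wave.
  - by move=> t; exact: powR_ge0.
have minner s' : measurable_fun setT (fun x =>
    (\int[@unit_measure R]_t (`|tri_sum s' (upd x i t)| `^ q)%:E)%E).
  apply: (@measurable_fun_fubini_tonelli_F _ _ _ _ _ (@unit_measure R)
    (fun z => (`|tri_sum s' (upd z.1 i z.2)| `^ q)%:E)).
  - apply: (measurableT_comp (f := fun x => (`|tri_sum s' x| `^ q)%:E)).
      exact: measurable_pow (measurable_tri_sum s').
    exact: measurable_upd.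
  - by move=> z; rewrite lee_fin powR_ge0.
have ige0 w x : (0 <= \int[@unit_measure R]_t (`|tri_sum w (upd x i t)| `^ q)%:E)%E.
  by apply: integral_ge0 => t _; rewrite lee_fin powR_ge0.
have resE w : (powint (tri_sum w) = \int[cube]_x
    \int[@unit_measure R]_t (`|tri_sum w (upd x i t)| `^ q)%:E)%E.
  apply: (integral_resample i (f := fun x => (`|tri_sum w x| `^ q)%:E)).
    exact: measurable_pow (measurable_tri_sum w).
  by move=> x; rewrite lee_fin powR_ge0.
rewrite !resE.
rewrite -ge0_integralZl_EFin//.
apply: ge0_le_integral => //.
  exact: measurable_funeM.
move=> x _; rewrite !inner -EFinM lee_fin.
have -> : sl [seq e <- s | [pred k | (tnth k i <= N)%N] e.2] x =
    [seq e <- sl s x | (e.2 <= N)%N] by rewrite /sl filter_map.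
exact: HK.
Qed.

(** Induction on the length of the prefix: [rank2_le] reduces the condition to thresholds on the
    rank of a shorter prefix and on the next entry. The thresholds vary with [J], but the Boolean
    operations do not, hence the uniform constant. *)
Lemma ubounded_rank m : (m < n)%N ->
  ubounded (fun J => [pred k : n.-tuple nat | (rank (take m.+1 k) <= J)%N]).
Proof.
elim: m => [|m IH] mn.
  apply: ubounded_ext (ubounded_slab (Ordinal mn)) => N k _ /=.
  rewrite (tnth_nth 0%N)/=; case: k => -[|x s] /= sz.
    by exfalso; rewrite -(eqP sz) in mn.
  by rewrite take0.
have bE := IH (ltnW mn); have bF := ubounded_slab (Ordinal mn).
pose A J := (sigma2 J).1; pose B J := (sigma2 J).2.
have re (h : nat -> nat) (E : nat -> pred (n.-tuple nat)) :
  ubounded E -> ubounded (E \o h) by exact: ubounded_reindex.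
have F1 := ubounded_or
  (ubounded_and (re (fun J => (B J).-1) _ bE) (re (fun J => (B J).-1) _ bF))
  (ubounded_and (re B _ bF) (ubounded_and
    (ubounded_not (re (fun J => (B J).-1) _ bF)) (re A _ bE))).
have F2 := ubounded_and (re A _ bE) (ubounded_and (re A _ bF)
  (ubounded_not (ubounded_and (ubounded_not (re (fun J => (A J).-1) _ bE))
    (re (fun J => (B J).-1) _ bF)))).
(* Enumeration starts at 1, so [J = 0] selects no positive index; it is set apart because [sigma2 0]
   has no meaning. *)
have F0 : ubounded (fun _ : nat => pred0).
  exists 0 => // t s _; rewrite mul0e.
  rewrite (_ : seq.filter _ s = [::]); last by elim: s.
  rewrite /powint (eq_integral (fun=> 0%E)) ?integral0// => x _.
  by rewrite /tri_sum big_nil normr0 powR0 ?gt_eqF.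
have := ubounded_if (fun J => J == 0%N) F0 (ubounded_if (fun J => A J <= B J)%N F1 F2).
apply: ubounded_ext => J k k0 /=.
have mk : (m.+1 < size k)%N by rewrite size_tuple.
have st : size (take m.+1 k) = m.+1 by rewrite size_takel// ltnW.
have t0 : all (ltn 0) (take m.+1 k).
  by move: k0; rewrite -{1}(cat_take_drop m.+1 k) all_cat => /andP[].
have r0 : (0 < rank (take m.+1 k))%N by rewrite rank_gt0// st.
have b0 : (0 < nth 0 k m.+1)%N by move/all_nthP : k0; apply.
rewrite (take_nth 0%N mk) rank_rcons ?st//.
case: ifP => [/eqP ->|/negbT].
  by apply/esym/negbTE; rewrite -ltnNge rank2_gt0.
rewrite -lt0n => J0; have [A0 B0] := sigma2_gt0 J0.
rewrite -[in RHS](sigma2K J0) rank2_le// /A /B (tnth_nth 0%N) /=.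
by case: ifP.
Qed.
End bounded_restrictions.

(** * Density *)

Section thresholds.
Context {R : realType}.
Implicit Types (y z t x : R) (k m : nat).

Lemma bernoulli_lower y m : 0 <= y <= 1 -> 1 - m%:R * y <= (1 - y) ^+ m.
Proof.
move=> /andP[y0 y1]; elim: m => [|m IH]; first by rewrite mul0r subr0 expr0.
rewrite exprS; have h : (1 - y) * (1 - m%:R * y) <= (1 - y) * (1 - y) ^+ m.
  by rewrite ler_wpM2l// subr_ge0.
apply: le_trans h; rewrite -[m.+1%:R]natr1.
have : 0 <= m%:R * y * y by rewrite !mulr_ge0.
by move: (m%:R) => M; nra.
Qed.

Lemma bernoulli_upper y m : 0 <= y <= 1 -> (1 - y) ^+ m * (1 + m%:R * y) <= 1.
Proof.
move=> /andP[y0 y1]; elim: m => [|m IH]; first by rewrite mul0r addr0 mulr1.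
apply: le_trans IH; rewrite exprSr -mulrA ler_wpM2l ?exprn_ge0 ?subr_ge0//.
rewrite -[m.+1%:R]natr1.
have : 0 <= m%:R * y * y by rewrite !mulr_ge0.
by move: (m%:R) => M; nra.
Qed.

(** With [b] the square root of [y], one factor [b ^ k] compensates [k] by Bernoulli's inequality
    and the other tends to 0. *)
Lemma cvg_geometric_natM y : 0 <= y < 1 -> k%:R * y ^+ k @[k --> \oo] --> (0 : R).
Proof.
move=> /andP[y0 y1]; pose b := Num.sqrt y.
have b0 : 0 <= b by exact: sqrtr_ge0.
have bb : b ^+ 2 = y by rewrite sqr_sqrtr.
have b1 : b < 1 by nra.
have h k : 0 <= k%:R * y ^+ k <= (1 - b)^-1 * b ^+ k.
  rewrite mulr_ge0 ?exprn_ge0//= -bb -exprM mulnC exprM expr2 mulrA.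
  rewrite ler_wpM2r ?exprn_ge0// -[leRHS]mul1r ler_pdivlMr ?subr_gt0//.
  have := @bernoulli_upper (1 - b) k; rewrite subKr subr_ge0 (ltW b1)/= gerBl b0.
  move=> /(_ isT); have := exprn_ge0 k b0; move: (b ^+ k) (k%:R) => B K.
  by nra.
apply: (@squeeze_cvgr _ _ _ _ (fun=> 0) (fun k => (1 - b)^-1 * b ^+ k)).
- by near=> k; exact: h.
- exact: cvg_cst.
- rewrite -(mulr0 (1 - b)^-1); apply: cvgMl_tmp.
  by apply: cvg_expr; rewrite ger0_norm.
Unshelve. all: by end_near. Qed.

(** Of the kind used by Brosowski and Deutsch for the Stone-Weierstrass theorem: the power behaves
    like [exp (- k * (2 * z) ^ k)]. The additional factor [k] in the exponent forces the limit 0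
    also at [z = 1/2]. *)
Lemma threshold_step z : 0 <= z <= 1 ->
  (1 - z ^+ k) ^+ (k * 2 ^ k) @[k --> \oo] --> ((z < 2^-1)%R%:R : R).
Proof.
move=> /andP[z0 z1].
have zk k : 0 <= z ^+ k <= 1 by rewrite exprn_ge0//= exprn_ile1.
have zk' k : 0 <= 1 - z ^+ k <= 1.
  by have /andP[h1 h2] := zk k; rewrite subr_ge0 h2 gerBl h1.
case: ltP => z2.
  apply: (@squeeze_cvgr _ _ _ _ (fun k => 1 - k%:R * (2 * z) ^+ k) (fun=> 1)).
  - near=> k; apply/andP; split; last by have /andP[? ?] := zk' k; rewrite exprn_ile1.
    apply: le_trans (bernoulli_lower _ (zk k)).
    by rewrite lerB// natrM natrX exprMn mulrA.
  - rewrite -[X in _ --> X]subr0; apply: cvgB; first exact: cvg_cst.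
    apply: cvg_geometric_natM; rewrite mulr_ge0//=; lra.
  - exact: cvg_cst.
apply: (@squeeze_cvgr _ _ _ _ (fun=> 0) (fun k => harmonic k)).
- near=> k; have /andP[h1 h2] := zk' k; rewrite exprn_ge0//=.
  have i0 : 0 <= (2^-1 : R) by rewrite invr_ge0.
  have i1 : (2^-1 : R) <= 1 by rewrite invf_le1// ler1n.
  have hz : 0 <= (2^-1 : R) ^+ k <= 1 by rewrite exprn_ge0//= exprn_ile1.
  apply: (@le_trans _ _ ((1 - 2^-1 ^+ k) ^+ (k * 2 ^ k))).
    have h3 : (2^-1 : R) ^+ k <= z ^+ k by rewrite lerXn2r ?nnegrE ?invr_ge0.
    by rewrite lerXn2r ?nnegrE ?lerB// subr_ge0; case/andP: hz.
  rewrite /harmonic -[leRHS]mul1r ler_pdivlMr//.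
  have := bernoulli_upper (k * 2 ^ k) hz; rewrite natrM natrX -mulrA exprVn divff.
    by rewrite mulr1 nat1r.
  by rewrite expf_neq0.
- exact: cvg_cst.
- exact: cvg_harmonic.
Unshelve. all: by end_near. Qed.

Lemma cos_pi_lt x y : 0 <= x -> x < y -> y <= 1 -> cos (pi * y) < cos (pi * x).
Proof.
move=> x0 xy y1.
have p0 := pi_gt0 R.
by rewrite ltr_cos ?ltr_pM2l// in_itv/=; apply/andP; split; nra.
Qed.

Lemma threshold_poly (c : \bar R) : exists P : nat -> {poly R},
  (forall k t, -1 <= t <= 1 -> 0 <= (P k).[t] <= 1) /\
  forall x, 0 < x < 1 ->
    (P k).[cos (pi * x)] @[k --> \oo] --> ((x%:E < c)%E%:R : R).
Proof.
have [c0|c0] := leP c 0%E.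
  exists (fun=> 0); split=> [k t _|x /andP[x0 _]]; first by rewrite horner0 lexx ler01.
  under eq_fun do rewrite horner0.
  rewrite ltNge (le_trans c0) ?lee_fin ?(ltW x0)//; exact: cvg_cst.
have [c1|c1] := leP 1%E c.
  exists (fun=> 1); split=> [k t _|x /andP[_ x1]]; first by rewrite hornerC lexx ler01.
  under eq_fun do rewrite hornerC.
  rewrite (lt_le_trans _ c1) ?lte_fin//; exact: cvg_cst.
case: c c0 c1 => [c| |]//; rewrite !lte_fin => c0 c1.
(* [Z] is affine and decreasing and crosses 1/2 at [cos (pi * c)]; as the cosine decreases on
   [[0, pi]], [Z < 1/2] means [x < c]. The slope 1/4 keeps the values in [[0, 1]]. *)
have [Z ZE] : exists Z : {poly R},
    forall t, Z.[t] = 2^-1 - 4^-1 * (t - cos (pi * c)).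
  exists (2^-1%:P - 4^-1 *: ('X - (cos (pi * c))%:P)) => t.
  by rewrite !hornerE.
have Z01 t : -1 <= t <= 1 -> 0 <= Z.[t] <= 1.
  have h1 := cos_le1 (pi * c); have h2 := cos_geN1 (pi * c).
  by rewrite ZE => /andP[? ?]; apply/andP; split; lra.
exists (fun k => (1 - Z ^+ k) ^+ (k * 2 ^ k)); split=> [k t|x /andP[x0 x1]].
  move=> /Z01/andP[h0 h1]; rewrite !hornerE.
  have h : 0 <= 1 - Z.[t] ^+ k <= 1.
    by rewrite subr_ge0 exprn_ile1// gerBl exprn_ge0.
  by have /andP[? ?] := h; apply/andP; split; [exact: exprn_ge0|exact: exprn_ile1].
under eq_fun do rewrite !hornerE.
have -> : (x%:E < c%:E)%E = (Z.[cos (pi * x)] < 2^-1).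
  rewrite ZE lte_fin; have [xc|cx|->] := ltgtP x c.
  - by have := cos_pi_lt (ltW x0) xc (ltW c1); lra.
  - by have := cos_pi_lt (ltW c0) cx (ltW x1); lra.
  - lra.
by apply: threshold_step; apply: Z01; rewrite cos_geN1 cos_le1.
Qed.
End thresholds.

(** * The closure of the triangle sums in L_q *)

Section limits_of_triangle_sums.
Context {R : realType} (n : nat) (q : R).
Hypothesis q1 : 1 < q.
Local Notation RR := (measurableTypeR R).
Local Notation cube := (cube_measure R n).
Local Notation powint := (@powint R n q).
Implicit Types (s : seq (R * n.-tuple nat)) (f g G : n.-tuple RR -> R).

Let q0 : 0 < q. Proof. by rewrite (lt_trans ltr01). Qed.

Definition tri_limit f := measurable_fun setT f /\
  forall e : R, 0 < e -> exists2 s, positive s &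
    (powint (fun x => f x - tri_sum s x)%R <= e%:E)%E.

Lemma powint_le f G : measurable_fun setT f -> measurable_fun setT G ->
  (forall x, `|f x| <= `|G x|) -> (powint f <= powint G)%E.
Proof.
move=> mf mG fG; apply: ge0_le_integral => //; try exact: measurable_pow.
by move=> x _; rewrite lee_fin ge0_ler_powR ?nnegrE ?(ltW q0).
Qed.

Lemma powint_cst (d : R) : 0 <= d -> powint (fun=> d) = (d `^ q)%:E.
Proof.
move=> d0; rewrite /powint ger0_norm// integral_cst//.
by rewrite [X in (_ * X)%E](cube_measureT R n) mule1.
Qed.

Lemma powintZ (c : R) f : measurable_fun setT f ->
  powint (fun x => c * f x) = ((`|c| `^ q)%:E * powint f)%E.
Proof.
move=> mf; rewrite /powint -ge0_integralZl_EFin ?powR_ge0//; last exact: measurable_pow.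
apply: eq_integral => x _; rewrite -EFinM normrM powRM//.
Qed.

Lemma tri_limit_tri_sum s : positive s -> tri_limit (tri_sum s).
Proof.
move=> s0; split=> [|e e0]; first exact: measurable_tri_sum.
exists s => //; under eq_fun do rewrite subrr.
by rewrite powint_cst// powR0 ?gt_eqF// lee_fin ltW.
Qed.

Lemma powintD_le f g (e : R) : measurable_fun setT f -> measurable_fun setT g ->
  (powint f <= (e / 2 / 2 `^ q)%:E)%E -> (powint g <= (e / 2 / 2 `^ q)%:E)%E ->
  (powint (fun x => f x + g x)%R <= e%:E)%E.
Proof.
move=> mf mg fe ge; apply: le_trans (powintD q1 mf mg) _.
apply: (@le_trans _ _ ((2 `^ q)%:E * ((e / 2 / 2 `^ q)%:E + (e / 2 / 2 `^ q)%:E))%E).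
  by apply: lee_wpmul2l; [rewrite lee_fin powR_ge0|exact: (leeD fe ge)].
by rewrite -EFinD -EFinM lee_fin -mulrDl -splitr mulrCA divff ?mulr1// gt_eqF ?powR_gt0.
Qed.

Let half (e : R) : 0 < e -> 0 < e / 2 / 2 `^ q.
Proof. by move=> e0; rewrite !divr_gt0 ?powR_gt0. Qed.

Lemma tri_limit_closed f : measurable_fun setT f ->
  (forall e : R, 0 < e -> exists2 g, tri_limit g &
    (powint (fun x => f x - g x)%R <= e%:E)%E) -> tri_limit f.
Proof.
move=> mf H; split=> // e /half e0.
have [g [mg /(_ _ e0)[s s0 Hs]] Hg] := H _ e0; exists s => //.
have E x : f x - tri_sum s x = (f x - g x) + (g x - tri_sum s x) by rewrite subrKA.
under eq_fun do rewrite E.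
apply: (powintD_le _ _ Hg Hs); apply: measurable_funB => //.
exact: measurable_tri_sum.
Qed.

Lemma tri_limitD f g : tri_limit f -> tri_limit g -> tri_limit (fun x => f x + g x).
Proof.
move=> [mf Hf] [mg Hg]; split=> [|e /half e0]; first exact: measurable_funD.
have [[s s0 Hs] [t t0 Ht]] := (Hf _ e0, Hg _ e0).
exists (s ++ t); first by rewrite /positive all_cat; apply/andP.
have st x : tri_sum (s ++ t) x = tri_sum s x + tri_sum t x.
  by rewrite /tri_sum big_cat.
under eq_fun do rewrite st opprD addrACA.
by apply: (powintD_le _ _ Hs Ht); apply: measurable_funB => //; exact: measurable_tri_sum.
Qed.

Lemma tri_limitZ (c : R) f : tri_limit f -> tri_limit (fun x => c * f x).
Proof.
move=> [mf Hf]; split=> [|e e0]; first exact: measurable_funM.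
have c0 : 0 < `|c| `^ q + 1 by rewrite ltr_wpDl ?powR_ge0.
have [s s0 Hs] := Hf _ (divr_gt0 e0 c0).
exists [seq (c * i.1, i.2) | i <- s]; first by rewrite /positive all_map.
have sE x : tri_sum [seq (c * i.1, i.2) | i <- s] x = c * tri_sum s x.
  by rewrite /tri_sum big_map mulr_sumr; apply: eq_bigr => i _; rewrite mulrA.
under eq_fun do rewrite sE -mulrBr.
rewrite powintZ; last by apply: measurable_funB => //; exact: measurable_tri_sum.
apply: (@le_trans _ _ ((`|c| `^ q)%:E * (e / (`|c| `^ q + 1))%:E)%E).
  by rewrite lee_wpmul2l// lee_fin powR_ge0.
rewrite -EFinM lee_fin mulrCA ler_piMr ?(ltW e0)// ler_pdivrMr// mul1r lerDl//.
Qed.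

Lemma tri_limit0 : tri_limit (fun=> 0).
Proof.
have -> : (fun=> 0) = @tri_sum R n [::].
  by apply/funext => x; rewrite /tri_sum big_nil.
exact: tri_limit_tri_sum.
Qed.

Lemma tri_limit_sum (I : eqType) (r : seq I) (f : I -> n.-tuple RR -> R) :
  {in r, forall i, tri_limit (f i)} -> tri_limit (fun x => \sum_(i <- r) f i x).
Proof.
elim: r => [|i r IH] Hf.
  by under eq_fun do rewrite big_nil; exact: tri_limit0.
under eq_fun do rewrite big_cons.
apply: tri_limitD; first by apply: Hf; rewrite mem_head.
by apply: IH => j jr; apply: Hf; rewrite in_cons jr orbT.
Qed.

Lemma tri_limit_uniform f : measurable_fun setT f ->
  (forall d : R, 0 < d -> exists2 g, tri_limit g & forall x, `|f x - g x| <= d) ->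
  tri_limit f.
Proof.
move=> mf H; apply: tri_limit_closed => // e e0.
have [g Hg fg] := H (e `^ q^-1) (powR_gt0 _ e0); exists g => //.
have eE := @powR_invK _ e q (ltW e0) (lt0r_neq0 q0).
rewrite -[X in X%:E]eE -powint_cst ?powR_ge0//.
apply: powint_le => //; first by apply: measurable_funB => //; case: Hg.
by move=> x; rewrite [leRHS]ger0_norm ?powR_ge0.
Qed.

Lemma negligible_cubeC : cube (~` unit_cube R n) = 0%E.
Proof. by rewrite /cube_measure /mrestr setICl measure0. Qed.

Lemma ae_cube (P : n.-tuple RR -> Prop) :
  (forall x, unit_cube R n x -> P x) -> {ae cube, forall x, P x}.
Proof.
move=> HP; exists (~` unit_cube R n); split.
- by apply: measurableC; exact: measurable_unit_cube.
- exact: negligible_cubeC.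
- by move=> x /= nP /HP.
Qed.

Lemma tri_limit_dominated (f_ : nat -> n.-tuple RR -> R) f G :
  (forall k, tri_limit (f_ k)) -> measurable_fun setT f -> measurable_fun setT G ->
  (powint G < +oo)%E ->
  (forall x, unit_cube R n x -> f_ k x @[k --> \oo] --> f x) ->
  (forall k x, unit_cube R n x -> `|f x - f_ k x| <= G x) ->
  tri_limit f.
Proof.
move=> Hf mf mG Goo cvgf fG.
have mB k : measurable_fun setT (fun x => f x - f_ k x).
  by apply: measurable_funB => //; have [] := Hf k.
have : (powint (fun x => f x - f_ k x)%R @[k --> \oo] --> (0%E : \bar R))%classic.
  pose h k x := (`|f x - f_ k x| `^ q)%:E.
  have mh k : measurable_fun setT (h k) by exact: measurable_pow (mB k).
  have h0 : {ae cube, forall x, setT x -> h k x @[k --> \oo] --> (0%E : \bar R)}.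
    apply: ae_cube => x xC _; rewrite /h.
    have -> : 0%E = (`|(0 : R)| `^ q)%:E :> \bar R by rewrite normr0 powR0 ?gt_eqF.
    apply/fine_cvgP; split; first exact: nearW.
    have cc := @continuous_norm_powR_fun R R q id q0 (fun z => cvg_id) (0 : R).
    have fx : f x - f_ k x @[k --> \oo] --> 0.
      by rewrite -(subrr (f x)); apply: cvgB; [exact: cvg_cst|exact: cvgf].
    exact: (cvg_comp _ _ fx cc).
  have iG : cube.-integrable setT (fun x => (`|G x| `^ q)%:E).
    apply/integrableP; split; first exact: measurable_pow.
    rewrite (eq_integral (fun x => (`|G x| `^ q)%:E))// => x _.
    by rewrite gee0_abs// lee_fin powR_ge0.
  have hG : {ae cube, forall x, forall k, setT x -> (`|h k x| <= (`|G x| `^ q)%:E)%E}.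
    apply: ae_cube => x xC k _; rewrite /h gee0_abs ?lee_fin ?powR_ge0//.
    rewrite ge0_ler_powR ?nnegrE ?(ltW q0)// (le_trans (fG k x xC))// ler_norm//.
  have [_ _] := dominated_convergence measurableT mh (measurable_cst 0%E) h0 iG hG.
  by rewrite integral_cst// mul0e.
move=> c0; apply: tri_limit_closed => // e e0.
have : (0%E < e%:E)%E by rewrite lte_fin.
move=> /(@open_ereal_lt' R 0%E e%:E) /c0[N _ HN].
by exists (f_ N) => //; apply: ltW; exact: HN (leqnn N).
Qed.
End limits_of_triangle_sums.

Section product_limits.
Context {R : realType} (n : nat) (q : R).
Hypothesis q1 : 1 < q.
Local Notation RR := (measurableTypeR R).
Local Notation tri_limit := (@tri_limit R n q).
Local Notation S := (@triangle_wave R).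
Implicit Types (k : n.-tuple nat) (x : n.-tuple RR).

Lemma measurable_prod_tnth (f : 'I_n -> R -> R) :
  (forall i, measurable_fun setT (f i)) ->
  measurable_fun setT (fun x => \prod_(i < n) f i (tnth x i)).
Proof.
move=> mf; apply: measurable_prod => i _.
by apply: measurableT_comp; [exact: mf|exact: measurable_tnth].
Qed.

(** The waves are replaced by the [f i] one coordinate at a time; [mix m] has the first [m]
    replaced. All other factors are bounded by 1, so a uniform error in one coordinate is no larger
    for the product. *)
Lemma tri_limit_prod (f : 'I_n -> R -> R) :
  (forall i, measurable_fun setT (f i)) ->
  (forall i t, `|f i t| <= 1) -> (forall i, tri_approx (f i)) ->
  tri_limit (fun x => \prod_(i < n) f i (tnth x i)).
Proof.
move=> mf f1 af.
pose term m k (i : 'I_n) (t : R) := if (i < m)%N then f i t else S ((tnth k i)%:R * t).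
pose mix m k x := \prod_(i < n) term m k i (tnth x i).
suff main m k : (m <= n)%N -> all (ltn 0) k -> tri_limit (mix m k).
  pose k1 := [tuple of nseq n 1%N].
  have -> : (fun x => \prod_(i < n) f i (tnth x i)) = mix n k1.
    by apply/funext => x; apply: eq_bigr => i _; rewrite /term ltn_ord.
  by apply: main => //; rewrite all_nseq orbT.
have mterm m' k' i : measurable_fun setT (term m' k' i).
  rewrite /term; case: (i < m')%N; first exact: mf.
  by apply: (measurableT_comp (@measurable_triangle_wave R)); exact: measurable_funM.
elim: m k => [|m IH] k mn k0.
  have -> : mix 0%N k = tri_sum [:: (1, k)].
    by apply/funext => x; rewrite /tri_sum big_seq1 mul1r.
  by apply: tri_limit_tri_sum => //; rewrite /positive /= k0.
pose i0 := Ordinal mn.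
pose setk c := [tuple (if j == i0 then c else tnth k j) | j < n].
pose Q x := \prod_(i < n | i != i0) term m.+1 k i (tnth x i).
have mixS x : mix m.+1 k x = f i0 (tnth x i0) * Q x.
  by rewrite /mix (bigD1 i0)//= {1}/term /= ltnSn.
have mixc c x : mix m (setk c) x = S (c%:R * tnth x i0) * Q x.
  rewrite /mix (bigD1 i0)//= {1}/term /= ltnn tnth_mktuple eqxx; congr (_ * _).
  apply: eq_bigr => j ji; rewrite /term tnth_mktuple (negbTE ji).
  have jm : (j < m.+1)%N = (j < m)%N.
    rewrite [LHS]ltnS leq_eqVlt; case: eqP => // jm; case/eqP: ji.
    exact: val_inj.
  by rewrite jm.
have Q1 x : `|Q x| <= 1.
  rewrite normr_prod; apply: prodr_ile1 => i _; rewrite normr_ge0 /term.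
  by case: ifP => _; [exact: f1|exact: triangle_wave_le1].
apply: (tri_limit_uniform q1).
  by rewrite /mix; apply: measurable_prod_tnth => i; exact: mterm.
move=> d d0; have [l l0 Hl] := af i0 _ d0.
exists (fun x => \sum_(e <- l) e.1 * mix m (setk e.2) x).
  apply: (tri_limit_sum q1) => e el; apply: tri_limitZ; apply: IH (ltnW mn) _.
  apply/allP => c /tnthP[j ->]; rewrite tnth_mktuple; case: eqP => _.
    by move/allP : l0 => /(_ e el).
  by move/allP : k0 => /(_ _ (mem_tnth j k)).
move=> x; rewrite mixS; under eq_bigr do rewrite mixc mulrA.
rewrite -mulr_suml -mulrBl normrM -[leRHS]mulr1 ler_pM//.
Qed.

Definition sinprod x : R := \prod_(i < n) sinpi (tnth x i).

Lemma measurable_sinpi : measurable_fun setT (@sinpi R).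
Proof. by apply: continuous_measurable_fun; exact: continuous_sinpi. Qed.

Lemma measurable_sinprod : measurable_fun setT sinprod.
Proof. by apply: (@measurable_prod_tnth (fun=> @sinpi R)) => _; exact: measurable_sinpi. Qed.

Lemma sinpi01 (t : R) : 0 < t < 1 -> 0 < sinpi t <= 1.
Proof.
move=> /andP[t0 t1]; rewrite sin_le1 andbT sin_gt0_pi//.
by have p0 := pi_gt0 R; rewrite mulr_gt0//= gtr_pMr.
Qed.

Lemma sinprod_gt0 x : unit_cube R n x -> 0 < sinprod x.
Proof. by move=> xC; apply: prodr_gt0 => i _; have /andP[] := sinpi01 (xC i). Qed.

Lemma sinprod_le1 x : `|sinprod x| <= 1.
Proof.
rewrite normr_prod; apply: prodr_ile1 => i _; rewrite normr_ge0.
by rewrite ler_norml sin_geN1 sin_le1.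
Qed.

(** These boxes are stable under intersection and generate the sigma-algebra; a bound [+oo] leaves
    its coordinate free. *)
Definition low_box (b : 'I_n -> \bar R) : set (n.-tuple RR) :=
  [set x | forall i, ((tnth x i : R)%:E < b i)%E].

Lemma measurable_low_box b : measurable (low_box b).
Proof.
have -> : low_box b = box (fun i => [set t : RR | ((t : R)%:E < b i)%E]) by [].
apply: measurable_box => i.
have := emeasurable_fun_infty_o measurableT (@EFin_measurable R setT) (b i).
by rewrite setTI.
Qed.

(** The threshold polynomials take values in [[0, 1]] on the range of the cosine, so the products
    stay bounded by 1 while converging pointwise on the cube. *)
Lemma tri_limit_low_box b :
  tri_limit (fun x => \1_(low_box b) x * sinprod x).
Proof.
have /choice[P HP] := fun i => threshold_poly (b i).
pose f_ m i (t : R) := (P i m).[cos (pi * t)] * sinpi t.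
have P1 i m t : 0 <= (P i m).[cos (pi * t)] <= 1.
  by apply: (HP i).1; rewrite cos_geN1 cos_le1.
have f1 m i t : `|f_ m i t| <= 1.
  rewrite /f_ normrM mulr_ile1//.
    by have /andP[p0 p1] := P1 i m t; rewrite ger0_norm.
  by rewrite ler_norml sin_geN1 sin_le1.
have mf m i : measurable_fun setT (f_ m i).
  apply: continuous_measurable_fun; apply: continuousM_fun; last exact: continuous_sinpi.
  apply: (continuous_comp_fun (@continuous_horner R (P i m))).
  apply: (continuous_comp_fun (@continuous_cos R)).
  by apply: continuousM_fun; [exact: continuous_cst_fun|move=> z; exact: cvg_id].
apply: (@tri_limit_dominated _ _ _ q1 (fun m x => \prod_(i < n) f_ m i (tnth x i)) _ (cst 2)).
- move=> m; apply: tri_limit_prod => // i; exact: tri_approx_horner.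
- apply: measurable_funM; last exact: measurable_sinprod.
  by apply: measurable_indic; exact: measurable_low_box.
- exact: measurable_cst.
- by rewrite powint_cst// ltry.
- move=> x xC.
  have -> : \1_(low_box b) x * sinprod x =
      \prod_(i < n) (((tnth x i : R)%:E < b i)%E%:R * sinpi (tnth x i)).
    rewrite big_split /=; congr (_ * _); rewrite indicE.
    have [/set_mem xb|/negP xb] := boolP (x \in low_box b).
      by rewrite big1// => i _; rewrite (xb i).
    have [i xi] : exists i, ~~ ((tnth x i : R)%:E < b i)%E.
      by apply/not_existsP => h; apply: xb; apply/mem_set => i; apply/negPn/negP/h.
    by rewrite (bigD1 i)//= (negbTE xi) mul0r.
  apply: cvg_big => [|i _]; first exact: mul_continuous.
  by apply: cvgMr_tmp; exact: ((HP i).2 _ (xC i)).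
- move=> m x xC; apply: le_trans (ler_normB _ _) _.
  rewrite (_ : cst 2 x = 1 + 1 :> R)// lerD//.
    rewrite normrM mulr_ile1// ?sinprod_le1// indicE.
    by case: (_ \in _); rewrite ?normr1 ?normr0.
  rewrite normr_prod; apply: prodr_ile1 => i _; rewrite normr_ge0; exact: f1.
Qed.
End product_limits.

(** * From boxes to arbitrary functions of L_q *)

Section density.
Import HBNNSimple.
Context {R : realType} (n : nat) (q : R).
Hypothesis q1 : 1 < q.
Local Notation RR := (measurableTypeR R).
Local Notation powint := (@powint R n q).
Local Notation tri_limit := (@tri_limit R n q).
Local Notation g := (@sinprod R n).
Implicit Types (x : n.-tuple RR) (f : n.-tuple RR -> R).

Definition low_boxes : set (set (n.-tuple RR)) := range (@low_box R n).

Lemma low_boxI : setI_closed low_boxes.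
Proof.
move=> _ _ [b _ <-] [c _ <-]; exists (fun i => Order.min (b i) (c i)) => //.
apply/seteqP; split=> x /=.
  by move=> h; split=> i; have := h i; rewrite lt_min => /andP[].
by move=> [hb hc] i; rewrite lt_min hb hc.
Qed.

(** The identity is measurable from the generated sigma-algebra as soon as each coordinate is, and a
    half-line condition on one coordinate is itself a box, free in the others. *)
Lemma measurable_low_boxes (A : set (n.-tuple RR)) :
  measurable A -> <<s low_boxes >> A.
Proof.
pose T := g_sigma_algebraType low_boxes.
have mid : measurable_fun setT ((fun x => x) : T -> n.-tuple RR).
  apply/measurable_fun_tnthP => i.
  apply: (measurability _ (RGenInftyO.measurableE R)) => _ [_ [b ->] <-].
  apply: sub_sigma_algebra; exists (fun j => if j == i then b%:E else +oo%E) => //.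
  rewrite setTI; apply/seteqP; split=> x /=.
    by move=> /(_ i); rewrite eqxx lte_fin in_itv.
  rewrite in_itv/= => xb j; case: eqP => [->|_]; first by rewrite lte_fin.
  exact: ltry.
move=> mA; have := mid measurableT A mA; rewrite setTI; exact.
Qed.

(** Dynkin's theorem: proper differences are handled by linearity, increasing unions by dominated
    convergence. *)
Lemma tri_limit_indic (A : set (n.-tuple RR)) : measurable A ->
  tri_limit (fun x => \1_A x * g x).
Proof.
move=> mA; pose H : set (set (n.-tuple RR)) :=
  [set B | measurable B /\ tri_limit (fun x => \1_B x * g x)].
suff : <<s low_boxes >> `<=` H by move=> /(_ A (measurable_low_boxes mA))[].
apply: (lambda_system_subset low_boxI); last by [].
- split; [by []| | |].
  + split; first exact: measurableT.
    have -> : [set: n.-tuple RR] = @low_box R n (fun=> +oo%E).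
      by apply/seteqP; split=> // x _ i; exact: ltry.
    exact: tri_limit_low_box.
  + move=> B C CB [mB HB] [mC HC]; split; first exact: measurableD.
    have E x : \1_(B `\` C) x * g x = \1_B x * g x + -1 * (\1_C x * g x).
      rewrite mulN1r -mulrBl; congr (_ * _); rewrite !indicE in_setD.
      have [xC|xC] := boolP (x \in C); last by rewrite andbT subr0.
      by have /mem_set -> : B x; [apply: CB; exact: set_mem|rewrite /= subrr].
    by under eq_fun do rewrite E; apply: (tri_limitD q1 HB); exact: tri_limitZ.
  + move=> F ndF HF; have mF : measurable (\bigcup_i F i).
      by apply: bigcupT_measurable => i; exact: (HF i).1.
    split=> //; apply: (@tri_limit_dominated _ _ _ q1 (fun i x => \1_(F i) x * g x) _ (cst 2)).
    * by move=> i; exact: (HF i).2.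
    * by apply: measurable_funM; [exact: measurable_indic|exact: measurable_sinprod].
    * exact: measurable_cst.
    * by rewrite powint_cst// ltry.
    * move=> x _; apply: cvgMr_tmp.
      have [[i _ Fix]|Fx] := pselect ((\bigcup_i F i) x).
        rewrite [X in _ --> X]indicE mem_set; last by exists i.
        apply: cvg_near_cst; exists i => // j /= ij.
        rewrite indicE mem_set//.
        by move: x Fix; apply/subsetPset/ndF.
      rewrite [X in _ --> X]indicE memNset//.
      apply: cvg_near_cst; apply: nearW => j.
      by rewrite indicE memNset// => Fjx; apply: Fx; exists j.
    * move=> i x _; rewrite -mulrBl normrM -[leRHS]mulr1 ler_pM ?sinprod_le1//.
      rewrite !indicE; case: (_ \in _); case: (_ \in _);
        rewrite ?subrr ?subr0 ?sub0r ?normrN ?normr1 ?normr0 ?ler1n//.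
- by move=> _ [b _ <-]; split; [exact: measurable_low_box|exact: tri_limit_low_box].
Qed.

Lemma tri_limit_nnsfun (h : {nnsfun (n.-tuple RR) >-> R}) :
  tri_limit (fun x => h x * g x).
Proof.
under eq_fun do rewrite fimfunE fsbig_finite//= mulr_suml.
apply: (tri_limit_sum q1) => y _; under eq_fun do rewrite -mulrA.
by apply: tri_limitZ; apply: tri_limit_indic; exact: measurable_sfunP.
Qed.

(** Simple functions [h k] increasing to [f / g] give [h k * g] increasing to [f] on the cube, with
    [f] itself as dominating function. Off the cube [g] may vanish or be negative; dividing by its
    absolute value keeps the quotient nonnegative. *)
Lemma tri_limit_ge0 f : measurable_fun setT f -> (forall x, 0 <= f x) ->
  (powint f < +oo)%E -> tri_limit f.
Proof.
move=> mf f0 foo; pose v x := f x * `|g x| `^ (-1); pose u x := (v x)%:E.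
have mg := @measurable_sinprod R n.
have mu : measurable_fun setT u.
  apply/measurable_EFinP; apply: measurable_funM => //.
  apply: (@measurableT_comp _ _ _ _ _ _ (@powR R ^~ (-1))) => //.
  exact: measurableT_comp.
have u0 x : setT x -> (0 <= u x)%E by rewrite lee_fin mulr_ge0 ?powR_ge0.
pose h := nnsfun_approx measurableT mu.
have vg x : unit_cube R n x -> v x * g x = f x.
  move=> xC; have g0 := sinprod_gt0 xC.
  by rewrite /v ger0_norm ?(ltW g0)// powR_inv1 ?(ltW g0)// divfK// gt_eqF.
have hu k x : h k x <= v x.
  rewrite -lee_fin; apply: cvge_to_ge (cvg_nnsfun_approx measurableT mu u0 (x := x) I) _.
  exists k => // m /= km; rewrite lee_fin.
  by have /lefP := nd_nnsfun_approx measurableT mu km.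
apply: (@tri_limit_dominated _ _ _ q1 (fun k x => h k x * g x) _ f) => //.
- by move=> k; exact: tri_limit_nnsfun.
- move=> x xC; rewrite -[X in _ --> X](vg x xC); apply: cvgMr_tmp.
  have := cvg_nnsfun_approx measurableT mu u0 (x := x) I.
  by move=> /fine_cvgP[].
- move=> k x xC; have g0 := sinprod_gt0 xC.
  have h1 : h k x * g x <= f x by rewrite -[leRHS](vg x xC) ler_pM2r.
  by rewrite ger0_norm ?subr_ge0// gerBl mulr_ge0 ?(ltW g0).
Qed.

Lemma tri_limit_Lq f : measurable_fun setT f -> (powint f < +oo)%E -> tri_limit f.
Proof.
move=> mf foo.
have E : f = (fun x => f^\+ x + -1 * f^\- x).
  by apply/funext => x; rewrite mulN1r -[in LHS](funrposBneg f).
have mp := measurable_funrpos mf; have mn := measurable_funrneg mf.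
have fE x : f^\+ x + f^\- x = `|f x|.
  exact: (congr1 (fun F => F x) (funrposDneg f)).
rewrite E; apply: (tri_limitD q1); last apply: tri_limitZ.
- apply: (tri_limit_ge0 mp); first by move=> x; exact: funrpos_ge0.
  apply: le_lt_trans foo; apply: (powint_le q1 mp mf) => x.
  by rewrite ger0_norm ?funrpos_ge0// -fE lerDl funrneg_ge0.
- apply: (tri_limit_ge0 mn); first by move=> x; exact: funrneg_ge0.
  apply: le_lt_trans foo; apply: (powint_le q1 mn mf) => x.
  by rewrite ger0_norm ?funrneg_ge0// -fE lerDr funrpos_ge0.
Qed.
End density.

(** * The triangle system *)

Section triangle_prefixes.
Context {R : realType} (n : nat) (q : R).
Hypothesis q1 : 1 < q.
Local Notation RR := (measurableTypeR R).
Local Notation X := (Lq_cube n q1).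
Local Notation Lf := (LfunType (cube_measure R n) (ltr1_lee1_fin q1)).
Local Notation powint := (@powint R n q).
Implicit Types (k : n.-tuple nat) (a : nat -> R).

Let q0 : 0 < q. Proof. by rewrite (lt_trans ltr01). Qed.

Lemma powint_Lclass (f : Lf) : powint f = (`|Lclass f| `^ q)%:E.
Proof.
rewrite Lspace_normE -poweR_EFin (finite_norm_fine f) powR_Lnorm ?gt_eqF//.
Qed.

Lemma measurable_Lfun (f : Lf) : measurable_fun setT f.
Proof. exact: (@measurable_funPT _ _ _ _ f). Qed.

Definition triangle_prefix a l : seq (R * n.-tuple nat) :=
  [seq (a j, square_order n j.+1) | j <- iota 0 l].

Lemma Lclass_triangle_prefix a l : exists2 F : Lf,
  (F : n.-tuple RR -> R) = tri_sum (triangle_prefix a l) &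
  \sum_(0 <= j < l) a j *: triangle_Lq q1 (square_order n j.+1) = Lclass F.
Proof.
elim: l => [|l [F FE IH]].
  exists 0; last by rewrite big_geq.
  by apply/funext => x; rewrite /tri_sum big_nil.
rewrite big_nat_recr//= IH /triangle_Lq LspaceZ LspaceD.
eexists; last reflexivity.
have iE : iota 0 l.+1 = iota 0 l ++ [:: l] by rewrite -addn1 iotaD.
apply/funext => x; rewrite /= FE /tri_sum /triangle_prefix iE.
by rewrite map_cat big_cat /= big_seq1.
Qed.

Lemma triangle_wave_neq0 (t : R) : 0 < t -> t < 2^-1 -> triangle_wave t != 0.
Proof.
move=> t0 t1; have f0 : Num.floor t = 0.
  by apply/floor_def; rewrite add0r (ltW t0) (lt_trans t1)// invf_lt1// ltr1n.
by rewrite /triangle_wave f0 expr0z mul1r subr0 /tent ltW// mulf_neq0// gt_eqF.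
Qed.

(** On the box of sides [1 / (2 * k_i)] at the origin every factor is on its first rising branch,
    hence nonzero, and the box has positive measure. *)
Lemma triangle_Lq_neq0 k : all (ltn 0) k -> triangle_Lq q1 k != 0.
Proof.
move=> k0; apply/eqP => /(LclassP _ (0 : Lf)) ae0.
pose b i : R := (2 * (tnth k i)%:R)^-1.
have ki i : 0 < (tnth k i)%:R :> R.
  by rewrite ltr0n; move/allP : k0 => /(_ _ (mem_tnth i k)).
have b0 i : 0 < b i by rewrite invr_gt0 mulr_gt0.
pose A := @box R n (fun i => `]0, b i[%classic).
have mA : measurable A by apply: measurable_box => i; exact: measurable_itv.
have AC : A `<=` unit_cube R n.
  move=> x xA i; have /= := xA i; rewrite in_itv/= => /andP[-> xb] /=.
  apply: lt_le_trans xb _; rewrite invf_le1 ?mulr_gt0//.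
  have : 1 <= (tnth k i)%:R :> R.
    by rewrite ler1n; move/allP : k0 => /(_ _ (mem_tnth i k)).
  lra.
have : cube_measure R n A = 0%E.
  apply/negligibleP => //; apply: negligibleS ae0 => x xA /= /(_ I) /eqP.
  apply/negP; apply/prodf_neq0 => i _ /=.
  have /= := xA i; rewrite in_itv/= => /andP[xi xb].
  apply: triangle_wave_neq0; first by rewrite mulr_gt0.
  by move: xb; rewrite /b -(ltr_pM2l (ki i)) invfM mulrCA divff ?gt_eqF// mulr1.
rewrite /cube_measure /mrestr (setIidl AC) lebesgue_tuple_box; last first.
  by move=> i; exact: measurable_itv.
under eq_bigr do rewrite lebesgue_measure_itv/= lte_fin b0 sube0.
rewrite prodEFin => h.
have : 0 < \prod_(i < n) b i by rewrite prodr_gt0.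
by rewrite (EFin_inj h) ltxx.
Qed.
End triangle_prefixes.

Section assembly.
Context {R : realType} (n : nat) (q : R).
Hypothesis q1 : 1 < q.
Local Notation RR := (measurableTypeR R).
Local Notation N := n.+1.
Local Notation X := (Lq_cube N q1).
Local Notation Lf := (LfunType (cube_measure R N) (ltr1_lee1_fin q1)).
Local Notation powint := (@powint R N q).
Local Notation prefix := (@triangle_prefix R N).
Implicit Types (k : N.-tuple nat) (a : nat -> R).

Let q0 : 0 < q. Proof. by rewrite (lt_trans ltr01). Qed.

Lemma positive_prefix a l : positive (prefix a l).
Proof.
rewrite /positive all_map; apply/allP => j _ /=.
by have [] := @rank_square_orderS n j.+1 isT.
Qed.

(** Along the enumeration the rank is the position, so cutting a sum at [m] is the restriction
    controlled by [ubounded_rank]. *)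
Lemma filter_prefix a m l : (m <= l)%N ->
  [seq e <- prefix a l | (rank (take N (e.2 : N.-tuple nat)) <= m)%N] = prefix a m.
Proof.
move=> ml; rewrite /triangle_prefix filter_map -(filter_iota_ltn 0 ml) add0n.
congr map; apply: eq_filter => j /=.
rewrite take_oversize ?size_tuple//.
by have [-> _] := @rank_square_orderS n j.+1 isT.
Qed.

Lemma prefix_basis_constant : exists2 K : R, 0 <= K & forall a m l, (m <= l)%N ->
  `|\sum_(0 <= j < m) a j *: triangle_Lq q1 (square_order N j.+1)| <=
  K * `|\sum_(0 <= j < l) a j *: triangle_Lq q1 (square_order N j.+1)|.
Proof.
have [K K0 HK] := @ubounded_rank R N q q1 n (ltnSn n).
exists (K `^ q^-1); first exact: powR_ge0.
move=> a m l ml; have [F FE ->] := @Lclass_triangle_prefix R N q q1 a m.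
have [G GE ->] := @Lclass_triangle_prefix R N q q1 a l.
have := HK m _ (positive_prefix a l).
rewrite filter_prefix// -FE -GE !powint_Lclass -EFinM lee_fin => h.
have {}h : (`|Lclass F| `^ q) `^ q^-1 <= (K * `|Lclass G| `^ q) `^ q^-1.
  by rewrite ge0_ler_powR ?nnegrE ?mulr_ge0 ?powR_ge0 ?invr_ge0 ?(ltW q0).
move: h; rewrite powRM ?powR_ge0// -!powRrM divff ?gt_eqF//.
by rewrite !powRr1.
Qed.

(** An index may occur several times in [s]: its coefficients are added up at the position given by
    its rank, and the largest rank bounds the length. *)
Lemma tri_sum_prefix (s : seq (R * N.-tuple nat)) : positive s ->
  exists a l, tri_sum s = tri_sum (prefix a l).
Proof.
move=> s0; pose l := \max_(e <- s) rank (e.2 : N.-tuple nat).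
exists (fun j => \sum_(e <- s | rank (e.2 : N.-tuple nat) == j.+1) e.1), l.
apply/funext => x; rewrite /tri_sum big_map.
have -> : \sum_(j <- iota 0 l) (\sum_(e <- s | rank (e.2 : N.-tuple nat) == j.+1) e.1) *
      triangle_prod (square_order N j.+1) x =
    \sum_(j < l) \sum_(e <- s | rank (e.2 : N.-tuple nat) == j.+1) e.1 * triangle_prod e.2 x.
  rewrite -(big_mkord xpredT (fun j => \sum_(e <- s |
    rank (e.2 : N.-tuple nat) == j.+1) e.1 * triangle_prod e.2 x)).
  rewrite /index_iota subn0; apply: eq_bigr => j _; rewrite mulr_suml.
  rewrite big_seq_cond [RHS]big_seq_cond; apply: eq_bigr => e /andP[es /eqP ej].
  rewrite -ej /= square_orderS_rank//.
  by move/allP : s0 => /(_ e es).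
rewrite (exchange_big_dep xpredT)//= big_seq [RHS]big_seq; apply: eq_bigr => e es.
have e0 : all (ltn 0) e.2 by move/allP : s0 => /(_ e es).
have r0 : (0 < rank e.2)%N by rewrite rank_gt0 ?size_tuple.
have rl : ((rank e.2).-1 < l)%N.
  rewrite prednK// /l.
  exact: (@leq_bigmax_seq _ s xpredT (fun e : R * N.-tuple nat => rank e.2) e es isT).
rewrite (big_pred1 (Ordinal rl))// => j /=.
by rewrite -{1}(prednK r0) eqSS eq_sym.
Qed.

Lemma dense_prefixes (x : X) (e : R) : 0 < e -> exists a l,
  `|x - \sum_(0 <= j < l) a j *: triangle_Lq q1 (square_order N j.+1)| <= e.
Proof.
move=> e0; rewrite -(LreprK x); set f := Lrepr x.
have foo : (powint f < +oo)%E by rewrite powint_Lclass ltry.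
have [_ H] := tri_limit_Lq q1 (measurable_Lfun f) foo.
have [s s0 Hs] := H (e `^ q) (powR_gt0 _ e0).
have [a [l E]] := tri_sum_prefix s0; exists a, l.
have [F FE ->] := @Lclass_triangle_prefix R N q q1 a l.
rewrite -[- Lclass F]scaleN1r LspaceZ LspaceD.
have : (powint (f + -1 *: F)%R <= (e `^ q)%:E)%E.
  apply: le_trans Hs; rewrite le_eqVlt; apply/orP; left; apply/eqP.
  by congr (powint _); apply/funext => y /=; rewrite E -FE scaleN1r.
rewrite powint_Lclass lee_fin => h.
rewrite leNgt; apply/negP => eu.
have := gt0_ltr_powR q0 _ _ eu; rewrite !nnegrE (ltW e0) normr_ge0.
by move=> /(_ isT isT); rewrite ltNge h.
Qed.

Lemma triangle_schauder_basis :
  schauder_basis (X := X) (fun j : nat => triangle_Lq q1 (square_order N j.+1)).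
Proof.
have [K K0 HK] := prefix_basis_constant.
apply: (@schauder_basis_criterion R X _ K K0).
- by move=> j; apply: triangle_Lq_neq0; have [] := @rank_square_orderS n j.+1 isT.
- exact: HK.
- exact: dense_prefixes.
Qed.
End assembly.

Theorem corollary3p6 (R : realType) (n : nat) (q : R)
    (n_gt0 : (0 < n)%N) (q_gt1 : 1 < q) :
  schauder_basis (X := Lq_cube n q_gt1)
    (fun j : nat => triangle_Lq q_gt1 (square_order n j.+1)).
Proof. by case: n n_gt0 => // n _; exact: triangle_schauder_basis. Qed.
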